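(* Let $\kappa>0$ be the coercivity constant of $a_\epsilon$, let $M_{k_2},\tilde M_{k_1}>0$ be the constants in the lift-operator bounds and $C_P$ the constant in the discrete Poincaré inequality (all specified in the context). Assume that $\sigma\ge M_{k_2}^2/d$, $\tilde\sigma\ge \tilde M_{k_1}^2$, $0<\delta\le \kappa/(2d)$, $\bm u^0\in L^2(\Omega)^d$, and $\bm f^n\in L^2(\Omega)^d$ for $1\le n\le N_T$. Then the discontinuous Galerkin pressure correction scheme described in the context is unconditionally stable: for all $\tau>0$ and all $1\le m\le N_T$, $$\|\bm u_h^m\|^2+\frac{\kappa\mu}{2}\,\tau\sum_{n=1}^m\|\bm v_h^n\|_{\mathrm{DG}}^2+\frac12\tau^2|\xi_h^m|_{\mathrm{DG}}^2+\frac{1}{\delta\mu}\tau\|S_h^m\|^2\le \|\bm u^0\|^2+\frac{2C_P^2}{\kappa\mu}\,\tau\sum_{n=1}^m\|\bm f^n\|^2 .$$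
   Context: **Mesh and spaces.** $d\in\{2,3\}$, $\Omega\subset\mathbb R^d$ is an open bounded polyhedral domain, $\mu>0$ is the viscosity, $T>0$, $\tau=T/N_T$ is the time step, $t^n=n\tau$, $\bm f^n=\bm f(t^n)$. $(\cdot,\cdot)$ and $\|\cdot\|$ are the $L^2(\Omega)$ inner product and norm. $\mathcal E_h$ is a family of regular partitions of $\Omega$ in the sense of Ciarlet: $h_E/\rho_E\le\rho$ for all $E\in\mathcal E_h$ with $\rho$ independent of $h$, where $h_E=\mathrm{diam}(E)$, $\rho_E$ is the maximal diameter of a ball inscribed in $E$, $h=\max_E h_E$. $\Gamma_h$ is the set of interior faces; sums over $e\in\Gamma_h\cup\partial\Omega$ run over all interior and boundary faces; $h_e=|e|^{1/(d-1)}$. An interior face $e=\partial E_e^1\cap\partial E_e^2$ has unit normal $\bm n_e$ pointing from $E_e^1$ to $E_e^2$, and $\{\theta\}=\frac12(\theta|_{E_e^1}+\theta|_{E_e^2})$, $[\theta]=\theta|_{E_e^1}-\theta|_{E_e^2}$. On a boundary face, $\bm n_e$ is the outward normal and $\{\theta\}=[\theta]=\theta|_{E_e}$. $\bm X=\{\bm v\in L^2(\Omega)^d:\bm v|_E\in W^{2,2d/(d+1)}(E)^d\ \forall E\}$. For integers $k_1\ge1$, $k_2\ge0$ with $k_1-1\le k_2\le k_1+1$: $\bm X_h=\{\bm v_h\in L^2(\Omega)^d:\bm v_h|_E\in\mathbb P_{k_1}(E)^d\ \forall E\}$, $M_h=\{q_h\in L^2(\Omega):q_h|_E\in\mathbb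 P_{k_2}(E)\ \forall E\}$, $M_{h0}=\{q_h\in M_h:\int_\Omega q_h=0\}$. $\nabla_h$, $\nabla_h\cdot$ are the broken gradient and divergence. **Forms.** With penalty parameters $\sigma,\tilde\sigma>0$ and $\epsilon\in\{-1,0,1\}$: $$a_\epsilon(\bm v,\bm\theta)=\sum_E\int_E\nabla\bm v:\nabla\bm\theta-\sum_{e\in\Gamma_h\cup\partial\Omega}\int_e\{\nabla\bm v\}\bm n_e\cdot[\bm\theta]+\epsilon\sum_{e\in\Gamma_h\cup\partial\Omega}\int_e\{\nabla\bm\theta\}\bm n_e\cdot[\bm v]+\sum_{e\in\Gamma_h\cup\partial\Omega}\frac{\sigma}{h_e}\int_e[\bm v]\cdot[\bm\theta],$$ $$b(\bm\theta,q)=\sum_E\int_E(\nabla\cdot\bm\theta)q-\sum_{e\in\Gamma_h\cup\partial\Omega}\int_e\{q\}[\bm\theta]\cdot\bm n_e,$$ $$a_{\mathrm{ellip}}(\phi,q)=\sum_E\int_E\nabla\phi\cdot\nabla q-\sum_{e\in\Gamma_h}\int_e\{\nabla\phi\}\cdot\bm n_e[q]-\sum_{e\in\Gamma_h}\int_e\{\nabla q\}\cdot\bm n_e[\phi]+\sum_{e\in\Gamma_h}\frac{\tilde\sigma}{h_e}\int_e[\phi][q],$$ $$a_{\mathcal C}(\bm z;\bm w,\bm v,\bm\theta)=\sum_E\Big(\int_E(\bm w\cdot\nabla\bm v)\cdot\bm\theta+\frac12\int_E(\nabla\cdot\bm w)\,\bm v\cdot\bm\theta\Big)-\frac12\sum_{e\in\Gamma_h\cup\partial\Omega}\int_e[\bm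 w]\cdot\bm n_e\{\bm v\cdot\bm\theta\}+\sum_E\int_{\partial E_-^{\bm z}}|\{\bm w\}\cdot\bm n_E|(\bm v^{\mathrm{int}}-\bm v^{\mathrm{ext}})\cdot\bm\theta^{\mathrm{int}},$$ where $\bm n_E$ is the outward normal to $E$, int/ext denote traces on $\partial E$ from inside/outside $E$ ($\bm v^{\mathrm{ext}}=\bm 0$ on $\partial\Omega$), and $\partial E_-^{\bm z}=\{x\in\partial E:\{\bm z(x)\}\cdot\bm n_E<0\}$. **Norms and coercivity (standing assumption).** $\|\bm\theta\|_{\mathrm{DG}}^2=\sum_E\|\nabla\bm\theta\|_{L^2(E)}^2+\sum_{e\in\Gamma_h\cup\partial\Omega}\frac{\sigma}{h_e}\|[\bm\theta]\|_{L^2(e)}^2$ and $|q|_{\mathrm{DG}}^2=\sum_E\|\nabla q\|_{L^2(E)}^2+\sum_{e\in\Gamma_h}\frac{\tilde\sigma}{h_e}\|[q]\|_{L^2(e)}^2$. It is assumed (penalties large enough) that $a_\epsilon(\bm\theta_h,\bm\theta_h)\ge\kappa\|\bm\theta_h\|_{\mathrm{DG}}^2$ for all $\bm\theta_h\in\bm X_h$, with $\kappa=1$ if $\epsilon=1$ and $\kappa=1/2$ if $\epsilon\in\{-1,0\}$, and $a_{\mathrm{ellip}}(q_h,q_h)\ge\frac12|q_h|_{\mathrm{DG}}^2$ for all $q_h\in M_h$. **Lift operators and constants.** $R_h([\bm\theta_h])\in M_h$ is defined by $(R_h([\bm\theta_h]),q_h)=\sum_{e\in\Gamma_h\cup\partial\Omega}\int_e\{q_h\}[\bm\theta_h]\cdot\bm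 n_e$ for all $q_h\in M_h$; $\bm G_h([q_h])\in\bm X_h$ by $(\bm G_h([q_h]),\bm\theta_h)=\sum_{e\in\Gamma_h}\int_e\{\bm\theta_h\}\cdot\bm n_e[q_h]$ for all $\bm\theta_h\in\bm X_h$. $M_{k_2},\tilde M_{k_1}>0$ are constants independent of $h$ (depending on $k_2$, $k_1$ respectively) with $\|R_h([\bm\theta_h])\|\le M_{k_2}(\sum_{e\in\Gamma_h\cup\partial\Omega}h_e^{-1}\|[\bm\theta_h]\|_{L^2(e)}^2)^{1/2}$ and $\|\bm G_h([q_h])\|\le\tilde M_{k_1}(\sum_{e\in\Gamma_h}h_e^{-1}\|[q_h]\|_{L^2(e)}^2)^{1/2}$. $C_P$ is the constant (independent of $h,\tau$) with $\|\bm\theta\|\le C_P\|\bm\theta\|_{\mathrm{DG}}$ for all $\bm\theta\in\bm X$. **Scheme.** $\delta>0$ is a parameter. Set $p_h^0=\phi_h^0=0$, and let $\bm u_h^0\in\bm X_h$ be the elementwise $L^2$ projection of $\bm u^0$. For $n=1,\dots,N_T$: find $\bm v_h^n\in\bm X_h$ with $$(\bm v_h^n,\bm\theta_h)+\tau a_{\mathcal C}(\bm u_h^{n-1};\bm u_h^{n-1},\bm v_h^n,\bm\theta_h)+\tau\mu a_\epsilon(\bm v_h^n,\bm\theta_h)=(\bm u_h^{n-1},\bm\theta_h)+\tau b(\bm\theta_h,p_h^{n-1})+\tau(\bm f^n,\bm\theta_h)\quad\forall\bm\theta_h\in\bm X_h;$$ find $\phi_h^n\in M_{h0}$ with $a_{\mathrm{ellip}}(\phi_h^n,q_h)=-\frac1\tau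 b(\bm v_h^n,q_h)$ for all $q_h\in M_{h0}$; then find $p_h^n\in M_h$, $\bm u_h^n\in\bm X_h$ with $(p_h^n,q_h)=(p_h^{n-1},q_h)+(\phi_h^n,q_h)-\delta\mu\,b(\bm v_h^n,q_h)$ for all $q_h\in M_h$ and $(\bm u_h^n,\bm\theta_h)=(\bm v_h^n,\bm\theta_h)+\tau b(\bm\theta_h,\phi_h^n)$ for all $\bm\theta_h\in\bm X_h$. **Auxiliary functions.** $S_h^0=0$, $S_h^n=\delta\mu\sum_{i=1}^n(\nabla_h\cdot\bm v_h^i-R_h([\bm v_h^i]))$ for $n\ge1$; $\xi_h^0=0$, $\xi_h^n=p_h^n+S_h^n$ for $n\ge1$. *)

(* Defs.v *)
From HB Require Import structures.
From mathcomp Require Import all_boot all_order all_algebra.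
From mathcomp Require Import all_classical all_reals all_analysis.

Set Implicit Arguments.
Unset Strict Implicit.
Unset Printing Implicit Defensive.

Import Order.TTheory GRing.Theory Num.Theory.
Import numFieldNormedType.Exports.

Local Open Scope classical_set_scope.
Local Open Scope ring_scope.

Section measurable_rV.
Context {R : realType} (n : nat).
Let coord (i : 'I_n) (x : 'rV[R]_n) : R := x 0 i.

Let rV_set0 : g_sigma_preimage coord set0.
Proof. exact: sigma_algebra0. Qed.

Let rV_setC A : g_sigma_preimage coord A -> g_sigma_preimage coord (~` A).
Proof. exact: sigma_algebraC. Qed.

Let rV_bigcup (F : (set 'rV[R]_n)^nat) :
  (forall i, g_sigma_preimage coord (F i)) ->
  g_sigma_preimage coord (\bigcup_i (F i)).
Proof. exact: sigma_algebra_bigcup. Qed.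

(* Borel sigma-algebra of R^n, generated by the coordinates. *)
HB.instance Definition _ := @isMeasurable.Build default_measure_display
  'rV[R]_n (g_sigma_preimage coord) rV_set0 rV_setC rV_bigcup.

Lemma measurable_coord (i : 'I_n) :
  measurable_fun [set: 'rV[R]_n] (fun x : 'rV[R]_n => x 0 i).
Proof.
move=> _ Y mY; rewrite setTI; apply: sub_sigma_algebra => /=.
rewrite -bigcup_seq/=; exists i => /=; first by rewrite mem_index_enum.
by exists Y => //; rewrite setTI.
Qed.

Lemma measurable_fun_rV d (T : measurableType d) (f : T -> 'rV[R]_n) :
  (forall i, measurable_fun [set: T] (fun t => f t 0 i)) ->
  measurable_fun [set: T] f.
Proof.
move=> mf.
have fsub : g_sigma_preimage (fun i => coord i \o f) `<=` measurable.
  apply: smallest_sub; first exact: sigma_algebra_measurable.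
  rewrite -bigcup_seq => A [i _] [B mB <-]; exact: mf.
rewrite g_sigma_preimage_comp in fsub.
by move=> _ A mA; apply: fsub; exists A.
Qed.

End measurable_rV.

Section lebesgue_step.
Context {R : realType} (n : nat).

Definition rV_cons (p : measurableTypeR R * 'rV[R]_n) : 'rV[R]_n.+1 :=
  row_mx (p.1 : R)%:M p.2 : 'rV[R]_(1 + n).

Definition rV_uncons (x : 'rV[R]_n.+1) : measurableTypeR R * 'rV[R]_n :=
  (x 0 0, rsubmx (x : 'rV[R]_(1 + n))).

Lemma rV_consK : cancel rV_cons rV_uncons.
Proof.
move=> [t y]; rewrite /rV_cons /rV_uncons row_mxKr; congr pair.
have := row_mxEl (t%:M : 'rV_1) y 0 0; rewrite [RHS]mxE mulr1n => e; rewrite -[RHS]e.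
by have -> : lshift n 0 = 0 :> 'I_(1 + n) by apply: val_inj.
Qed.

Lemma rV_unconsK : cancel rV_uncons rV_cons.
Proof.
move=> x; rewrite /rV_cons /rV_uncons /=.
have -> : (x 0 0)%:M = lsubmx (x : 'rV[R]_(1 + n)).
  apply/rowP => i; rewrite !mxE (ord1 i) mulr1n.
  by have -> : lshift n 0 = 0 :> 'I_(1 + n) by apply: val_inj.
exact: (hsubmxK (x : 'rV[R]_(1 + n))).
Qed.

Lemma measurable_rV_cons : measurable_fun [set: measurableTypeR R * 'rV[R]_n] rV_cons.
Proof.
apply: measurable_fun_rV => i.
case: (split_ordP (i : 'I_(1 + n))) => j ->.
  apply: (eq_measurable_fun fst) => // p _.
  have e := row_mxEl ((p.1 : R)%:M : 'rV[R]_1) p.2 0 j.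
  by apply: etrans (esym e); rewrite (ord1 j) mxE.
apply: (eq_measurable_fun (fun p : measurableTypeR R * 'rV[R]_n => p.2 0 j)).
  by move=> p _; exact: (esym (row_mxEr ((p.1 : R)%:M : 'rV[R]_1) p.2 0 j)).
exact: (measurableT_comp (measurable_coord j) measurable_snd).
Qed.

Lemma measurable_rV_uncons : measurable_fun [set: 'rV[R]_n.+1] rV_uncons.
Proof.
apply/measurable_fun_pairP; split; first exact: (measurable_coord ord0).
apply: measurable_fun_rV => i.
apply: (eq_measurable_fun (fun x : 'rV[R]_n.+1 => x 0 (rshift 1 i))).
  by move=> x _; rewrite /= mxE.
exact: (measurable_coord (rshift 1 i)).
Qed.

Variable m : {sigma_finite_measure set 'rV[R]_n -> \bar R}.

Definition lebesgue_step : set 'rV[R]_n.+1 -> \bar R :=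
  pushforward (@lebesgue_measure R \x m)%E rV_cons.

Let lebesgue_step0 : lebesgue_step set0 = 0%E.
Proof. by rewrite /lebesgue_step /pushforward preimage_set0 measure0. Qed.

Let lebesgue_step_ge0 A : (0 <= lebesgue_step A)%E.
Proof. exact: (measure_ge0 (lebesgue_measure \x m)%E). Qed.

Let lebesgue_step_sigma_additive : semi_sigma_additive lebesgue_step.
Proof.
move=> F mF tF mUF; rewrite /lebesgue_step /pushforward preimage_bigcup.
have mcons B : measurable B -> measurable (rV_cons @^-1` B).
  by move=> mB; rewrite -[X in measurable X]setTI; exact: measurable_rV_cons.
apply: (measure_semi_sigma_additive (s := (lebesgue_measure \x m)%E)).
- by move=> k; exact: mcons.
- apply/trivIsetP => i j _ _ ij; rewrite -preimage_setI.
  by move/trivIsetP : tF => /(_ _ _ _ _ ij) -> //; rewrite preimage_set0.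
- by rewrite -preimage_bigcup; exact: mcons.
Qed.

HB.instance Definition _ := isMeasure.Build _ _ _ lebesgue_step
  lebesgue_step0 lebesgue_step_ge0 lebesgue_step_sigma_additive.

Let lebesgue_step_sigma_finite : sigma_finite setT lebesgue_step.
Proof.
have /sigma_finiteP[F [FT ndF Foo]] := sigma_finiteT (@lebesgue_measure R).
have /sigma_finiteP[G [GT ndG Goo]] := sigma_finiteT m.
exists (fun k => rV_uncons @^-1` (F k `*` G k)).
  rewrite -preimage_bigcup predeqE => x; split=> // _.
  have [i _ Fi] : (\bigcup_i F i) (rV_uncons x).1 by rewrite -FT.
  have [j _ Gj] : (\bigcup_i G i) (rV_uncons x).2 by rewrite -GT.
  exists (maxn i j) => //; split.
    by move: Fi; exact/subsetPset/ndF/leq_maxl.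
  by move: Gj; exact/subsetPset/ndG/leq_maxr.
move=> k; have [mF Fk] := Foo k; have [mG Gk] := Goo k; split.
  by rewrite -[X in measurable X]setTI; apply: measurable_rV_uncons => //;
    exact: measurableX.
rewrite /lebesgue_step /pushforward -comp_preimage.
have -> : rV_uncons \o rV_cons = id by apply/funext => p /=; rewrite rV_consK.
by rewrite preimage_id product_measure1E// lte_mul_pinfty// ge0_fin_numE.
Qed.

HB.instance Definition _ := Measure_isSigmaFinite.Build _ _ _ lebesgue_step
  lebesgue_step_sigma_finite.

End lebesgue_step.

(* Lebesgue measure on R^n, as the n-fold product of [lebesgue_measure]
   transported to row vectors. *)
Fixpoint lebesgue_rV (R : realType) (n : nat) :
    {sigma_finite_measure set 'rV[R]_n -> \bar R} :=
  match n with
  | 0 => @dirac _ 'rV[R]_0 0 R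
  | n'.+1 => lebesgue_step (lebesgue_rV R n')
  end.

Section euclidean.
Context {R : realType} {d : nat}.
Local Notation pt := 'rV[R]_d.
Local Notation leb := (lebesgue_rV R d).

Definition dotv (x y : pt) : R := \sum_i x 0 i * y 0 i.

(* Euclidean norm; the library norm on ['rV[R]_d] is the sup norm. *)
Definition enorm (x : pt) : R := Num.sqrt (dotv x x).

Definition frob (A B : 'M[R]_d) : R := \sum_i \sum_j A i j * B i j.

Definition mulv (A : 'M[R]_d) (x : pt) : pt := x *m A^T.

Definition ediam (A : set pt) : R := sup [set enorm (x - y) | x in A & y in A].

(* Largest diameter of a ball inscribed in [A]. *)
Definition inball_diam (A : set pt) : R :=
  sup [set 2 * r | r in
    [set r : R | 0 <= r /\ exists c, [set y | enorm (y - c) <= r] `<=` A]].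

Definition convex_polytope (A : set pt) : Prop :=
  [/\ exists s : seq (pt * R), A = [set x | all (fun p => dotv p.1 x <= p.2) s],
      bounded_set A & interior A !=set0].

(* [interior (closure Omega) = Omega] rules out cracks: a polyhedral domain lies
   locally on one side of the faces of its boundary. *)
Definition polyhedral_domain (Omega : set pt) : Prop :=
  [/\ open Omega, connected Omega, bounded_set Omega, Omega !=set0 &
      interior (closure Omega) = Omega /\
      exists (T : finType) (P : T -> set pt),
        (forall t, convex_polytope (P t)) /\ closure Omega = \bigcup_t P t].

(* Surface integral over a subset [A] of the hyperplane [dotv n x = c], where
   [n] is a unit vector.  The (d-1)-dimensional Lebesgue (= Hausdorff) measure
   of [A] is the d-dimensional Lebesgue measure of the right prism of height 1
   over [A]. *)
Definition plane_proj (n : pt) (c : R) (x : pt) : pt := x - (dotv n x - c) *: n.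

Definition prism (n : pt) (c : R) (A : set pt) : set pt :=
  [set x | 0 <= dotv n x - c <= 1 /\ A (plane_proj n c x)].

Definition surface_int (n : pt) (c : R) (A : set pt) (f : pt -> R) : R :=
  \int[leb]_(x in prism n c A) f (plane_proj n c x).

Definition partial (j : 'I_d) (f : pt -> R) (x : pt) : R :=
  'D_(delta_mx 0 j) f x.

Definition gradv (f : pt -> R) (x : pt) : pt := \row_j partial j f x.

Definition jac (v : pt -> pt) (x : pt) : 'M[R]_d :=
  \matrix_(i, j) partial j (fun y => v y 0 i) x.

Definition divg (v : pt -> pt) (x : pt) : R := \tr (jac v x).

(* Polynomial functions of total degree at most [k]. *)
Definition poly_fun (k : nat) (f : pt -> R) : Prop :=
  exists c : {ffun 'I_d -> 'I_k.+1} -> R,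
    f = fun x => \sum_(a : {ffun 'I_d -> 'I_k.+1} | (\sum_i a i <= k)%N)
                   c a * \prod_i x 0 i ^+ a i.

Definition poly_vec (k : nat) (v : pt -> pt) : Prop :=
  forall i, poly_fun k (fun x => v x 0 i).

Definition Lp (U : set pt) (p : R) (g : pt -> R) : Prop :=
  measurable_fun U g /\ (\int[leb]_(x in U) (`|g x| `^ p)%:E < +oo)%E.

Definition L2vec (U : set pt) (v : pt -> pt) : Prop :=
  forall i, Lp U 2 (fun x => v x 0 i).

Definition L2norm (U : set pt) (v : pt -> pt) : R :=
  Num.sqrt (\int[leb]_(x in U) dotv (v x) (v x)).

Fixpoint Ck (k : nat) (f : pt -> R) : Prop :=
  continuous f /\
  match k with
  | 0 => True
  | k'.+1 => forall j, (forall x, derivable f x (delta_mx 0 j)) /\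
                       Ck k' (partial j f)
  end.

Definition test_function (U : set pt) (phi : pt -> R) : Prop :=
  [/\ forall k, Ck k phi, compact (closure [set x | phi x != 0]) &
      closure [set x | phi x != 0] `<=` U].

Definition weak_partial (U : set pt) (j : 'I_d) (g h : pt -> R) : Prop :=
  forall phi, test_function U phi ->
    \int[leb]_(x in U) (g x * partial j phi x) =
    - \int[leb]_(x in U) (h x * phi x).

(* [g] is in W^{2,p}(U), with weak first derivatives [Dg]. *)
Definition W2p (U : set pt) (p : R) (g : pt -> R) (Dg : 'I_d -> pt -> R) :
    Prop :=
  [/\ Lp U p g,
      forall j, Lp U p (Dg j) /\ weak_partial U j g (Dg j) &
      forall j l, exists h, Lp U p h /\ weak_partial U l (Dg j) h].

End euclidean.

(* An interior face [e] is shared by [elt1 e] and [E2], where [elt2 e = Some E2];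
   [elt2 e = None] on a boundary face.  The unit normal [nrm e] points out of [elt1 e], and the face
   lies in the hyperplane [dotv (nrm e) x = off e]. *)
Record mesh (R : realType) (d : nat) := Mesh {
  elt : finType;
  face : finType;
  elt1 : face -> elt;
  elt2 : face -> option elt;
  nrm : face -> 'rV[R]_d;
  off : face -> R }.

Section dg.
Context {R : realType} {d : nat}.
Local Notation pt := 'rV[R]_d.
Local Notation leb := (lebesgue_rV R d).
Variable M : mesh R d.
Implicit Types (E : elt M) (e : face M).

Definition adj E e : bool := (elt1 e == E) || (elt2 e == Some E).

Definition sgn E e : R := if elt1 e == E then 1 else -1.

Definition nrmE E e : pt := sgn E e *: nrm e.

Definition cell E : set pt :=
  [set x | forall e, adj E e -> dotv (nrmE E e) x <= sgn E e * off e].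

Definition facet E e : set pt := cell E `&` [set x | dotv (nrm e) x = off e].

Definition fset e : set pt := facet (elt1 e) e.

Definition interior_face e : bool := isSome (elt2 e).

(* Conforming partition (in the sense of Ciarlet) of [closure Omega] into convex
   polytopes.  The third clause says that no face of an element is redundant:
   each one is genuinely (d-1)-dimensional. *)
Definition mesh_of (Omega : set pt) : Prop :=
  [/\ (forall e, dotv (nrm e) (nrm e) = 1) /\
        (forall e, elt2 e <> Some (elt1 e)),
      forall E, bounded_set (cell E) /\ interior (cell E) !=set0,
      forall E e, adj E e -> exists2 x, facet E e x &
        forall e', adj E e' -> e' != e -> dotv (nrmE E e') x < sgn E e' * off e',
      (forall E E', E != E' -> interior (cell E) `&` interior (cell E') = set0) /\
        \bigcup_E cell E = closure Omega &
      forall e, if elt2 e is Some E' then facet (elt1 e) e = facet E' e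
                else fset e `<=` closure Omega `\` Omega].

Definition face_int e (f : pt -> R) : R :=
  surface_int (nrm e) (off e) (fset e) f.

Definition elt_int E (f : pt -> R) : R := \int[leb]_(x in cell E) f x.

Definition h_face e : R := face_int e (fun=> 1) `^ (d.-1%:R)^-1.

Section traces.
Context {V : lmodType R}.
Implicit Type q : elt M -> pt -> V.

Definition avg e q (x : pt) : V :=
  if elt2 e is Some E2 then 2^-1 *: (q (elt1 e) x + q E2 x) else q (elt1 e) x.

Definition jump e q (x : pt) : V :=
  if elt2 e is Some E2 then q (elt1 e) x - q E2 x else q (elt1 e) x.

(* Trace on the face [e] of [E] from outside [E]. *)
Definition ext E e q (x : pt) : V :=
  if elt1 e == E then (if elt2 e is Some E2 then q E2 x else 0)
  else q (elt1 e) x.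

End traces.

(* A function on Omega that is smooth on each element is represented by one
   function per element; the values on the boundary of the element are the trace
   taken from inside.  Since elements have nonempty interior, a broken polynomial
   has a unique representative satisfying [in_Xh] or [in_Mh]. *)
Definition bscal := elt M -> pt -> R.
Definition bvec := elt M -> pt -> pt.

Definition in_Xh (k1 : nat) (v : bvec) : Prop := forall E, poly_vec k1 (v E).
Definition in_Mh (k2 : nat) (q : bscal) : Prop := forall E, poly_fun k2 (q E).
Definition in_Mh0 (k2 : nat) (q : bscal) : Prop :=
  in_Mh k2 q /\ \sum_E elt_int E (q E) = 0.

Definition sdot (q r : bscal) : R := \sum_E elt_int E (fun x => q E x * r E x).
Definition vdot (v w : bvec) : R :=
  \sum_E elt_int E (fun x => dotv (v E x) (w E x)).
Definition snorm (q : bscal) : R := Num.sqrt (sdot q q).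
Definition vnorm (v : bvec) : R := Num.sqrt (vdot v v).

Definition bjac (v : bvec) : elt M -> pt -> 'M[R]_d := fun E => jac (v E).
Definition bgrad (q : bscal) : bvec := fun E => gradv (q E).
Definition bdiv (v : bvec) : bscal := fun E => divg (v E).

Definition a_eps (sigma eps : R) (v t : bvec) : R :=
  \sum_E elt_int E (fun x => frob (bjac v E x) (bjac t E x))
  - \sum_e face_int e (fun x =>
      dotv (mulv (avg e (bjac v) x) (nrm e)) (jump e t x))
  + eps * \sum_e face_int e (fun x =>
      dotv (mulv (avg e (bjac t) x) (nrm e)) (jump e v x))
  + \sum_e sigma / h_face e * face_int e (fun x =>
      dotv (jump e v x) (jump e t x)).

Definition b_form (t : bvec) (q : bscal) : R :=
  \sum_E elt_int E (fun x => bdiv t E x * q E x)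
  - \sum_e face_int e (fun x => avg e q x * dotv (jump e t x) (nrm e)).

Definition a_ellip (sigmat : R) (phi q : bscal) : R :=
  \sum_E elt_int E (fun x => dotv (bgrad phi E x) (bgrad q E x))
  - \sum_(e | interior_face e) face_int e (fun x =>
      dotv (avg e (bgrad phi) x) (nrm e) * jump e q x)
  - \sum_(e | interior_face e) face_int e (fun x =>
      dotv (avg e (bgrad q) x) (nrm e) * jump e phi x)
  + \sum_(e | interior_face e) sigmat / h_face e * face_int e (fun x =>
      jump e phi x * jump e q x).

(* The part of the face [e] of [E] on which [z] is inflow for [E]. *)
Definition inflow E e (z : bvec) : set pt :=
  fset e `&` [set x | dotv (avg e z x) (nrmE E e) < 0].

Definition a_C (z w v t : bvec) : R :=
  \sum_E (elt_int E (fun x => dotv (mulv (bjac v E x) (w E x)) (t E x))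
          + 2^-1 * elt_int E (fun x => bdiv w E x * dotv (v E x) (t E x)))
  - 2^-1 * \sum_e face_int e (fun x =>
      dotv (jump e w x) (nrm e) * avg e (fun E y => dotv (v E y) (t E y)) x)
  + \sum_E \sum_(e | adj E e)
      surface_int (nrm e) (off e) (inflow E e z) (fun x =>
        `|dotv (avg e w x) (nrmE E e)| * dotv (v E x - ext E e v x) (t E x)).

(* DG norm of a broken field [t] with broken gradient [Dt]. *)
Definition dg_norm (sigma : R) (t : bvec) (Dt : elt M -> pt -> 'M[R]_d) : R :=
  Num.sqrt (\sum_E elt_int E (fun x => frob (Dt E x) (Dt E x))
            + \sum_e sigma / h_face e * face_int e (fun x =>
                dotv (jump e t x) (jump e t x))).

Definition dg_norm_h (sigma : R) (t : bvec) : R := dg_norm sigma t (bjac t).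

Definition dg_seminorm (sigmat : R) (q : bscal) : R :=
  Num.sqrt (\sum_E elt_int E (fun x => dotv (bgrad q E x) (bgrad q E x))
            + \sum_(e | interior_face e) sigmat / h_face e *
                face_int e (fun x => jump e q x ^+ 2)).

(* [f] takes on the faces of [E] the trace of a function of W^{1,1} with weak
   derivatives [Df]: it is the limit in L^1 of the restrictions of C^1 functions
   that converge to [f] in W^{1,1}. *)
Definition has_trace E (f : pt -> R) (Df : 'I_d -> pt -> R) : Prop :=
  exists phi : nat -> pt -> R,
    [/\ forall k, Ck 1 (phi k),
        (\int[leb]_(x in interior (cell E)) (`|phi k x - f x|)%:E)%E
          @[k --> \oo] --> 0%E,
        forall j, (\int[leb]_(x in interior (cell E))
          (`|partial j (phi k) x - Df j x|)%:E)%E @[k --> \oo] --> 0%E &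
        forall e, adj E e ->
          (\int[leb]_(x in prism (nrm e) (off e) (fset e))
            (`|phi k (plane_proj (nrm e) (off e) x)
               - f (plane_proj (nrm e) (off e) x)|)%:E)%E
            @[k --> \oo] --> 0%E].

(* The broken Sobolev space X: [t] is in L^2 and elementwise in W^{2,2d/(d+1)},
   with broken weak gradient [Dt].  A representative is chosen that is Borel and
   takes on the boundary of each element the values of its trace. *)
Definition in_X (t : bvec) (Dt : elt M -> pt -> 'M[R]_d) : Prop :=
  forall E i,
    let f := fun x => t E x 0 i in
    let Df := fun (j : 'I_d) x => Dt E x i j in
    [/\ measurable_fun setT f,
        Lp (interior (cell E)) 2 f,
        W2p (interior (cell E)) ((2 * d)%:R / d.+1%:R) f Df &
        has_trace E f Df].

Definition is_lift_R (k2 : nat) (t : bvec) (r : bscal) : Prop :=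
  in_Mh k2 r /\ forall q, in_Mh k2 q ->
    sdot r q =
    \sum_e face_int e (fun x => avg e q x * dotv (jump e t x) (nrm e)).

Definition lift_R (k2 : nat) (t : bvec) : bscal := get [set r | is_lift_R k2 t r].

Definition is_lift_G (k1 : nat) (q : bscal) (g : bvec) : Prop :=
  in_Xh k1 g /\ forall t, in_Xh k1 t ->
    vdot g t = \sum_(e | interior_face e)
                 face_int e (fun x => dotv (avg e t x) (nrm e) * jump e q x).

Definition lift_G (k1 : nat) (q : bscal) : bvec := get [set g | is_lift_G k1 q g].

Record pressure_correction (k1 k2 : nat) (mu sigma sigmat eps delta tau : R)
    (NT : nat) (u0 : pt -> pt) (f : nat -> pt -> pt)
    (v u : nat -> bvec) (phi p : nat -> bscal) : Prop := PressureCorrection {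
  pc_p0 : p 0%N = (fun _ _ => 0);
  pc_phi0 : phi 0%N = (fun _ _ => 0);
  pc_u0_Xh : in_Xh k1 (u 0%N);
  pc_u0 : forall E t, poly_vec k1 t ->
    elt_int E (fun x => dotv (u 0%N E x) (t x)) =
    elt_int E (fun x => dotv (u0 x) (t x));
  pc_v_Xh : forall n, (1 <= n <= NT)%N -> in_Xh k1 (v n);
  pc_v : forall n t, (1 <= n <= NT)%N -> in_Xh k1 t ->
    vdot (v n) t + tau * a_C (u n.-1) (u n.-1) (v n) t
      + tau * mu * a_eps sigma eps (v n) t
    = vdot (u n.-1) t + tau * b_form t (p n.-1) + tau * vdot (fun=> f n) t;
  pc_phi_Mh0 : forall n, (1 <= n <= NT)%N -> in_Mh0 k2 (phi n);
  pc_phi : forall n q, (1 <= n <= NT)%N -> in_Mh0 k2 q ->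
    a_ellip sigmat (phi n) q = - (tau^-1 * b_form (v n) q);
  pc_p_Mh : forall n, (1 <= n <= NT)%N -> in_Mh k2 (p n);
  pc_p : forall n q, (1 <= n <= NT)%N -> in_Mh k2 q ->
    sdot (p n) q
    = sdot (p n.-1) q + sdot (phi n) q - delta * mu * b_form (v n) q;
  pc_u_Xh : forall n, (1 <= n <= NT)%N -> in_Xh k1 (u n);
  pc_u : forall n t, (1 <= n <= NT)%N -> in_Xh k1 t ->
    vdot (u n) t = vdot (v n) t + tau * b_form t (phi n) }.

Definition S_aux (k2 : nat) (delta mu : R) (v : nat -> bvec) (n : nat) : bscal :=
  fun E x => delta * mu *
    \sum_(1 <= i < n.+1) (bdiv (v i) E x - lift_R k2 (v i) E x).

Definition xi_aux (k2 : nat) (delta mu : R) (v : nat -> bvec) (p : nat -> bscal)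
    (n : nat) : bscal :=
  fun E x => if n is 0 then 0 else p n E x + S_aux k2 delta mu v n E x.

End dg.

(* Main.v *)
(* With the lifts, [b(t, q) = (div t - R[t], q) = - (t, grad q - G[q])] on the
   discrete spaces, the second identity by integration by parts on each element.
   The pressure update then reads [xi^n = xi^(n-1) + phi^n], and [S^n] increases by
   [delta mu (div v^n - R[v^n])].  Test the momentum equation with [v^n]: the upwind
   convection form is nonnegative on the diagonal, and
   [2 tau b(v^n, p^(n-1)) = - 2 tau^2 a(phi^n, xi^(n-1)) - 2 tau (div v^n - R[v^n], S^(n-1))]
   telescopes against the squares [tau^2 a(xi^n, xi^n)] and [tau/(delta mu) |S^n|^2].
   Their quadratic remainders are absorbed as follows: [tau^2 a(phi^n, phi^n)] by the
   velocity update, since [|grad phi - G[phi]|^2 <= a(phi, phi)] when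
   [sigmat >= Mtk1^2]; and [tau delta mu |div v^n - R[v^n]|^2] by half of the viscous
   term, since [|div v - R[v]|^2 <= 2 d |v|_DG^2] when [sigma >= Mk2^2 / d] and
   [2 d delta <= kappa].

   The surface integrals are Lebesgue integrals over prisms, so the divergence theorem
   on a polytope [K] has to be proved: differentiate the integral over [K] along
   translations; up to slabs near its edges, the symmetric difference of [K] and its
   translate by [w / k] is a union of thin prisms over the facets.  The existence of
   the lifts, which are Hilbert epsilon terms in the statement, follows from linear
   algebra on the monomial basis of each element. *)

From HB Require Import structures.
Require Import Defs.
From mathcomp Require Import all_boot all_order all_algebra.
From mathcomp Require Import all_classical all_reals all_analysis.
From mathcomp Require Import measurable_realfun ring lra.

Import Order.TTheory GRing.Theory Num.Theory.
Import numFieldNormedType.Exports.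

Local Open Scope classical_set_scope.
Local Open Scope ring_scope.

Set Implicit Arguments.
Unset Strict Implicit.
Unset Printing Implicit Defensive.

(** * Lebesgue measure on row vectors *)

(** The quantity that telescopes is [a(xi, xi)], not the seminorm of [xi]: the symmetry of the
    elliptic form produces the cross term [2 a(phi, xi)], and coercivity is applied once, at the
    last time level, whence the factor 1/2 in front of the seminorm. The potential equation can be
    tested only with functions of zero mean, so [xi] must first be shown to be a sum of the [phi].
    Two kinds of integrands occur. Discrete ones are measurable and locally bounded, a class stable
    under all the operations used, so that the rules for integrals on bounded sets apply to them
    freely. The data [u0] and [f] are square integrable on [Omega] only, whereas the closed cells
    reach its boundary; they are treated on the interiors of the cells, the difference being a null
    set. Facets are never parametrized. The integral over a slab of a function that is constant
    along the normal is proportional to the thickness of the slab, by additivity and monotonicity;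
    this makes a surface integral, taken over a prism of height 1, comparable with the layers of
    thickness at most [h] swept by a translate. *)

Section null_integral.
Context dd (T : measurableType dd) (R : realType).
Variable mu : {measure set T -> \bar R}.
Import HBNNSimple.

(** No measurability of [f] or [g] is available. The integral of a nonnegative function is a
    supremum over the simple functions below it; cutting such a function off on [N] keeps its
    integral and puts it below [g]. *)
Lemma ge0_le_integral_null (N : set T) (f g : T -> \bar R) :
  measurable N -> mu N = 0%E -> (forall x, 0 <= f x)%E ->
  (forall x, 0 <= g x)%E -> (forall x, ~ N x -> f x = g x) ->
  (\int[mu]_x f x <= \int[mu]_x g x)%E.
Proof.
move=> mN N0 f0 g0 fg; rewrite !ge0_integralTE//.
apply: ge_ereal_sup => _ [h hf <-].
pose k := proj_nnsfun h (measurableC mN).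
have hk : sintegral mu h = sintegral mu k.
  have := integral_nnsfun mu measurableT h.
  have := integral_nnsfun mu measurableT k.
  rewrite !patch_setT => <- <-.
  apply: ge0_ae_eq_integral => //.
  - exact/measurable_EFinP.
  - exact/measurable_EFinP.
  - by move=> x _; rewrite lee_fin.
  - by move=> x _; rewrite lee_fin.
  exists N; split=> // x /= xN; apply: contrapT => nN; apply: xN => _.
  by rewrite /mindic indicE mem_set ?mulr1.
rewrite hk; apply: ereal_sup_ubound; exists k => //= x.
rewrite /mindic indicE; have [nN|nN] := boolP (x \in ~` N).
  by rewrite mulr1 -fg ?hf//; move: nN; rewrite inE.
by rewrite mulr0 g0.
Qed.

(** Positive and negative parts are compared in both directions. Arbitrary integrands are allowed
    because the data are measurable on [Omega] only, not on the closed cells. *)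
Lemma Rintegral_null (D N : set T) (f g : T -> R) :
  measurable N -> mu N = 0%E -> (forall x, D x -> ~ N x -> f x = g x) ->
  \int[mu]_(x in D) f x = \int[mu]_(x in D) g x.
Proof.
move=> mN N0 fg; rewrite /Rintegral; congr fine.
rewrite integral_mkcond [RHS]integral_mkcond integralE [RHS]integralE.
have fg' x : ~ N x ->
    ((fun x => (f x)%:E) \_ D) x = ((fun x => (g x)%:E) \_ D) x.
  by move=> nN; rewrite /patch; case: ifPn => // /[!inE] Dx; rewrite fg.
by congr (_ - _)%E; apply/eqP; rewrite eq_le; apply/andP; split;
  apply: (@ge0_le_integral_null N) => // x nN; rewrite ?(funeposE, funenegE) fg'.
Qed.

End null_integral.

Lemma lebesgue_measure_translate (R : realType) (t : R) (A : set R) :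
  measurable A -> lebesgue_measure [set x | A (x + t)] = lebesgue_measure A.
Proof.
move=> mA.
have mt : measurable_fun [set: measurableTypeR R]
    (fun x => x + t : measurableTypeR R).
  exact: measurable_funD.
pose phi : {mfun measurableTypeR R >-> measurableTypeR R} :=
  HB.pack (fun x => x + t : measurableTypeR R)
  (isMeasurableFun.Build _ _ _ _ _ mt).
rewrite [RHS](@lebesgue_measure_unique _ (pushforward lebesgue_measure phi))//.
move=> _ [[a b]] _ <-; rewrite /pushforward.
transitivity (@lebesgue_measure R `]a - t, b - t]%classic).
  by rewrite /= !lebesgue_measure_itv/= !lte_fin ltrD2r -!EFinD opprB addrA subrK.
by congr lebesgue_measure; apply/seteqP; split => x /=;
  rewrite !in_itv/= ltrBlDr lerBrDr.
Qed.

Section lebesgue_rV_theory.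
Context {R : realType}.

Lemma measurable_forall_coord d (A : 'I_d -> set R) :
  (forall i, measurable (A i)) ->
  measurable [set x : 'rV[R]_d | forall i, A i (x 0 i)].
Proof.
move=> mA.
have -> : [set x : 'rV[R]_d | forall i, A i (x 0 i)] =
    \bigcap_(i in [set: 'I_d]) [set x | A i (x 0 i)].
  by apply/seteqP; split => x /= h i; [move=> _|]; exact: h.
apply: fin_bigcap_measurable => // i _.
by rewrite -[X in measurable X]setTI; exact: measurable_coord.
Qed.

(** The sigma-algebra is generated by the coordinates, so an open set has to be written as a
    countable union of measurable boxes: the cubes inside it with rational centre and radius
    [1 / (k + 1)]. *)
Lemma rV_open_measurable d (U : set 'rV[R]_d) : open U -> measurable U.
Proof.
move=> oU.
pose c (q : 'rV[rat]_d) : 'rV[R]_d := map_mx ratr q.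
pose B (p : 'rV[rat]_d * nat) :=
  [set x : 'rV[R]_d | forall i, `|x 0 i - c p.1 0 i| < p.2.+1%:R^-1].
have -> : U = \bigcup_(p in [set p | B p `<=` U]) B p.
  apply/seteqP; split => [x Ux|x [p pU]]; last exact: pU.
  have /nbhs_ballP[e /= e0 eU] : nbhs x U by exact: open_nbhs_nbhs.
  have [k ke] : exists k : nat, k.+1%:R^-1 < e / 2.
    have e2 : 0 < e / 2 by rewrite divr_gt0.
    have [k hk] := ltr_add_invr e2.
    by exists k; move: hk; rewrite add0r.
  have qx i : {q : rat | x 0 i - k.+1%:R^-1 < ratr q < x 0 i + k.+1%:R^-1}.
    apply/cid; have [|q] := @rat_in_itvoo _ (x 0 i - k.+1%:R^-1) (x 0 i + k.+1%:R^-1).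
      by rewrite ltrD2l gtrN.
    by rewrite in_itv/=; exists q.
  exists (\row_i sval (qx i), k) => /=; last first.
    move=> i; rewrite !mxE; case: (qx i) => q /= /andP[h1 h2].
    by move: h1 h2; set K := _^-1 => h1 h2; rewrite ltr_norml; apply/andP; split; lra.
  move=> y yB; apply: eU; split => // i j.
  rewrite (ord1 i); have := yB j; rewrite /= !mxE /ball/=.
  case: (qx j) => q /= /andP[h1 h2].
  move: h1 h2 ke; set K := _^-1 => h1 h2 ke.
  by rewrite !ltr_norml => /andP[h3 h4]; apply/andP; split; lra.
rewrite bigcup_mkcond; apply: countable_bigcupT_measurable => [|p].
  exact: countableP.
case: ifPn => // _.
apply: (@measurable_forall_coord _ (fun i => [set t | `|t - c p.1 0 i| < p.2.+1%:R^-1])).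
move=> i; have -> : [set t : R | `|t - c p.1 0 i| < p.2.+1%:R^-1] =
  ball (c p.1 0 i) p.2.+1%:R^-1.
  by apply/seteqP; split => t /=; rewrite /ball/= distrC.
exact: measurable_ball.
Qed.

Lemma rV_continuous_measurable d (f : 'rV[R]_d -> R) :
  continuous f -> measurable_fun setT f.
Proof.
move=> cf; apply: (@measurability _ _ _ _ setT f _ (RGenOpens.measurableE R)).
move=> _ [_ [a [b ->] <-]]; rewrite setTI; apply: rV_open_measurable.
by move/continuousP : cf; apply; exact: interval_open.
Qed.

Lemma rV_cons0 d t (y : 'rV[R]_d) : rV_cons (t, y) 0 0 = t.
Proof. by have /(congr1 fst) := rV_consK (t, y). Qed.

Lemma rV_consS d t (y : 'rV[R]_d) i : rV_cons (t, y) 0 (lift ord0 i) = y 0 i.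
Proof.
have /(congr1 (fun p : measurableTypeR R * 'rV[R]_d => p.2 0 i)) := rV_consK (t, y).
rewrite /= mxE => <-.
by congr (rV_cons _ _ _); exact: val_inj.
Qed.

Lemma lebesgue_rV_prod d (A : 'I_d -> set R) :
  (forall i, measurable (A i)) ->
  lebesgue_rV R d [set x | forall i, A i (x 0 i)] =
  (\prod_i lebesgue_measure (A i))%E.
Proof.
elim: d A => [|d IH] A mA.
  rewrite big_ord0 /= diracE mem_set//= => -[].
  by [].
rewrite big_ord_recl -IH//= /lebesgue_step /pushforward.
rewrite -product_measure1E//; last by
  apply: (@measurable_forall_coord _ (fun i => A (lift ord0 i))).
congr (product_measure1 _ _ _); apply/seteqP; split => -[t y] /=.
  move=> h; split=> [|i]; first by rewrite -[t](rV_cons0 t y); exact: h.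
  by rewrite -(rV_consS t y); exact: h.
case=> At Ay i; case: (unliftP ord0 i) => [j|] ->.
  by rewrite rV_consS; exact: Ay.
by rewrite rV_cons0.
exact: mA.
Qed.

(** The pushforward of the product measure by a translation agrees with it on rectangles, by the
    one-dimensional case and the induction hypothesis; uniqueness of product measures concludes. *)
Lemma lebesgue_rV_translate d (v : 'rV[R]_d) (A : set 'rV[R]_d) :
  measurable A -> lebesgue_rV R d [set x | A (x + v)] = lebesgue_rV R d A.
Proof.
elim: d v A => [|d IH] v A mA.
  congr (lebesgue_rV R 0 _); apply/seteqP; split => x /=;
  by have -> : x + v = x by apply/rowP => -[].
pose w := rV_uncons v.
have mw : measurable_fun [set: measurableTypeR R * 'rV[R]_d]
    (fun p => (p.1 + w.1, p.2 + w.2) : measurableTypeR R * 'rV[R]_d).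
  apply/measurable_fun_pairP; split => /=; first exact: measurable_funD.
  apply: measurable_fun_rV => i.
  apply: (eq_measurable_fun (fun p : measurableTypeR R * 'rV[R]_d => p.2 0 i + w.2 0 i)).
    by move=> p _; rewrite [RHS]mxE.
  apply: measurable_funD => //.
  exact: (measurableT_comp (measurable_coord i) measurable_snd).
pose phi : {mfun (measurableTypeR R * 'rV[R]_d)%type >->
    (measurableTypeR R * 'rV[R]_d)%type} :=
  HB.pack (fun p => (p.1 + w.1, p.2 + w.2) : measurableTypeR R * 'rV[R]_d)
  (isMeasurableFun.Build _ _ _ _ _ mw).
pose lm := (@lebesgue_measure R \x lebesgue_rV R d)%E.
have mA' : measurable (@rV_cons R d @^-1` A).
  by rewrite -[X in measurable X]setTI; exact: measurable_rV_cons.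
rewrite /= /lebesgue_step /pushforward.
rewrite [RHS](@product_measure_unique _ _ _ _ _ _ _ (pushforward lm phi))//.
  suff consD t y : rV_cons (t, y) + v = rV_cons (t + w.1, y + w.2).
    by congr lm; apply/seteqP; split => -[t y] /=; rewrite consD.
  apply/rowP => i; case: (unliftP ord0 i) => [j|] ->; rewrite [LHS]mxE.
    rewrite !rV_consS [RHS]mxE; congr (_ + _).
    by rewrite -[v in LHS]rV_unconsK rV_consS.
  by rewrite !rV_cons0.
move=> B C mB mC; transitivity ((@lebesgue_measure R [set x | B (x + w.1)%R] *
    lebesgue_rV R d [set x | C (x + w.2)%R])%E); last first.
  by rewrite IH// lebesgue_measure_translate.
rewrite -product_measure1E//; last 2 first.
- have : measurable_fun setT (fun x : measurableTypeR R => x + w.1).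
    exact: measurable_funD.
  by move=> /(_ measurableT _ mB); rewrite setTI.
- have : measurable_fun setT (fun x : 'rV[R]_d => x + w.2).
    apply: measurable_fun_rV => i.
    apply: (eq_measurable_fun (fun x : 'rV[R]_d => x 0 i + w.2 0 i)).
      by move=> p _; rewrite [RHS]mxE.
    by apply: measurable_funD => //; exact: measurable_coord.
  by move=> /(_ measurableT _ mC); rewrite setTI.
Qed.

End lebesgue_rV_theory.

(** * Measurable locally bounded functions *)

Section locally_bounded.
Context {R : realType} {d : nat}.
Local Notation pt := 'rV[R]_d.
Local Notation leb := (lebesgue_rV R d).

Lemma normr_coord_le (x : pt) i : `|x 0 i| <= `|x|.
Proof.
have -> : `|x| = mx_norm x by [].
by rewrite mx_normrE; apply/bigmax_geP; right => /=; exists (0, i).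
Qed.

Definition bx (r : R) : set pt := [set x | forall i, `|x 0 i| <= r].

Lemma bx_sub r s : r <= s -> bx r `<=` bx s.
Proof. by move=> rs x xr i; exact: le_trans (xr i) rs. Qed.

Lemma bx_norm x : bx `|x| x.
Proof. by move=> i; exact: normr_coord_le. Qed.

Lemma bx_add r s x y : bx r x -> bx s y -> bx (r + s) (x + y).
Proof.
move=> xr ys i; rewrite mxE; apply: (le_trans (ler_normD _ _)).
by apply: lerD; [exact: xr|exact: ys].
Qed.

Lemma measurable_bx r : measurable (bx r).
Proof.
apply: (@measurable_forall_coord _ _ (fun=> [set t | `|t| <= r])) => _.
have -> : [set t : R | `|t| <= r] = `[- r, r]%classic.
  by apply/seteqP; split => t /=; rewrite in_itv/= ler_norml.
exact: measurable_itv.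
Qed.

Lemma bx_lty r : (leb (bx r) < +oo)%E.
Proof.
have -> : bx r = [set x : pt | forall i, `[- r, r]%classic (x 0 i)].
  by apply/seteqP; split => t /= h i; have := h i; rewrite /= in_itv/= ler_norml.
rewrite (lebesgue_rV_prod (fun=> measurable_itv _)).
have : (\prod_(i < d) lebesgue_measure (`[(- r)%R, r]%classic : set R))%E \is a fin_num.
  apply: (big_ind (fun x : \bar R => x \is a fin_num)) => //.
    by move=> x y ? ?; exact: fin_numM.
  by move=> _ _; rewrite lebesgue_measure_itv/=; case: ifP.
by rewrite fin_numElt => /andP[].
Qed.

Definition bdd (A : set pt) := exists r, A `<=` bx r.

Lemma bounded_bdd A : bounded_set A -> bdd A.
Proof.
case=> M [_ hM]; exists (M + 1) => x Ax i.
by apply: le_trans (normr_coord_le _ _) _; apply: hM => //; rewrite ltrDl.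
Qed.

Lemma bdd_sub A B : A `<=` B -> bdd B -> bdd A.
Proof. by move=> AB [r Br]; exists r => x /AB /Br. Qed.

Lemma bdd_bx r : bdd (bx r).
Proof. by exists r. Qed.

Lemma bdd_lty A : measurable A -> bdd A -> (leb A < +oo)%E.
Proof.
move=> mA [r Ar]; apply: le_lt_trans (bx_lty r).
by apply: le_measure => //; rewrite inE//; exact: measurable_bx.
Qed.

(** The class of all discrete integrands: it contains the continuous functions and the indicators of
    measurable sets, is an algebra, is stable under translation and projection onto a plane, and its
    members are integrable on bounded measurable sets. *)
Definition LB (f : pt -> R) :=
  measurable_fun setT f /\ forall r, exists C, forall x, bx r x -> `|f x| <= C.

Lemma LB_cst c : LB (fun=> c).
Proof. by split => // r; exists `|c|. Qed.

Lemma LB_add f g : LB f -> LB g -> LB (fun x => f x + g x).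
Proof.
move=> [mf bf] [mg bg]; split; first exact: measurable_funD.
move=> r; have [C hC] := bf r; have [D hD] := bg r; exists (C + D) => x xr.
by rewrite (le_trans (ler_normD _ _))// lerD ?hC ?hD.
Qed.

Lemma LB_mul f g : LB f -> LB g -> LB (fun x => f x * g x).
Proof.
move=> [mf bf] [mg bg]; split; first exact: measurable_funM.
move=> r; have [C hC] := bf r; have [D hD] := bg r; exists (C * D) => x xr.
by rewrite normrM ler_pM ?hC ?hD.
Qed.

Lemma LB_scale c f : LB f -> LB (fun x => c * f x).
Proof. exact/LB_mul/LB_cst. Qed.

Lemma LB_opp f : LB f -> LB (fun x => - f x).
Proof. by move=> /(LB_scale (-1)); under eq_fun do rewrite mulN1r. Qed.

Lemma LB_sub f g : LB f -> LB g -> LB (fun x => f x - g x).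
Proof. by move=> Lf Lg; apply: LB_add => //; exact: LB_opp. Qed.

Lemma LB_sum I (s : seq I) (P : pred I) (f : I -> pt -> R) :
  (forall i, P i -> LB (f i)) -> LB (fun x => \sum_(i <- s | P i) f i x).
Proof.
move=> Lf; elim: s => [|i s IH].
  by under eq_fun do rewrite big_nil; exact: LB_cst.
under eq_fun do rewrite big_cons.
by have [Pi|_] := boolP (P i) => //; exact/LB_add/IH/Lf.
Qed.

Lemma LB_norm f : LB f -> LB (fun x => `|f x|).
Proof.
move=> [mf bf]; split; first exact: measurableT_comp.
by move=> r; have [C hC] := bf r; exists C => x xr; rewrite normr_id hC.
Qed.

Lemma LB_indic A : measurable A -> LB (\1_A).
Proof.
move=> mA; split; first exact: measurable_indic.
by move=> r; exists 1 => x _; rewrite indicE; case: (_ \in _); rewrite ?normr1 ?normr0.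
Qed.

Lemma LB_continuous f : continuous f -> LB f.
Proof.
move=> cf; split; first exact: rV_continuous_measurable.
move=> r; have cr : compact (bx r).
  have -> : bx r = [set x : pt | forall i, `[- r, r]%classic (x 0 i)].
    by apply/seteqP; split => t /= h i; have := h i; rewrite /= in_itv/= ler_norml.
  by apply: (@rV_compact _ _ (fun=> `[- r, r]%classic)) => i; exact: segment_compact.
have : compact (f @` bx r).
  by apply: continuous_compact => //; exact: continuous_subspaceT.
move=> /compact_bounded[M [_ hM]]; exists (M + 1) => x xr.
by apply: hM; [rewrite ltrDl|exists x].
Qed.

Lemma LB_comp f (g : pt -> pt) : LB f -> measurable_fun setT g ->
  (forall r, exists s, forall x, bx r x -> bx s (g x)) -> LB (fun x => f (g x)).
Proof.
move=> [mf bf] mg bg; split; first exact: measurableT_comp.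
by move=> r; have [s hs] := bg r; have [C hC] := bf s; exists C => x /hs /hC.
Qed.

Lemma LB_coord i : LB (fun x => x 0 i).
Proof. by split; [exact: measurable_coord|move=> r; exists r => x]. Qed.

Lemma LB_dotv (v w : pt -> pt) : (forall i, LB (fun x => v x 0 i)) ->
  (forall i, LB (fun x => w x 0 i)) -> LB (fun x => dotv (v x) (w x)).
Proof. by move=> Lv Lw; apply: LB_sum => i _; exact: LB_mul. Qed.

Lemma measurable_shift (v : pt) : measurable_fun setT (fun x : pt => x + v).
Proof.
apply: measurable_fun_rV => i.
apply: (eq_measurable_fun (fun x : pt => x 0 i + v 0 i)).
  by move=> p _; rewrite [RHS]mxE.
by apply: measurable_funD => //; exact: measurable_coord.
Qed.

Lemma LB_shift f v : LB f -> LB (fun x => f (x + v)).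
Proof.
move=> Lf; apply: (LB_comp Lf); first exact: measurable_shift.
by move=> r; exists (r + `|v|) => x xr; exact/bx_add/bx_norm.
Qed.

Lemma LB_integrable f A : LB f -> measurable A -> bdd A ->
  leb.-integrable A (EFin \o f).
Proof.
move=> [mf bf] mA [r Ar]; apply: measurable_bounded_integrable => //.
- by apply: bdd_lty => //; exists r.
- exact: measurable_funTS.
have [C hC] := bf r; exists C; split; first exact: num_real.
by move=> M CM x /Ar /hC /le_trans; apply; exact: ltW.
Qed.

Section integral.
Variables (A : set pt) (mA : measurable A) (bA : bdd A).

Lemma LB_RintegralD f g : LB f -> LB g ->
  \int[leb]_(x in A) (f x + g x) = \int[leb]_(x in A) f x + \int[leb]_(x in A) g x.
Proof. by move=> Lf Lg; rewrite RintegralD//; exact: LB_integrable. Qed.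

Lemma LB_RintegralB f g : LB f -> LB g ->
  \int[leb]_(x in A) (f x - g x) = \int[leb]_(x in A) f x - \int[leb]_(x in A) g x.
Proof. by move=> Lf Lg; rewrite RintegralB//; exact: LB_integrable. Qed.

Lemma LB_RintegralZ c f : LB f ->
  \int[leb]_(x in A) (c * f x) = c * \int[leb]_(x in A) f x.
Proof. by move=> Lf; rewrite RintegralZl//; exact: LB_integrable. Qed.

Lemma LB_Rintegral_sum I (s : seq I) (P : pred I) (f : I -> pt -> R) :
  (forall i, P i -> LB (f i)) ->
  \int[leb]_(x in A) (\sum_(i <- s | P i) f i x) =
  \sum_(i <- s | P i) \int[leb]_(x in A) f i x.
Proof.
move=> Lf; elim: s => [|i s IH].
  under eq_Rintegral do rewrite big_nil.
  by rewrite big_nil Rintegral_cst// mul0r.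
under eq_Rintegral do rewrite big_cons; rewrite big_cons; case: ifPn => // Pi.
by rewrite LB_RintegralD ?IH//; [exact: Lf|exact: LB_sum].
Qed.

Lemma LB_le_Rintegral f g : LB f -> LB g -> (forall x, A x -> f x <= g x) ->
  \int[leb]_(x in A) f x <= \int[leb]_(x in A) g x.
Proof. by move=> Lf Lg fg; apply: le_Rintegral => //; exact: LB_integrable. Qed.

Lemma LB_normr_Rintegral f : LB f ->
  `|\int[leb]_(x in A) f x| <= \int[leb]_(x in A) `|f x|.
Proof. by move=> Lf; apply: le_normr_Rintegral => //; exact: LB_integrable. Qed.

End integral.

Lemma Rintegral_indic (A B : set pt) f :
  \int[leb]_(x in A `&` B) f x = \int[leb]_(x in A) (\1_B x * f x).
Proof.
rewrite Rintegral_mkcondr; apply: eq_Rintegral => x _.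
by rewrite /patch indicE; case: ifP => _; rewrite ?mul1r ?mul0r.
Qed.

Lemma Rintegral_sub (A B : set pt) f : A `<=` B ->
  \int[leb]_(x in A) f x = \int[leb]_(x in B) (\1_A x * f x).
Proof. by move=> AB; rewrite -Rintegral_indic; congr Rintegral; rewrite setIidr. Qed.

Lemma LB_Rintegral_shift (v : pt) (A : set pt) f :
  LB f -> measurable A -> bdd A ->
  \int[leb]_(x in A) f x = \int[leb]_(x in [set x | A (x + v)]) f (x + v).
Proof.
move=> Lf mA [r Ar]; rewrite /Rintegral; congr fine.
pose phi := fun x : pt => x + v.
have mphi : measurable_fun setT phi by exact: measurable_shift.
pose pphi : {mfun pt >-> pt} := HB.pack phi (isMeasurableFun.Build _ _ _ _ _ mphi).
transitivity (\int[pushforward leb pphi]_(x in A) (f x)%:E)%E.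
  apply: eq_measure_integral => B mB _.
  exact/esym/lebesgue_rV_translate.
rewrite integral_pushforward//.
  by apply/measurable_EFinP; case: Lf.
apply: (LB_integrable (f := fun x => f (x + v))); first exact: LB_shift.
  by have := mphi measurableT A mA; rewrite setTI.
exists (r + `|- v|) => x /Ar h; rewrite -[x](addrK v); exact/bx_add/bx_norm.
Qed.

End locally_bounded.

Section dotv_theory.
Context {R : realType} {d : nat}.
Local Notation pt := 'rV[R]_d.
Implicit Types x y z : pt.

Lemma dotvC x y : dotv x y = dotv y x.
Proof. by apply: eq_bigr => i _; rewrite mulrC. Qed.

Lemma dotvDl x y z : dotv (x + y) z = dotv x z + dotv y z.
Proof. by rewrite /dotv -big_split; apply: eq_bigr => i _; rewrite mxE mulrDl. Qed.

Lemma dotvZl a x y : dotv (a *: x) y = a * dotv x y.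
Proof. by rewrite /dotv mulr_sumr; apply: eq_bigr => i _; rewrite mxE mulrA. Qed.

Lemma dotvDr x y z : dotv z (x + y) = dotv z x + dotv z y.
Proof. by rewrite !(dotvC z) dotvDl. Qed.

Lemma dotvZr a x y : dotv x (a *: y) = a * dotv x y.
Proof. by rewrite !(dotvC x) dotvZl. Qed.

Lemma dotvNl x y : dotv (- x) y = - dotv x y.
Proof. by rewrite -scaleN1r dotvZl mulN1r. Qed.

Lemma dotvNr x y : dotv x (- y) = - dotv x y.
Proof. by rewrite !(dotvC x) dotvNl. Qed.

Lemma dotvBl x y z : dotv (x - y) z = dotv x z - dotv y z.
Proof. by rewrite dotvDl dotvNl. Qed.

Lemma dotvBr x y z : dotv z (x - y) = dotv z x - dotv z y.
Proof. by rewrite dotvDr dotvNr. Qed.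

Lemma dot0v x : dotv 0 x = 0.
Proof. by rewrite /dotv big1// => i _; rewrite mxE mul0r. Qed.

Lemma dotv_ge0 x : 0 <= dotv x x.
Proof. by apply: sumr_ge0 => i _; rewrite -expr2 sqr_ge0. Qed.

Lemma dotv_gt0 x : x != 0 -> 0 < dotv x x.
Proof.
move=> x0; rewrite lt_def dotv_ge0 andbT; apply: contraNneq x0 => /eqP.
rewrite psumr_eq0 => [/allP h|i _]; last by rewrite -expr2 sqr_ge0.
apply/eqP/rowP => i; rewrite mxE; have := h i (mem_index_enum _).
by rewrite mulf_eq0 orbb => /eqP.
Qed.

Lemma dotv_delta x j : dotv x (delta_mx 0 j) = x 0 j.
Proof.
rewrite /dotv (bigD1 j)//= mxE !eqxx mulr1 big1 ?addr0// => i ij.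
by rewrite mxE (negbTE ij) andbF mulr0.
Qed.

Lemma dotv_unit_le x y : dotv x x = 1 -> dotv y y = 1 -> `|dotv x y| <= 1.
Proof.
move=> x1 y1; have := dotv_ge0 (x + y); have := dotv_ge0 (x - y).
rewrite !(dotvDl, dotvDr, dotvNl, dotvNr) x1 y1 (dotvC y x) ler_norml => h1 h2.
by apply/andP; split; lra.
Qed.

Lemma coord_unit_le x j : dotv x x = 1 -> `|x 0 j| <= 1.
Proof.
by move=> x1; rewrite -dotv_delta dotv_unit_le// dotv_delta mxE !eqxx.
Qed.

Lemma measurable_dotv x : measurable_fun setT (dotv x).
Proof. by have [] := LB_dotv (fun i => LB_cst (x 0 i)) (fun i => LB_coord i). Qed.

Lemma LB_dotv1 x : LB (dotv x).
Proof. exact: (LB_dotv (fun i => LB_cst (x 0 i)) (fun i => LB_coord i)). Qed.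

Lemma measurable_plane x c : measurable [set y | dotv x y = c].
Proof.
by have := measurable_dotv x measurableT (measurable_set1 c); rewrite setTI.
Qed.

End dotv_theory.

Section hyperplane.
Context {R : realType} {d : nat}.
Local Notation pt := 'rV[R]_d.
Local Notation leb := (lebesgue_rV R d).

(* The translates of a bounded piece of the hyperplane along its normal are
   disjoint, have equal measure, and fit in a bounded set. *)
Lemma bounded_hyperplane_null (n : pt) c r : n != 0 ->
  leb ([set x | dotv n x = c] `&` bx r) = 0%E.
Proof.
move=> n0; have q0 := dotv_gt0 n0; set q := dotv n n in q0.
set Hr := _ `&` _; have mH : measurable Hr.
  by apply: measurableI; [exact: measurable_plane|exact: measurable_bx].
pose t (k : nat) : R := k.+1%:R^-1.
pose F k := [set x | Hr (x + (- t k) *: n)].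
have mF k : measurable (F k).
  by have := measurable_shift (- t k *: n) measurableT mH; rewrite setTI.
have FE k : leb (F k) = leb Hr by exact: lebesgue_rV_translate.
have t01 k : 0 <= t k <= 1.
  by rewrite invr_ge0 ler0n/= invf_le1// ler1n.
have Fb k : F k `<=` bx (r + `|n|).
  move=> x [_ /= h i]; have := h i; rewrite !mxE.
  have := normr_coord_le n i; have /andP[] := t01 k; set s := t k.
  move=> s0 s1 ni xr; rewrite -[x 0 i](subrK (s * n 0 i)).
  rewrite (le_trans (ler_normD _ _))// lerD//; first by rewrite -mulNr.
  by rewrite normrM (ger0_norm s0) (le_trans _ ni)// ler_piMl.
have tF : trivIset setT F.
  move=> k l _ _ [x [[/= + _] [/= + _]]]; rewrite !dotvDr !dotvZr -/q => <-.
  move/addrI/(mulIf (lt0r_neq0 q0))/oppr_inj/invr_inj/eqP.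
  by rewrite eqr_nat eqSS => /eqP.
have Hfin : leb Hr \is a fin_num.
  rewrite ge0_fin_numE//; apply: (@bdd_lty _ _ Hr) => //.
  by exists r => x [].
have Kle (K : nat) : K%:R * fine (leb Hr) <= fine (leb (bx (r + `|n|) : set pt)).
  have bfin : leb (bx (r + `|n|) : set pt) \is a fin_num by rewrite ge0_fin_numE// bx_lty.
  have h : (leb (\big[setU/set0]_(k < K) F k) <= leb (bx (r + `|n|)))%E.
    apply: le_measure; rewrite ?inE//.
    - by apply: bigsetU_measurable.
    - exact: measurable_bx.
    - by rewrite -bigcup_mkord => x [k _ /Fb].
  rewrite -lee_fin (fineK bfin); apply: le_trans h.
  have -> : leb (\big[setU/set0]_(k < K) F k) = (\sum_(k < K) (fine (leb Hr))%:E)%E.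
    rewrite (measure_bigsetU leb)//.
    by apply: eq_bigr => k _; rewrite (fineK Hfin); exact: FE.
  by rewrite sumEFin sumr_const card_ord mulr_natl.
have m0 : fine (leb Hr) <= 0.
  rewrite leNgt; apply/negP => m0.
  have b0 : 0 <= fine (leb (bx (r + `|n|) : set pt)) by exact: fine_ge0.
  have := archi_boundP (divr_ge0 b0 (ltW m0)).
  by rewrite ltr_pdivrMr// ltNge Kle.
rewrite -(fineK Hfin); congr EFin; apply/eqP; rewrite eq_le m0/=.
exact: fine_ge0.
Qed.

Lemma hyperplane_null (n : pt) c : n != 0 -> leb [set x | dotv n x = c] = 0%E.
Proof.
move=> n0; apply/(negligibleP leb); first exact: measurable_plane.
have -> : [set x | dotv n x = c] =
    \bigcup_(k : nat) ([set x | dotv n x = c] `&` bx k%:R).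
  apply/seteqP; split => [x xc|x [k _ []]//].
  have [k hk] : exists k : nat, `|x| <= k%:R.
    by exists (Num.bound `|x|); rewrite ltW// archi_boundP.
  by exists k => //; split => // i; rewrite (le_trans (normr_coord_le x i)).
apply: negligible_bigcup => k; apply/negligibleP.
  by apply: measurableI; [exact: measurable_plane|exact: measurable_bx].
exact: bounded_hyperplane_null.
Qed.

End hyperplane.

(** Cauchy's functional equation, with monotonicity in place of continuity. If [k] is the integer
    part of [N s], both [N J(s)] and [N s J(1)] lie between [k J(1)] and [(k + 1) J(1)]; hence [N]
    times the error is at most [J(1)] for every [N]. *)
Lemma additive_ge0_linear (R : realType) (J : R -> R) :
  (forall s t, 0 <= s -> 0 <= t -> J (s + t) = J s + J t) ->
  (forall s, 0 <= s -> 0 <= J s) -> forall s, 0 <= s -> J s = s * J 1.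
Proof.
move=> JD J0 s s0.
have JM (k : nat) t : 0 <= t -> J (k%:R * t) = k%:R * J t.
  move=> t0; elim: k => [|k IH].
    by have := JD 0 0 (lexx _) (lexx _); rewrite !mul0r addr0; lra.
  by rewrite -natr1 mulrDl mul1r JD ?mulr_ge0 ?ler0n// IH mulrDl mul1r.
have Jle t u : 0 <= t -> t <= u -> J t <= J u.
  move=> t0 tu; rewrite -[u](subrK t) addrC JD ?subr_ge0//.
  by rewrite lerDl J0// subr_ge0.
have J10 : 0 <= J 1 by rewrite J0.
have key (N : nat) : N%:R * `|J s - s * J 1| <= J 1.
  have Ns : 0 <= N%:R * s by rewrite mulr_ge0.
  have := truncn_itv Ns; set k := Num.truncn _ => /andP[k1 k2].
  have h1 : k%:R * J 1 <= N%:R * J s.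
    by rewrite -JM// -JM// mulr1 Jle.
  have h2 : N%:R * J s <= k.+1%:R * J 1.
    by rewrite -JM// -JM// mulr1 Jle// ltW.
  have h3 : k%:R * J 1 <= N%:R * s * J 1 by rewrite ler_wpM2r.
  have h4 : N%:R * s * J 1 <= k.+1%:R * J 1 by rewrite ler_wpM2r// ltW.
  rewrite -{1}(ger0_norm (ler0n R N)) -normrM ler_norml.
  rewrite -natr1 in h2 h4; apply/andP; split; nra.
apply/eqP; rewrite -subr_eq0 -normr_le0 leNgt; apply/negP => p.
have := archi_boundP (divr_ge0 J10 (ltW p)).
by rewrite ltr_pdivrMr// ltNge key.
Qed.

(** * The divergence theorem on a polytope *)

Section convergence.
Context {R : realType} {d : nat}.
Local Notation pt := 'rV[R]_d.
Local Notation leb := (lebesgue_rV R d).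

Lemma bounded_convergence (A N : set pt) (F : nat -> pt -> R) (f : pt -> R) C :
  measurable A -> bdd A -> (forall k, measurable_fun setT (F k)) ->
  measurable_fun setT f -> (forall k x, A x -> `|F k x| <= C) ->
  measurable N -> leb N = 0%E ->
  (forall x, A x -> ~ N x -> F k x @[k --> \oo] --> f x) ->
  \int[leb]_(x in A) F k x @[k --> \oo] --> \int[leb]_(x in A) f x.
Proof.
move=> mA bA mF mf FC mN N0 Ff.
have [] := @dominated_convergence _ _ _ leb A mA (fun k => EFin \o F k) (EFin \o f)
  (EFin \o cst C).
- by move=> k; apply/measurable_EFinP; exact: measurable_funTS.
- by apply/measurable_EFinP; exact: measurable_funTS.
- exists N; split=> // x /= h; apply: contrapT => nN; apply: h => Ax.
  by apply: cvg_EFin; [exact: nearW|exact: Ff].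
- exact: (LB_integrable (LB_cst C)).
- by apply: aeW => x k Ax /=; rewrite lee_fin FC.
move=> intf _ h; apply: fine_cvg; rewrite /= fineK//.
exact: integrable_fin_num.
Qed.

Lemma harmonic_dnbhs : (@harmonic R) @ \oo --> 0^'.
Proof.
move=> P P0.
have h : \forall k \near \oo, harmonic k != 0 :> R -> P (harmonic k).
  exact: (@cvg_harmonic R _ P0).
by apply: filterS h => k; apply; rewrite /harmonic invr_neq0.
Qed.

Lemma derive_along (f : pt -> R) (x w : pt) (t : R) :
  derivable f (t *: w + x) w ->
  is_derive t 1 (fun s : R => f (s *: w + x)) ('D_w f (t *: w + x)).
Proof.
move=> df.
have E : (fun h : R => h^-1 *: (((fun s : R => f (s *: w + x)) \o shift t) (h *: 1)
     - f (t *: w + x))) =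
   (fun h => h^-1 *: ((f \o shift (t *: w + x)) (h *: w) - f (t *: w + x))).
  by apply/funext => h /=; rewrite [h%:A]mulr1 scalerDl addrA.
by apply: DeriveDef; [rewrite /derivable E|rewrite /derive E].
Qed.

Lemma bx_delta (t : R) (j : 'I_d) : bx `|t| (t *: delta_mx 0 j : pt).
Proof.
by move=> i; rewrite !mxE normrM normr_nat ler_piMr// lern1 leq_b1.
Qed.

Lemma difference_bound (f : pt -> R) (j : 'I_d) (r C h : R) x :
  (forall y, derivable f y (delta_mx 0 j)) -> 
  (forall y, bx (r + 1) y -> `|partial j f y| <= C) -> bx r x -> 0 <= h <= 1 ->
  `|f (h *: delta_mx 0 j + x) - f x| <= C * h.
Proof.
move=> df fC xr /andP[h0 h1]; pose w : pt := delta_mx 0 j.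
have dg t : is_derive t (1 : R) (fun s : R => f (s *: w + x)) (partial j f (t *: w + x)).
  exact: derive_along.
have [] := @MVT_segment _ (fun s => f (s *: w + x)) (fun t => partial j f (t *: w + x)) 0 h h0.
  by apply: derivable_within_continuous => t _; exact: ex_derive.
move=> t; rewrite in_itv/= subr0 scale0r add0r => /andP[t0 th] ->.
rewrite normrM (ger0_norm h0) ler_wpM2r// fC// addrC; apply: bx_add => //.
by apply: bx_sub (bx_delta t j); rewrite ger0_norm// (le_trans th).
Qed.

Lemma cvg_difference_quotient (f : pt -> R) (j : 'I_d) (A : set pt) :
  LB f -> (forall y, derivable f y (delta_mx 0 j)) -> LB (partial j f) ->
  measurable A -> bdd A ->
  k.+1%:R * \int[leb]_(x in A) (f (k.+1%:R^-1 *: delta_mx 0 j + x) - f x)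
    @[k --> \oo] --> \int[leb]_(x in A) partial j f x.
Proof.
move=> Lf df Ldf mA [r Ar]; pose w : pt := delta_mx 0 j.
have LF k : LB (fun x => f (k.+1%:R^-1 *: w + x) - f x).
  apply: LB_sub => //; under eq_fun do rewrite addrC; exact: LB_shift.
have bA : bdd A by exists r.
rewrite (_ : (fun k : nat => _) = (fun k : nat => \int[leb]_(x in A)
    (k.+1%:R * (f (k.+1%:R^-1 *: w + x) - f x)))); last first.
  by apply/funext => k; rewrite LB_RintegralZ.
have [C fC] := Ldf.2 (r + 1).
apply: (@bounded_convergence _ set0 _ _ C) => //.
- by move=> k; case: (LB_scale k.+1%:R (LF k)).
- by case: Ldf.
- move=> k x /Ar xr; rewrite normrM ger0_norm// -ler_pdivlMl// mulrC.
  by apply: difference_bound fC xr _; rewrite // invr_ge0 ler0n/= invf_le1// ler1n.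
move=> x Ax _.
have := df x; rewrite /derivable => /cvg_ex[l hl].
have -> : partial j f x = l by apply: cvg_lim.
have := cvg_comp _ _ harmonic_dnbhs hl; apply: cvg_trans; apply: near_eq_cvg.
by apply: nearW => k; rewrite /= /harmonic invrK.
Qed.

End convergence.

(** * Integrals over slabs parallel to a hyperplane *)

Section tube.
Context {R : realType} {d : nat}.
Local Notation pt := 'rV[R]_d.
Local Notation leb := (lebesgue_rV R d).
Implicit Types (n : pt) (c : R) (A : set pt) (J : set R) (f : pt -> R).

Lemma LB_compv f (g : pt -> pt) : LB f -> (forall i, LB (fun x => g x 0 i)) ->
  LB (fun x => f (g x)).
Proof.
move=> Lf Lg; apply: LB_comp => //.
  by apply: measurable_fun_rV => i; case: (Lg i).
move=> r; have /choice[C hC] : forall i, exists C, forall x, bx r x -> `|g x 0 i| <= C.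
  by move=> i; exact: (Lg i).2.
exists (\sum_i `|C i|) => x xr i; rewrite (bigD1 i)//=.
apply: le_trans (hC i x xr) _; apply: le_trans (ler_norm _) _.
by rewrite lerDl sumr_ge0.
Qed.

Lemma LB_plane_proj n c i : LB (fun x => plane_proj n c x 0 i).
Proof.
under eq_fun do rewrite /plane_proj !mxE.
apply: LB_sub; first exact: LB_coord.
by apply: LB_mul; [apply: LB_sub; [exact: LB_dotv1|exact: LB_cst]|exact: LB_cst].
Qed.

Lemma LB_comp_proj n c f : LB f -> LB (fun x => f (plane_proj n c x)).
Proof. by move=> Lf; apply: LB_compv => // i; exact: LB_plane_proj. Qed.

Lemma measurable_plane_proj n c A : measurable A ->
  measurable [set x | A (plane_proj n c x)].
Proof.
move=> mA; have : measurable_fun setT (plane_proj n c).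
  by apply: measurable_fun_rV => i; case: (LB_plane_proj n c i).
by move=> /(_ measurableT _ mA); rewrite setTI.
Qed.

(** A prism over [A] whose heights range over [J] instead of [[0, 1]]. Other intervals are required
    for the thin layer that a facet sweeps when the polytope is translated. *)
Definition tube n c J A : set pt :=
  [set x | J (dotv n x - c) /\ A (plane_proj n c x)].

Lemma plane_projK n c x : plane_proj n c x + (dotv n x - c) *: n = x.
Proof. by rewrite /plane_proj subrK. Qed.

Lemma dotv_plane_proj n c x : dotv n n = 1 -> dotv n (plane_proj n c x) = c.
Proof. by move=> n1; rewrite dotvBr dotvZr n1 mulr1 opprB addrC subrK. Qed.

Lemma plane_proj_shift n c x s : dotv n n = 1 ->
  plane_proj n c (x + s *: n) = plane_proj n c x.
Proof.
move=> n1; rewrite /plane_proj dotvDr dotvZr n1 mulr1.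
rewrite (_ : _ + s - c = (dotv n x - c) + s); last by ring.
by rewrite scalerDl opprD addrACA subrr addr0.
Qed.

Lemma plane_projN n c x : plane_proj (- n) (- c) x = plane_proj n c x.
Proof. by rewrite /plane_proj dotvNl scalerN opprK -opprD scaleNr. Qed.

Lemma measurable_tube n c J A : measurable J -> measurable A ->
  measurable (tube n c J A).
Proof.
move=> mJ mA; apply: measurableI; last exact: measurable_plane_proj.
have : measurable_fun setT (fun x : pt => dotv n x - c).
  by apply: measurable_funB => //; exact: measurable_dotv.
by move=> /(_ measurableT _ mJ); rewrite setTI.
Qed.

Lemma tube_bx n c J A r m : dotv n n = 1 -> J `<=` [set t | `|t| <= m] ->
  A `<=` bx r -> tube n c J A `<=` bx (r + m).
Proof.
move=> n1 Jm Ar x [/Jm /= xm /Ar xr]; rewrite -(plane_projK n c x); apply: bx_add => // i.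
rewrite mxE normrM (le_trans _ xm)// ler_piMr//; exact: coord_unit_le.
Qed.

Lemma bdd_tube n c J A m : dotv n n = 1 -> J `<=` [set t | `|t| <= m] ->
  bdd A -> bdd (tube n c J A).
Proof. by move=> n1 Jm [r Ar]; exists (r + m); exact: tube_bx. Qed.

Section linear.
Variables (n : pt) (c : R) (A : set pt).
Hypotheses (n1 : dotv n n = 1) (mA : measurable A) (bA : bdd A).
Local Notation tint a b f :=
  (\int[leb]_(x in tube n c [set t | a < t <= b] A) f (plane_proj n c x)).

Lemma measurable_Ioc (a b : R) : measurable [set t : R | a < t <= b].
Proof.
have -> : [set t : R | a < t <= b] = `]a, b]%classic.
  by apply/seteqP; split => t /=; rewrite in_itv.
exact: measurable_itv.
Qed.

Lemma Ioc_bound (a b : R) : [set t : R | a < t <= b] `<=` [set t | `|t| <= `|a| + `|b|].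
Proof.
move=> t /= /andP[ta tb]; rewrite ler_norml; have := ler_norm b; have := ler_norm (- a).
rewrite normrN; have := normr_ge0 a; have := normr_ge0 b => *.
by apply/andP; split; lra.
Qed.

Let mt a b := measurable_tube n c (measurable_Ioc a b) mA.
Let bt a b := bdd_tube c n1 (@Ioc_bound a b) bA.

Lemma tube_shift a b s f : LB f -> tint (a + s) (b + s) f = tint a b f.
Proof.
move=> Lf; rewrite (LB_Rintegral_shift (s *: n))//; last exact: LB_comp_proj.
under eq_Rintegral do rewrite plane_proj_shift//.
congr Rintegral; apply/seteqP; split => x /=; rewrite /tube/= plane_proj_shift//;
  rewrite dotvDr dotvZr n1 mulr1 => -[/andP[h1 h2] ?]; split => //; apply/andP; split; lra.
Qed.

Lemma tube_split a b e f : LB f -> a <= b -> b <= e ->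
  tint a e f = tint a b f + tint b e f.
Proof.
move=> Lf ab be; rewrite -Rintegral_setU//; first last.
- rewrite disj_set2E; apply/eqP/seteqP; split => // x [[/= /andP[_ h1] _] [/andP[h2 _] _]].
  by move: h2; rewrite ltNge h1.
- rewrite (_ : _ `|` _ = tube n c [set t | a < t <= e] A).
    by apply: LB_integrable => //; exact: LB_comp_proj.
  apply/seteqP; split => [x [] [/= /andP[h1 h2] h3]|x [/= /andP[h1 h2] h3]].
  + by split => //=; rewrite h1 (le_trans h2).
  + by split => //=; rewrite h2 (le_lt_trans ab).
  by have [h|h] := leP (dotv n x - c) b; [left|right]; split=> //=; rewrite ?h1 ?h.
congr Rintegral.
apply/seteqP; split => [x [/= /andP[h1 h2] h3]|x [] [/= /andP[h1 h2] h3]].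
+ by have [h|h] := leP (dotv n x - c) b; [left|right]; split=> //=; rewrite ?h1 ?h.
+ by split => //=; rewrite h1 (le_trans h2).
+ by split => //=; rewrite h2 (le_lt_trans ab).
Qed.

Let tube_linear_ge0 f s : LB f -> (forall x, A x -> 0 <= f x) -> 0 <= s ->
  tint 0 s f = s * tint 0 1 f.
Proof.
move=> Lf f0 s0; apply: (@additive_ge0_linear _ (fun s => tint 0 s f)) => //.
- move=> u v u0 v0; rewrite (@tube_split 0 u)// ?lerDl//; congr (_ + _).
  by rewrite -{1}[u]add0r [u + v]addrC tube_shift.
- by move=> u u0; apply: Rintegral_ge0 => x [_ /f0].
Qed.

(** The integral is invariant under translation along [n] and additive in the half-open interval, so
    for [f] nonnegative on [A] it is linear in the length. A general [f] is first raised by a bound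
    [C] of its absolute value on [A]. *)
Lemma tube_linear a b f : LB f -> a <= b -> tint a b f = (b - a) * tint 0 1 f.
Proof.
move=> Lf ab.
rewrite -[in LHS](add0r a) -[in LHS](subrK a b) tube_shift//.
have [r Ar] := bA; have [C hC] := Lf.2 r.
have LC := LB_cst C : @LB R d _.
have LfC := LB_add Lf LC.
have ba : 0 <= b - a by rewrite subr_ge0.
have fC0 x : A x -> 0 <= f x + C.
  by move=> /Ar /hC; rewrite ler_norml => /andP[+ _]; rewrite -subr_ge0 opprK.
have C0 (x : pt) : A x -> 0 <= C by move=> /Ar /hC; exact: le_trans.
have fE u v : tint u v f = tint u v (fun x => f x + C) - tint u v (fun=> C).
  rewrite -LB_RintegralB//; last exact: (LB_comp_proj n c LfC).
  by apply: eq_Rintegral => x _; rewrite addrK.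
rewrite !fE (tube_linear_ge0 LfC)// (tube_linear_ge0 LC)//; ring.
Qed.

(** The closed prism and the half-open one, which can be stacked without overlap, differ by a piece
    of a hyperplane. *)
Lemma surface_int_tube f : LB f -> surface_int n c A f = tint 0 1 f.
Proof.
move=> Lf; rewrite /surface_int.
have mprism : measurable (prism n c A).
  apply: (@measurable_tube n c [set t | 0 <= t <= 1] A) => //.
  rewrite (_ : mkset _ = `[0, 1]%classic); first exact: measurable_itv.
  by apply/seteqP; split => t /=; rewrite in_itv.
have n0 : n != 0.
  by apply: contra_eq_neq n1 => ->; rewrite dot0v eq_sym oner_eq0.
have sub : tube n c [set t | 0 < t <= 1] A `<=` prism n c A.
  by move=> x [/= /andP[h1 h2] h3]; split => //; rewrite (ltW h1).
rewrite (Rintegral_sub _ sub); apply: (Rintegral_null (measurable_plane n c)).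
  exact: hyperplane_null.
move=> x [/andP[h1 h2] h3] nx; rewrite indicE mem_set ?mul1r//; split => //=.
rewrite h2 andbT lt_def h1 andbT; apply/eqP => /eqP; rewrite subr_eq0 => /eqP.
exact: nx.
Qed.

End linear.

(** Reversing the normal puts the prism on the other side of the plane; the translation by [n]
    brings it back without changing the projections. *)
Lemma surface_intN n c A f : dotv n n = 1 -> measurable A -> bdd A -> LB f ->
  surface_int (- n) (- c) A f = surface_int n c A f.
Proof.
move=> n1 mA bA Lf; rewrite /surface_int.
under eq_Rintegral do rewrite plane_projN.
have J1 : [set t : R | 0 <= t <= 1] `<=` [set t | `|t| <= 1].
  by move=> t /= /andP[t0 t1]; rewrite ger0_norm.
rewrite [RHS](LB_Rintegral_shift n).
- have ppn x : plane_proj n c (x + n) = plane_proj n c x.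
    by have := plane_proj_shift c x 1 n1; rewrite scale1r.
  under [RHS]eq_Rintegral do rewrite ppn.
  congr Rintegral; apply/seteqP; split => x; rewrite /prism /= plane_projN ppn;
  rewrite dotvNl dotvDr n1 => -[/andP[h1 h2] ?]; split => //; apply/andP; split; lra.
- exact: LB_comp_proj.
- apply: (@measurable_tube n c [set t | 0 <= t <= 1] A) => //.
  rewrite (_ : mkset _ = `[0, 1]%classic); first exact: measurable_itv.
  by apply/seteqP; split => t /=; rewrite in_itv.
- exact: (bdd_tube c n1 J1 bA).
Qed.

End tube.

Lemma normr_bool_sub (R : numDomainType) (a b : bool) : `|a%:R - b%:R| <= 1 :> R.
Proof.
by case: a; case: b; rewrite /= ?mulr1n ?mulr0n ?subrr ?subr0 ?sub0r ?normrN ?normr0 ?normr1.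
Qed.

Lemma cvg_sumr (R : realType) (I : Type) (s : seq I) (P : pred I)
    (F : I -> nat -> R) (l : I -> R) :
  (forall i, P i -> F i k @[k --> \oo] --> l i) ->
  \sum_(i <- s | P i) F i k @[k --> \oo] --> \sum_(i <- s | P i) l i.
Proof.
move=> Fl; elim: s => [|i s IH].
  by rewrite big_nil; under eq_fun do rewrite big_nil; exact: cvg_cst.
rewrite big_cons; under eq_fun do rewrite big_cons.
by have [Pi|_] := boolP (P i) => //; apply: cvgD => //; exact: Fl.
Qed.

(** * A polytope compared with its small translates *)

Section gauss.
Context {R : realType} {d : nat}.
Local Notation pt := 'rV[R]_d.
Local Notation leb := (lebesgue_rV R d).

(** A Lipschitz condition on bounded sets for the sup norm, phrased with the cubes [bx] because
    displacements are only ever estimated coordinate by coordinate. *)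
Definition LLip (f : pt -> R) := forall r, exists2 L, 0 <= L &
  forall e x y, 0 <= e -> bx r x -> bx r y -> bx e (x - y) ->
    `|f x - f y| <= L * e.

Variables (I : finType) (n : I -> pt) (c : I -> R).
Local Notation K := [set x | forall i, dotv (n i) x <= c i].
Local Notation y i x := (plane_proj (n i) (c i) x).
Hypotheses (n1 : forall i, dotv (n i) (n i) = 1) (bK : bdd K).
(** The set is the cylinder, along [n i], over the intersection of the planes [i] and [j]. This says
    in terms of volume that edges have no surface measure. *)
Hypothesis edge_null : forall i j, i != j ->
  leb [set x | dotv (n j) (y i x) = c j] = 0%E.

Lemma measurable_polytope : measurable K.
Proof.
have -> : K = \bigcap_(i in [set: I]) [set x | dotv (n i) x <= c i].
  by apply/seteqP; split => x /= h i; [move=> _|]; exact: h.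
apply: fin_bigcap_measurable => // i _.
have := measurable_dotv (n i) measurableT (measurable_itv `]-oo, (c i)]).
by rewrite setTI set_itvE.
Qed.

Variables (f : pt -> R) (Lf : LB f) (lipf : LLip f) (j0 : 'I_d).
Local Notation w := (delta_mx 0 j0 : pt).
Local Notation s i := (n i 0 j0).
Local Notation t i x := (dotv (n i) x - c i).

(** [F] lives on the symmetric difference of [K] and its translate by [h w]. The constraint [i] of
    the translate is [t i x <= h * s i], so [sig] is 1, -1 or 0 according to whether that constraint
    is gained, lost or unchanged. [G] is the share of the facet [i] in [F], with [f] and the
    membership in [K] read at the foot [y i x] of the perpendicular. *)
Let F (h : R) (x : pt) : R := f x * (\1_K (x - h *: w) - \1_K x).
Let sig (i : I) (h : R) (x : pt) : R :=
  (t i x <= h * s i)%R%:R - (t i x <= 0)%R%:R.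
Let G (i : I) (h : R) (x : pt) : R := sig i h x * (f (y i x) * \1_K (y i x)).
(** Error made in the layer of the facet [i], as a function of the foot [z]: [L h] for moving [f]
    from the point to its foot, and [D] for every other facet plane so close that its constraint may
    change too. *)
Let om (L D : R) (i : I) (h : R) (z : pt) : R := L * h +
  D * \sum_(j | j != i) \1_[set z | `|dotv (n j) z - c j| <= 2 * h] z.
Let slab (i : I) (h : R) := [set u : R | 0 < u <= h * s i \/ h * s i < u <= 0].

Let slabP i h x : reflect (slab i h (t i x)) ((t i x <= 0) != (t i x <= h * s i)).
Proof.
by apply: (iffP idP); rewrite /slab/=; case: (leP _ 0); case: (leP _ (h * s i)) => //= *;
  [right|left| |..]; rewrite ?andbT//; tauto.
Qed.

Let s_le i : `|s i| <= 1. Proof. exact: coord_unit_le. Qed.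

Let slab_le i h u : 0 <= h -> slab i h u -> `|u| <= h.
Proof.
move=> h0; have := s_le i; rewrite ler_norml => /andP[s1 s2].
by move=> [/andP[u1 u2]|/andP[u1 u2]]; rewrite ler_norml; apply/andP; split; nra.
Qed.

Let indK x : \1_K x = [forall i, t i x <= 0]%R%:R :> R.
Proof.
rewrite indicE; congr (nat_of_bool _)%:R; apply/idP/forallP.
  by rewrite inE => Kx i; rewrite subr_le0; exact: Kx.
by move=> Kx; rewrite inE => i; rewrite -subr_le0; exact: Kx.
Qed.

Let indKs h x : \1_K (x - h *: w) = [forall i, t i x <= h * s i]%R%:R :> R.
Proof.
rewrite indK; congr (nat_of_bool _)%:R; apply: eq_forallb => i.
by rewrite dotvBr dotvZr dotv_delta addrAC subr_le0.
Qed.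

Let dotv_proj i j x : dotv (n j) x - c j =
  (dotv (n j) (y i x) - c j) + t i x * dotv (n j) (n i).
Proof. by rewrite -[x in LHS](plane_projK (n i) (c i) x) dotvDr dotvZr addrAC. Qed.

(* Outside the slabs both sides vanish.  In the slab of face [k] and away from
   the other facet hyperplanes, only the constraint [k] changes, and the two sides
   differ by an increment of [f].  The remaining points are near an edge. *)
Let pointwise_bound r C L h x : 0 <= r -> K `<=` bx r ->
  0 <= C -> (forall z, bx (r + 2) z -> `|f z| <= C) ->
  0 <= L -> (forall e u v, 0 <= e -> bx (r + 2) u -> bx (r + 2) v -> bx e (u - v) ->
    `|f u - f v| <= L * e) ->
  0 < h <= 1 ->
  `|F h x - \sum_i G i h x| <=
  \sum_i \1_(tube (n i) (c i) (slab i h) (bx (r + 2))) x * om L (C + C) i h (y i x).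
Proof.
move=> r0 Kr C0 fC L0 fL /andP[h0 h1].
have h0' := ltW h0.
have om_ge z i : L * h <= om L (C + C) i h z.
  by rewrite lerDl mulr_ge0 ?addr_ge0// sumr_ge0// => j _; rewrite indicE.
have om0 z i : 0 <= om L (C + C) i h z by rewrite (le_trans _ (om_ge _ _))// mulr_ge0.
pose tb i : set pt := tube (n i) (c i) (slab i h) (bx (r + 2)).
have term0 i : 0 <= \1_(tb i) x * om L (C + C) i h (y i x).
  by rewrite mulr_ge0// indicE.
have sum0 : 0 <= \sum_i \1_(tube (n i) (c i) (slab i h) (bx (r + 2))) x *
    om L (C + C) i h (y i x).
  by apply: sumr_ge0 => i _; exact: term0.
(* A point of a slab and its foot are at distance at most [h <= 1]. Points of the translate of [K]
   lie in [bx (r + 1)] and their feet in [bx (r + 2)], which explains the radius of the tubes. *)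
have yx i e : slab i h (t i x) -> bx e (y i x) -> bx (e + 1) x.
  move=> sl ye; rewrite -(plane_projK (n i) (c i) x); apply: bx_add => // j.
  rewrite mxE normrM mulr_ile1// ?coord_unit_le//.
  exact: le_trans (slab_le h0' sl) h1.
have xy i e : slab i h (t i x) -> bx e x -> bx (e + 1) (y i x).
  move=> sl xe; rewrite /plane_proj; apply: bx_add => // j.
  rewrite !mxE normrN normrM mulr_ile1// ?coord_unit_le//.
  exact: le_trans (slab_le h0' sl) h1.
have sub12 (e : R) : e + 1 <= e + 2 by rewrite lerD2l ler1n.
have sub02 (e : R) : e <= e + 2 by rewrite lerDl.
have sig0 i : ~~ ((t i x <= 0) != (t i x <= h * s i)) -> sig i h x = 0.
  by rewrite negbK /sig => /eqP ->; rewrite subrr.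
have sig1 i : `|sig i h x| <= 1.
  exact: normr_bool_sub.
have [/forallP eqa|] := boolP [forall i, (t i x <= 0) == (t i x <= h * s i)].
  rewrite /F indKs indK (_ : [forall i, t i x <= h * s i] = [forall i, t i x <= 0]).
    rewrite subrr mulr0 big1 ?subrr ?normr0// => i _.
    by rewrite /G sig0 ?mul0r// negbK.
  by apply: eq_forallb => i; rewrite (eqP (eqa i)).
rewrite negb_forall => /existsP[i ai].
(* Passing from the foot to [x] changes the value of the constraint [j] by at most [h], and its
   threshold moves by [h * s j], again at most [h]. A margin of [2 h] therefore fixes the truth of
   both versions of the constraint. *)
pose good k := [forall j, (j != k) ==> (2 * h < `|dotv (n j) (y k x) - c j|)].
have [/existsP[k /andP[ak gk]]|nogood] :=
  boolP [exists k, ((t k x <= 0) != (t k x <= h * s k)) && good k].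
  have slk : slab k h (t k x) by exact/slabP.
  have aj j : j != k -> (t j x <= 0) = (dotv (n j) (y k x) <= c j) /\
      (t j x <= h * s j) = (dotv (n j) (y k x) <= c j).
    move=> jk; have := implyP (forallP gk j) jk; rewrite (dotv_proj k j x).
    have : `|t k x * dotv (n j) (n k)| <= h.
      rewrite normrM -[leRHS]mulr1 ler_pM//; first exact: (slab_le h0' slk).
      exact: dotv_unit_le.
    have : `|h * s j| <= h.
      by rewrite normrM (ger0_norm h0') ler_piMr.
    rewrite -(subr_le0 (c j)); move: (t k x * _) (dotv (n j) (y k x) - c j) (h * s j).
    move=> B A S; rewrite !ler_norml => /andP[S1 S2] /andP[B1 B2].
    have [A0|A0] := leP A 0.
      by rewrite ler0_norm// => A1; split; [have : A + B <= 0 by lra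
        |have : A + B <= S by lra] => ->.
    rewrite gtr0_norm// => A1; split; apply/negbTE; rewrite -ltNge; lra.
  pose P := [forall j, (j != k) ==> (dotv (n j) (y k x) <= c j)].
  have forallE (b : I -> bool) : (forall j, j != k -> b j = (dotv (n j) (y k x) <= c j)) ->
      [forall j, b j] = b k && P.
    move=> bE; apply/forallP/andP => [bj|[bk /forallP Pj] j].
      by split => //; apply/forallP => j; apply/implyP => jk; rewrite -bE.
    by have [->//|jk] := eqVneq j k; rewrite bE// (implyP (Pj j)).
  have K1 : \1_K (y k x) = P%:R :> R.
    rewrite indK; congr (nat_of_bool _)%:R.
    rewrite (forallE (fun j => t j (y k x) <= 0)) => [|j jk]; last by rewrite subr_le0.
    by rewrite dotv_plane_proj// subrr lexx.
  rewrite /F indKs indK (forallE (fun j => t j x <= 0)); last by move=> j /aj[].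
  rewrite (forallE (fun j => t j x <= h * s j)); last by move=> j /aj[].
  rewrite [X in _ - X](bigD1 k)//= [X in _ - (_ + X)]big1 => [|j jk]; last first.
    by rewrite /G sig0 ?mul0r//; have [-> ->] := aj _ jk; rewrite eqxx.
  rewrite addr0 /G K1 /sig.
  have [Pt|Pf] := boolP P; last first.
    by rewrite !andbF subrr !mulr0 subr0 normr0.
  rewrite !andbT mulr1 [X in `|X - _|]mulrC -mulrBr normrM.
  have yK : K (y k x).
    move: K1; rewrite Pt indicE; case: (boolP (_ \in _)) => [/[!inE]//|_ /eqP].
    by rewrite eq_sym oner_eq0.
  have yr := Kr _ yK; have xr := yx _ _ slk yr.
  rewrite (bigD1 k)//= -[leLHS]addr0 lerD//; last by
    apply: sumr_ge0 => l _; exact: term0.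
  rewrite indicE mem_set ?mul1r; last first.
    by split => //; exact: bx_sub yr.
  apply: le_trans (om_ge _ _); rewrite -[leRHS]mul1r ler_pM//; first exact: sig1.
  apply: fL => //; [exact: bx_sub xr|exact: bx_sub yr|].
  rewrite /plane_proj opprB addrC subrK => j.
  rewrite mxE normrM -[leRHS]mulr1 ler_pM// ?coord_unit_le//; exact: (slab_le h0' slk).
(* Near an edge no cancellation is used: [F] and each [G k] are bounded by [C] separately, hence the
   weight [C + C] in [om]. *)
have om_bad k : (t k x <= 0) != (t k x <= h * s k) -> C + C <= om L (C + C) k h (y k x).
  move=> ak; move: nogood; rewrite negb_exists => /forallP/(_ k).
  rewrite ak /= /good negb_forall => /existsP[j]; rewrite negb_imply -leNgt => /andP[jk cj].
  rewrite -[leLHS]add0r lerD// ?mulr_ge0// -[leLHS]mulr1 ler_wpM2l ?addr_ge0//.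
  rewrite (bigD1 j)//= indicE mem_set// lerDl; apply: sumr_ge0 => l _.
  by rewrite indicE.
have FC : `|F h x| <= \sum_k \1_(tb k) x * C.
  rewrite /F normrM; have [|nK] := pselect (K x \/ K (x - h *: w)); last first.
    rewrite !indicE !memNset; [|tauto|tauto].
    rewrite subrr normr0 mulr0; apply: sumr_ge0 => l _.
    by rewrite mulr_ge0// indicE.
  have sli : slab i h (t i x) by exact/slabP.
  move=> KK; have xr : bx (r + 1) x.
    case: KK => [/Kr|/Kr xr]; first by apply: bx_sub; rewrite lerDl.
    rewrite -[x](subrK (h *: w)); apply: bx_add => //.
    by apply: bx_sub (bx_delta h j0); rewrite ger0_norm.
  have ti : \1_(tb i) x = 1 :> R.
    by rewrite indicE mem_set//; split => //; apply: bx_sub (xy _ _ sli xr); rewrite -addrA.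
  rewrite (bigD1 i)//= ti mul1r.
  rewrite -[leLHS]addr0; apply: lerD; last first.
    by apply: sumr_ge0 => l _; rewrite mulr_ge0// indicE.
  rewrite -[leRHS]mulr1 ler_pM//; first by apply: fC; exact: bx_sub xr.
  by rewrite !indicE normr_bool_sub.
have GC k : `|G k h x| <= \1_(tb k) x * C.
  have [ak|/sig0] := boolP ((t k x <= 0) != (t k x <= h * s k)); last first.
    by rewrite /G => ->; rewrite mul0r normr0 mulr_ge0// indicE.
  have slk : slab k h (t k x) by exact/slabP.
  have [Ky|nKy] := pselect (K (y k x)); last first.
    rewrite /G [X in _ * (_ * X)]indicE memNset// !mulr0 normr0.
    by rewrite mulr_ge0// indicE.
  have yr : bx (r + 2) (y k x) by apply: bx_sub (Kr _ Ky).
  rewrite [leRHS]mulrC indicE mem_set ?mulr1 /G; last by split.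
  rewrite [X in _ * (_ * X)]indicE (mem_set Ky) mulr1 normrM -[leRHS]mul1r ler_pM//.
  exact: fC.
apply: le_trans (ler_normB _ _) _.
apply: le_trans (lerD FC (le_trans (ler_norm_sum _ _ _) (ler_sum _ (fun k _ => GC k)))) _.
rewrite -big_split /=; apply: ler_sum => k _; rewrite -mulrDr.
have [/[dup] tk [/slabP ak _]|ntk] := pselect (tb k x).
  by rewrite ler_wpM2l ?indicE// om_bad.
by rewrite indicE memNset// !mul0r.
Qed.

Local Notation unit_tube i A := (tube (n i) (c i) [set u | 0 < u <= 1] A).

Let slabE i h : 0 <= h ->
  slab i h = if 0 <= s i then [set u | 0 < u <= h * s i] else [set u | h * s i < u <= 0].
Proof.
move=> h0; apply/seteqP; split => u; case: ifPn => si /=; rewrite /slab/=.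
- have hs : 0 <= h * s i by rewrite mulr_ge0.
  by case=> // /andP[u1 u2]; have := lt_le_trans u1 u2; rewrite ltNge hs.
- have hs : h * s i <= 0 by rewrite mulr_ge0_le0// ltW// ltNge.
  by case=> // /andP[u1 u2]; have := lt_le_trans u1 u2; rewrite ltNge hs.
- by left.
- by right.
Qed.

Let measurable_slab i h : 0 <= h -> measurable (slab i h).
Proof. by move=> h0; rewrite slabE//; case: ifP => _; exact: measurable_Ioc. Qed.

Let slab_int i h A g : 0 <= h -> measurable A -> bdd A -> LB g ->
  \int[leb]_(x in tube (n i) (c i) (slab i h) A) g (y i x) =
  h * `|s i| * \int[leb]_(x in unit_tube i A) g (y i x).
Proof.
move=> h0 mA bA Lg; rewrite slabE//; case: ifPn => si.
  by rewrite tube_linear ?mulr_ge0// subr0 (ger0_norm si).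
have si0 : s i <= 0 by rewrite ltW// ltNge.
by rewrite tube_linear ?mulr_ge0_le0// sub0r -mulrN (ler0_norm si0).
Qed.

Let slab_bx i h r A : 0 <= h <= 1 -> A `<=` bx r ->
  tube (n i) (c i) (slab i h) A `<=` bx (r + 1).
Proof.
move=> /andP[h0 h1] Ar; apply: tube_bx => // u /(slab_le h0) /= uh.
exact: le_trans uh h1.
Qed.

Let LB_le i a : LB (fun x : pt => (t i x <= a)%R%:R).
Proof.
have mE : measurable [set x | dotv (n i) x <= c i + a].
  have := measurable_dotv (n i) measurableT (measurable_itv `]-oo, (c i + a)]).
  by rewrite setTI set_itvE.
rewrite (_ : (fun x : pt => _) = \1_[set x | dotv (n i) x <= c i + a]).
  exact: LB_indic.
apply/funext => x; rewrite indicE lerBlDl; congr (nat_of_bool _)%:R.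
by apply/idP/idP; rewrite inE.
Qed.

Let LB_indK : LB (\1_K : pt -> R).
Proof. by apply: LB_indic; exact: measurable_polytope. Qed.

Let LB_F h : LB (F h).
Proof.
apply: LB_mul => //; apply: LB_sub => //.
exact: (LB_shift (- (h *: w)) LB_indK).
Qed.

Let LB_G i h : LB (G i h).
Proof.
apply: LB_mul; first by apply: LB_sub; exact: LB_le.
by apply: (LB_comp_proj (n i) (c i) (f := fun z => f z * \1_K z)); exact: LB_mul.
Qed.

Let LB_om L D i h : LB (om L D i h).
Proof.
apply: LB_add; first exact: LB_cst.
apply: LB_scale; apply: LB_sum => j _; apply: LB_indic.
have mN : measurable_fun setT (fun z : pt => `|dotv (n j) z - c j|).
  by case: (LB_norm (LB_sub (LB_dotv1 (n j)) (LB_cst (c j)))).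
have := mN measurableT _ (measurable_itv `]-oo, (2 * h)]).
by rewrite setTI set_itvE.
Qed.

(** A change of variables moves the shift from [f] to the polytope. The cube [bx (r + 3)] is a
    common domain of integration: it also contains the tubes of thickness at most 1 over
    [bx (r + 2)]. *)
Let int_F h r : K `<=` bx r -> 0 <= h <= 1 ->
  \int[leb]_(x in K) (f (h *: w + x) - f x) = \int[leb]_(x in bx (r + 3)) F h x.
Proof.
move=> Kr /andP[h0 h1]; have mK := measurable_polytope.
have r1 : r <= r + 3 by rewrite lerDl.
pose Kh : set pt := [set x | K (x + - (h *: w))].
have mKh : measurable Kh.
  by have := measurable_shift (- (h *: w)) measurableT mK; rewrite setTI.
have Khr : Kh `<=` bx (r + 3).
  move=> x /Kr xr; rewrite -[x](subrK (h *: w)); apply: bx_add => //.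
  apply: bx_sub (bx_delta h j0); rewrite ger0_norm// (le_trans h1)//.
  by rewrite ler1n.
rewrite LB_RintegralB//; last first.
  by under eq_fun do rewrite addrC; exact: LB_shift.
have -> : \int[leb]_(x in K) f (h *: w + x) = \int[leb]_(x in Kh) f x.
  rewrite [RHS](LB_Rintegral_shift (h *: w))//; last by exists (r + 3).
  rewrite (_ : [set x | Kh (x + h *: w)] = K).
    by under eq_Rintegral do rewrite addrC.
  by rewrite /Kh; apply/seteqP; split => x /=; rewrite addrK.
rewrite (Rintegral_sub _ Khr) (Rintegral_sub _ (subset_trans Kr (bx_sub r1))).
rewrite -LB_RintegralB//.
- by apply: eq_Rintegral => x _; rewrite /F mulrC [X in _ - X]mulrC -mulrBr.
- exact: measurable_bx.
- by exists (r + 3).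
- by apply: LB_mul => //; exact: LB_indic.
- exact: LB_mul.
Qed.

Let int_G i h r : K `<=` bx r -> 0 <= h <= 1 ->
  \int[leb]_(x in bx (r + 3)) G i h x =
  h * s i * \int[leb]_(x in unit_tube i K) f (y i x).
Proof.
move=> Kr h01; have /andP[h0 h1] := h01; have mK := measurable_polytope.
have sub : tube (n i) (c i) (slab i h) K `<=` bx (r + 3).
  by apply: (subset_trans (slab_bx h01 Kr)); apply: bx_sub; rewrite lerD2l ler1n.
(* On its slab [sig] has the constant sign of [s i], which turns the thickness [h |s i|] into
   [h s i]. *)
have GE x : G i h x =
    (if 0 <= s i then 1 else -1) *
    (\1_(tube (n i) (c i) (slab i h) K) x * f (y i x)).
  rewrite /G [X in _ = _ * (X * _)]indicE.
  have [Ky|nKy] := pselect (K (y i x)); last first.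
    rewrite [X in _ * (_ * X)]indicE memNset// !mulr0 memNset ?mul0r ?mulr0//.
    by case=> _ /nKy.
  rewrite [X in _ * (_ * X)]indicE (mem_set Ky) mulr1.
  rewrite /sig; have [st|nst] := pselect (slab i h (t i x)); last first.
    rewrite memNset; last by case.
    have /eqP <- : (t i x <= 0) == (t i x <= h * s i).
      by apply: contrapT => /negP/slabP.
    by rewrite subrr !mul0r mulr0.
  rewrite mem_set ?mul1r; last by split.
  have := st; rewrite slabE//; case: ifPn => si /= /andP[u1 u2].
    by rewrite u2 leNgt u1 subr0.
  by rewrite u2 leNgt u1 sub0r.
under eq_Rintegral do rewrite GE.
have mtb : measurable (tube (n i) (c i) (slab i h) K).
  by apply: measurable_tube => //; exact: measurable_slab.
rewrite LB_RintegralZ; last 3 first.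
- exact: measurable_bx.
- by exists (r + 3).
- by apply: LB_mul; [exact: LB_indic|exact: LB_comp_proj].
rewrite -(Rintegral_sub _ sub) slab_int//.
case: ifPn => si; first by rewrite mul1r ger0_norm.
have si0 : s i <= 0 by rewrite ltW// ltNge.
by rewrite ler0_norm// mulN1r mulrN mulNr opprK.
Qed.

Let int_bound i h r g : 0 <= h <= 1 -> LB g ->
  \int[leb]_(x in bx (r + 3)) (\1_(tube (n i) (c i) (slab i h) (bx (r + 2))) x * g (y i x)) =
  h * `|s i| * \int[leb]_(x in unit_tube i (bx (r + 2))) g (y i x).
Proof.
move=> h01 Lg; have /andP[h0 h1] := h01.
rewrite -Rintegral_sub; first by rewrite slab_int//; [exact: measurable_bx|exists (r + 2)].
have := slab_bx h01 (@subset_refl _ (bx (r + 2) : set pt)).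
by move=> /(_ i) /subset_trans; apply; apply: bx_sub; lra.
Qed.

(** Off the null cylinders of [edge_null], the foot of a fixed [x] has a positive distance to every
    other plane, so all the indicators vanish once [2 h] is smaller; bounded convergence applies. *)
Let om_cvg L D i r :
  \int[leb]_(x in unit_tube i (bx r)) om L D i k.+1%:R^-1 (y i x) @[k --> \oo] --> (0 : R).
Proof.
have mt : measurable (unit_tube i (bx r)).
  by apply: measurable_tube; [exact: measurable_Ioc|exact: measurable_bx].
have bt : bdd (unit_tube i (bx r)).
  exact: (bdd_tube (c i) (n1 i) (@Ioc_bound _ 0 1) (bdd_bx r)).
pose N := \big[setU/set0]_(j | j != i) [set x | dotv (n j) (y i x) = c j].
have mN j : measurable [set x | dotv (n j) (y i x) = c j].
  exact: (measurable_plane_proj (n i) (c i) (measurable_plane (n j) (c j))).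
have N0 : leb N = 0%E.
  apply/(negligibleP leb); first exact: bigsetU_measurable.
  apply: (big_ind (fun A => leb.-negligible A)); first exact: negligible_set0.
    by move=> A B; exact: negligibleU.
  by move=> j ji; apply/negligibleP => //; apply: edge_null; rewrite eq_sym.
rewrite -[X in _ --> X](_ : \int[leb]_(x in unit_tube i (bx r)) 0 = 0); last first.
  by rewrite Rintegral_cst// mul0r.
apply: (@bounded_convergence _ _ _ N _ _ (`|L| + `|D| * #|I|%:R)) => //.
- by move=> k; case: (LB_comp_proj (n i) (c i) (LB_om L D i k.+1%:R^-1)).
- move=> k x _; rewrite /om (le_trans (ler_normD _ _))// lerD// normrM.
    by rewrite ler_piMr// ger0_norm// ?invr_ge0// invf_le1// ler1n.
  rewrite ler_wpM2l// ger0_norm; last by apply: sumr_ge0 => j _; rewrite indicE.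
  rewrite -sum1_card natr_sum big_mkcond /=; apply: ler_sum => j _.
  by rewrite indicE; case: ifP => _ //; case: (_ \in _).
- exact: bigsetU_measurable.
move=> x _ nN.
have -> : (0 : R) = L * 0 + D * \sum_(j | j != i) 0 by rewrite big1// !mulr0 addr0.
apply: cvgD; first by apply: cvgMr; exact: cvg_harmonic.
apply: cvgMr; apply: cvg_sumr => j ji.
have xj : 0 < `|dotv (n j) (y i x) - c j|.
  rewrite normr_gt0 subr_eq0; apply/eqP => xj; apply: nN.
  by rewrite /N (bigD1 j)//=; left.
apply: cvg_near_cst.
have e0 : 0 < `|dotv (n j) (y i x) - c j| / 2 by rewrite divr_gt0.
have /cvgr0_norm_lt/(_ _ e0) := @cvg_harmonic R; apply: filterS => k.
rewrite /harmonic ger0_norm ?invr_ge0// ltr_pdivlMr// mulrC => hk.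
by rewrite indicE memNset//= leNgt hk.
Qed.

(* [w / k] times the difference quotient of [f] along [w] is the integral of [f]
   over the symmetric difference of [K] and its translate, up to sign. *)
Lemma gauss_polytope : (forall x, derivable f x w) -> LB (partial j0 f) ->
  \int[leb]_(x in K) partial j0 f x = \sum_i s i * surface_int (n i) (c i) K f.
Proof.
move=> df Ldf; have mK := measurable_polytope.
have [r0 Kr0] := bK; pose r := `|r0|.
have r_ge0 : 0 <= r by exact: normr_ge0.
have Kr : K `<=` bx r by apply: (subset_trans Kr0); apply: bx_sub; exact: ler_norm.
have [C0 fC0] := Lf.2 (r + 2); pose C := `|C0|.
have fC z : bx (r + 2) z -> `|f z| <= C.
  by move=> /fC0 /le_trans; apply; exact: ler_norm.
have [L L0 fL] := lipf (r + 2).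
have S_E i : surface_int (n i) (c i) K f = \int[leb]_(x in unit_tube i K) f (y i x).
  exact: surface_int_tube.
under eq_bigr do rewrite S_E.
set S := \sum_i _.
have h01 (k : nat) : 0 <= (k.+1%:R^-1 : R) <= 1.
  by rewrite invr_ge0 ler0n/= invf_le1// ler1n.
(* With [h = 1 / (k + 1)], the factor [k + 1] of the difference quotient cancels the thickness of
   the slabs, leaving exactly the surface integrals and the error [E k]. *)
pose E (k : nat) := \sum_i `|s i| *
  \int[leb]_(x in unit_tube i (bx (r + 2))) om L (C + C) i k.+1%:R^-1 (y i x).
pose u (k : nat) := k.+1%:R * \int[leb]_(x in K) (f (k.+1%:R^-1 *: w + x) - f x).
have uE k : `|u k - S| <= E k.
  have k0 : k.+1%:R != 0 :> R by rewrite pnatr_eq0.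
  have mB : measurable (bx (r + 3) : set pt) by exact: measurable_bx.
  have bB : bdd (bx (r + 3) : set pt) by exists (r + 3).
  rewrite /u (int_F Kr)//; set h : R := k.+1%:R^-1.
  have h0 : 0 <= h by have /andP[] := h01 k.
  have mtb i : measurable (tube (n i) (c i) (slab i h) (bx (r + 2))).
    by apply: measurable_tube; [exact: measurable_slab|exact: measurable_bx].
  have SE : S = k.+1%:R * \int[leb]_(x in bx (r + 3)) (\sum_i G i h x).
    rewrite LB_Rintegral_sum//.
    rewrite mulr_sumr; apply: eq_bigr => i _.
    by rewrite (int_G _ Kr (h01 k)) -mulrA /h mulVKf.
  rewrite SE -mulrBr -LB_RintegralB//; last exact: LB_sum.
  rewrite normrM ger0_norm//.
  have -> : E k = k.+1%:R * \int[leb]_(x in bx (r + 3))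
      (\sum_i \1_(tube (n i) (c i) (slab i h) (bx (r + 2))) x * om L (C + C) i h (y i x)).
    rewrite LB_Rintegral_sum//; last first.
      move=> i _; apply: LB_mul; last exact: LB_comp_proj.
      exact: LB_indic.
    rewrite mulr_sumr; apply: eq_bigr => i _.
    by rewrite (int_bound _ _ (h01 k))// -mulrA /h mulVKf.
  rewrite ler_wpM2l//; apply: le_trans (LB_normr_Rintegral _ _ _) _ => //.
    by apply: LB_sub => //; exact: LB_sum.
  apply: LB_le_Rintegral => //.
  - by apply: LB_norm; apply: LB_sub => //; exact: LB_sum.
  - apply: LB_sum => i _; apply: LB_mul; last exact: LB_comp_proj.
    exact: LB_indic.
  move=> x _; apply: pointwise_bound => //; first exact: normr_ge0.
  by rewrite /h invr_gt0 ltr0n/=; have /andP[] := h01 k.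
have E0 : E k @[k --> \oo] --> (0 : R).
  have -> : (0 : R) = \sum_i `|s i| * 0 by rewrite big1// => i _; rewrite mulr0.
  by apply: cvg_sumr => i _; apply: cvgMr; exact: om_cvg.
have ucvg : u k @[k --> \oo] --> \int[leb]_(x in K) partial j0 f x.
  exact: cvg_difference_quotient.
have nu : `|u k - S| @[k --> \oo] --> `|\int[leb]_(x in K) partial j0 f x - S|.
  by apply: cvg_norm; apply: cvgB => //; exact: cvg_cst.
apply/eqP; rewrite -subr_eq0 -normr_le0.
by apply: (ler_cvg_to nu E0); apply: nearW.
Qed.

End gauss.

(** * Regular functions and polynomials *)

Section regular.
Context {R : realType} {d : nat}.
Local Notation pt := 'rV[R]_d.
Implicit Types f g : pt -> R.

Lemma is_derive_affine g (x v : pt) (a : R) :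
  (forall h : R, g (h *: v + x) = g x + h * a) -> is_derive x v g a.
Proof.
move=> gE.
have qa : \forall h \near 0^', (h : R)^-1 *: ((g \o shift x) (h *: v) - g x) = a.
  near=> h; have h0 : h != 0 by near: h; exact: nbhs_dnbhs_neq.
  by rewrite /= gE [g x + _]addrC addrK /GRing.scale/= mulKf.
have ca : (h : R)^-1 *: ((g \o shift x) (h *: v) - g x) @[h --> 0^'] --> a.
  exact: cvg_near_cst.
apply: DeriveDef; first by apply/cvg_ex; exists a.
exact: cvg_lim ca.
Unshelve. all: by end_near. Qed.

(** What the divergence theorem asks of an integrand, in a form stable under sums and products;
    constants and coordinates then give all polynomials. *)
Definition C1L f := [/\ LLip f, continuous f,
  forall j x, derivable f x (delta_mx 0 j) & forall j, continuous (partial j f)].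

Lemma C1L_LB f : C1L f -> LB f.
Proof. by case=> _ cf _ _; exact: LB_continuous. Qed.

Lemma C1L_partial_LB f j : C1L f -> LB (partial j f).
Proof. by case=> _ _ _ cf; exact: LB_continuous. Qed.

Lemma C1L_cst a : C1L (fun=> a).
Proof.
split.
- by move=> r; exists 0 => // e x y; rewrite subrr normr0 mul0r.
- exact: cst_continuous.
- by move=> j x; exact: derivable_cst.
- move=> j; rewrite (_ : partial j _ = fun=> 0); first exact: cst_continuous.
  by apply/funext => x; exact: derive_cst.
Qed.

Lemma derive_coord (x v : pt) i : is_derive x v (fun x => x 0 i) (v 0 i).
Proof. by apply: is_derive_affine => h; rewrite !mxE addrC. Qed.

Lemma C1L_coord i : C1L (fun x => x 0 i).
Proof.
split.
- by move=> r; exists 1 => // e x y _ _ _ /(_ i); rewrite !mxE mul1r.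
- exact: coord_continuous.
- by move=> j x; have [] := derive_coord x (delta_mx 0 j) i.
- move=> j; rewrite (_ : partial j _ = fun=> (delta_mx 0 j : pt) 0 i).
    exact: cst_continuous.
  by apply/funext => x; have [] := derive_coord x (delta_mx 0 j) i.
Qed.

Lemma partialD f g j : (forall x, derivable f x (delta_mx 0 j)) ->
  (forall x, derivable g x (delta_mx 0 j)) ->
  partial j (fun x => f x + g x) = fun x => partial j f x + partial j g x.
Proof. by move=> df dg; apply/funext => x; exact: deriveD. Qed.

Lemma partialM f g j : (forall x, derivable f x (delta_mx 0 j)) ->
  (forall x, derivable g x (delta_mx 0 j)) ->
  partial j (fun x => f x * g x) = fun x => f x * partial j g x + partial j f x * g x.
Proof.
move=> df dg; apply/funext => x; rewrite [RHS]/= [X in _ = _ + X]mulrC.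
exact: deriveM.
Qed.

Lemma LLipD f g : LLip f -> LLip g -> LLip (fun x => f x + g x).
Proof.
move=> lf lg r; have [L L0 hL] := lf r; have [M M0 hM] := lg r.
exists (L + M); first exact: addr_ge0.
move=> e x y e0 xr yr xy; rewrite opprD addrACA (le_trans (ler_normD _ _))//.
by rewrite mulrDl lerD ?hL ?hM.
Qed.

Lemma LLipM f g : LLip f -> LLip g -> LB f -> LB g -> LLip (fun x => f x * g x).
Proof.
move=> lf lg [_ bf] [_ bg] r; have [L L0 hL] := lf r; have [M M0 hM] := lg r.
have [C hC] := bf r; have [D hD] := bg r.
exists (`|C| * M + L * `|D|); first by rewrite addr_ge0// mulr_ge0.
move=> e x y e0 xr yr xy.
rewrite (_ : _ - _ = f x * (g x - g y) + (f x - f y) * g y); last by ring.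
have fx : `|f x| <= `|C| by rewrite (le_trans (hC _ xr))// ler_norm.
have gy : `|g y| <= `|D| by rewrite (le_trans (hD _ yr))// ler_norm.
apply: le_trans (ler_normD _ _) _; rewrite [leRHS]mulrDl lerD// normrM.
  by rewrite -mulrA ler_pM// hM.
by rewrite mulrAC ler_pM// hL.
Qed.

Lemma C1LD f g : C1L f -> C1L g -> C1L (fun x => f x + g x).
Proof.
case=> lf cf df dcf [lg cg dg dcg]; split.
- exact: LLipD.
- by move=> x; apply: continuousD; [exact: cf|exact: cg].
- by move=> j x; exact: derivableD.
- by move=> j; rewrite partialD// => x; apply: continuousD; [exact: dcf|exact: dcg].
Qed.

Lemma C1LM f g : C1L f -> C1L g -> C1L (fun x => f x * g x).
Proof.
move=> Cf Cg; case: (Cf) => lf cf df dcf; case: (Cg) => lg cg dg dcg; split.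
- by apply: LLipM => //; exact: C1L_LB.
- by move=> x; apply: continuousM; [exact: cf|exact: cg].
- by move=> j x; exact: derivableM.
- move=> j; rewrite partialM// => x; 
  apply: (@continuousD _ _ _ (fun x => f x * partial j g x) (fun x => partial j f x * g x));
  apply: continuousM.
  + exact: cf.
  + exact: dcg.
  + exact: dcf.
  + exact: cg.
Qed.

Lemma C1LZ a f : C1L f -> C1L (fun x => a * f x).
Proof. by move=> Cf; apply: C1LM => //; exact: C1L_cst. Qed.

Lemma partialZ a f j : (forall x, derivable f x (delta_mx 0 j)) ->
  partial j (fun x => a * f x) = fun x => a * partial j f x.
Proof. by move=> df; apply/funext => x; exact: deriveZ. Qed.

Lemma C1L_sum I (s : seq I) (P : pred I) (F : I -> pt -> R) :
  (forall i, P i -> C1L (F i)) -> C1L (fun x => \sum_(i <- s | P i) F i x).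
Proof.
move=> CF; elim: s => [|i s IH].
  by under eq_fun do rewrite big_nil; exact: C1L_cst.
under eq_fun do rewrite big_cons.
by have [Pi|_] := boolP (P i) => //; apply: C1LD => //; exact: CF.
Qed.

Lemma partial_sum I (s : seq I) (P : pred I) (F : I -> pt -> R) j :
  (forall i, P i -> C1L (F i)) ->
  partial j (fun x => \sum_(i <- s | P i) F i x) =
  fun x => \sum_(i <- s | P i) partial j (F i) x.
Proof.
move=> CF; elim: s => [|i s IH].
  under eq_fun do rewrite big_nil; under [RHS]eq_fun do rewrite big_nil.
  by apply/funext => x; exact: derive_cst.
under eq_fun do rewrite big_cons; under [RHS]eq_fun do rewrite big_cons.
have [Pi|_] := boolP (P i) => //; rewrite partialD ?IH//.
  by have [_ _ df _] := CF _ Pi.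
by have [_ _ df _] := C1L_sum s CF.
Qed.

Lemma C1L_prod I (s : seq I) (P : pred I) (F : I -> pt -> R) :
  (forall i, P i -> C1L (F i)) -> C1L (fun x => \prod_(i <- s | P i) F i x).
Proof.
move=> CF; elim: s => [|i s IH].
  by under eq_fun do rewrite big_nil; exact: C1L_cst.
under eq_fun do rewrite big_cons.
by have [Pi|_] := boolP (P i) => //; apply: C1LM => //; exact: CF.
Qed.

Lemma C1LX f k : C1L f -> C1L (fun x => f x ^+ k).
Proof.
move=> Cf; elim: k => [|k IH]; first by under eq_fun do rewrite expr0; exact: C1L_cst.
by under eq_fun do rewrite exprS; exact: C1LM.
Qed.

End regular.

Section polynomial.
Context {R : realType} {d : nat}.
Local Notation pt := 'rV[R]_d.
Implicit Types f g : pt -> R.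

Definition monomial (a : 'I_d -> nat) (x : pt) : R := \prod_i x 0 i ^+ a i.

Lemma poly_fun_monomial k (a : 'I_d -> nat) : (\sum_i a i <= k)%N ->
  poly_fun k (monomial a).
Proof.
move=> ak; have aik i : (a i < k.+1)%N.
  by rewrite ltnS (leq_trans _ ak)// (bigD1 i)//= leq_addr.
pose b : {ffun 'I_d -> 'I_k.+1} := [ffun i => Ordinal (aik i)].
have ba i : b i = a i :> nat by rewrite ffunE.
exists (fun b' => (b' == b)%:R); apply/funext => x.
rewrite (bigD1 b)/= ?eqxx ?mul1r; last by under eq_bigr do rewrite ba.
rewrite [X in _ + X]big1 ?addr0; last by move=> e /andP[_ /negbTE ->]; rewrite mul0r.
by apply: eq_bigr => i _; rewrite ba.
Qed.

Lemma poly_funE k f : poly_fun k f -> exists c : {ffun 'I_d -> 'I_k.+1} -> R,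
  f = fun x => \sum_(a : {ffun 'I_d -> 'I_k.+1} | (\sum_i a i <= k)%N)
    c a * monomial (fun i => a i : nat) x.
Proof. by []. Qed.

Lemma poly_funD k f g : poly_fun k f -> poly_fun k g -> poly_fun k (fun x => f x + g x).
Proof.
move=> [c ->] [e ->]; exists (fun a => c a + e a); apply/funext => x.
by rewrite -big_split/=; apply: eq_bigr => a _; rewrite mulrDl.
Qed.

Lemma poly_funZ k a f : poly_fun k f -> poly_fun k (fun x => a * f x).
Proof.
move=> [c ->]; exists (fun b => a * c b); apply/funext => x.
by rewrite mulr_sumr; apply: eq_bigr => b _; rewrite mulrA.
Qed.

Lemma poly_fun0 k : poly_fun k (fun _ : pt => 0 : R).
Proof. by exists (fun=> 0); apply/funext => x; rewrite big1// => i _; rewrite mul0r. Qed.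

Lemma poly_fun_sum k I (s : seq I) (P : pred I) (F : I -> pt -> R) :
  (forall i, P i -> poly_fun k (F i)) -> poly_fun k (fun x => \sum_(i <- s | P i) F i x).
Proof.
move=> CF; elim: s => [|i s IH].
  by under eq_fun do rewrite big_nil; exact: poly_fun0.
under eq_fun do rewrite big_cons.
by have [Pi|_] := boolP (P i) => //; apply: poly_funD => //; exact: CF.
Qed.

Lemma poly_funW k l f : (k <= l)%N -> poly_fun k f -> poly_fun l f.
Proof.
move=> kl /poly_funE[c ->]; apply: poly_fun_sum => a ak.
by apply: poly_funZ; apply: poly_fun_monomial; exact: leq_trans kl.
Qed.

Lemma C1L_monomial a : C1L (monomial a).
Proof. by apply: C1L_prod => i _; apply: C1LX; exact: C1L_coord. Qed.

Lemma C1L_poly k f : poly_fun k f -> C1L f.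
Proof.
by move=> /poly_funE[c ->]; apply: C1L_sum => a _; apply: C1LZ; exact: C1L_monomial.
Qed.

Lemma partial_monomial a j : exists b : R, exists a' : 'I_d -> nat,
  (\sum_i a' i <= (\sum_i a i).-1)%N /\ partial j (monomial a) = fun x => b * monomial a' x.
Proof.
pose rest (x : pt) := \prod_(i | i != j) x 0 i ^+ a i.
have mE : monomial a = fun x => x 0 j ^+ a j * rest x.
  by apply/funext => x; rewrite /monomial (bigD1 j).
have drest x : is_derive x (delta_mx 0 j : pt) rest 0.
  apply: is_derive_affine => h; rewrite mulr0 addr0; apply: eq_bigr => i ij.
  by rewrite !mxE eqxx (negbTE ij) mulr0 add0r.
have dr x : derivable rest x (delta_mx 0 j) by have [] := drest x.
have dX (k : nat) x : derivable (fun x : pt => x 0 j ^+ k) x (delta_mx 0 j).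
  by have [_ _ h _] := C1LX k (C1L_coord j : C1L (fun x : pt => _)); exact: h.
case aj : (a j) mE => [|k] mE.
  exists 0, (fun=> 0%N); split; first by rewrite big1.
  rewrite mE partialM//; apply/funext => x; rewrite mul0r.
  have -> : partial j rest x = 0 by have [] := drest x.
  under [X in _ + partial j X x * _]eq_fun do rewrite expr0.
  have -> : partial j (fun=> 1 : R) x = 0 by exact: derive_cst.
  by rewrite mulr0 mul0r addr0.
exists k.+1%:R, (fun i => if i == j then k else a i); split.
  rewrite [X in (_ <= X.-1)%N](bigD1 j)//= aj addSn /= (bigD1 j)//= eqxx leq_add2l.
  by rewrite leq_eqVlt; apply/orP; left; apply/eqP; apply: eq_bigr => i /negbTE ->.
rewrite mE partialM//; apply/funext => x.
have -> : partial j rest x = 0 by have [] := drest x.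
rewrite mulr0 add0r /monomial [in RHS](bigD1 j)//= eqxx mulrA; congr (_ * _).
  have dc := derive_coord x (delta_mx 0 j) j.
  have := is_deriveX k.+1 dc; rewrite exprfctE => dk.
  have -> : partial j (fun x : pt => x 0 j ^+ k.+1) x =
     (k.+1%:R * x 0 j ^+ k) *: (delta_mx 0 j : pt) 0 j.
    by have [] := dk.
  by rewrite mxE !eqxx /GRing.scale/= mulr1.
by apply: eq_bigr => i /negbTE ->.
Qed.

Lemma partial_poly k f j : poly_fun k f -> poly_fun k.-1 (partial j f).
Proof.
move=> /poly_funE[c ->]; rewrite partial_sum; last first.
  by move=> a _; apply: C1LZ; exact: C1L_monomial.
apply: poly_fun_sum => a ak; rewrite partialZ; last first.
  by case: (C1L_monomial (fun i => a i : nat)).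
apply: poly_funZ; have [b [a' [a'a ->]]] := partial_monomial (fun i => a i : nat) j.
apply: poly_funZ; apply: poly_fun_monomial; apply: leq_trans a'a _.
by rewrite -!subn1 leq_sub2r.
Qed.

(** Restricted to the line from a point [z] of [A] to [x], [f] is a univariate polynomial [p] with
    as many roots near [z] as one wishes; so [p] is zero, and [f x] is its value at 1. *)
Lemma poly_fun_eq0 k f (A : set pt) : poly_fun k f -> open A -> A !=set0 ->
  (forall x, A x -> f x = 0) -> f = fun=> 0.
Proof.
move=> /poly_funE[c fE] oA [z Az] fA; apply/funext => x.
have /nbhs_ballP[e /= e0 eA] : nbhs z A by exact: open_nbhs_nbhs.
pose p : {poly R} := \sum_(a : {ffun 'I_d -> 'I_k.+1} | (\sum_i a i <= k)%N)
  c a *: \prod_i ((z 0 i)%:P + (x 0 i - z 0 i) *: 'X) ^+ a i.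
have pE t : p.[t] = f (z + t *: (x - z)).
  rewrite fE horner_sum; apply: eq_bigr => a _; rewrite hornerZ horner_prod.
  congr (_ * _); apply: eq_bigr => i _.
  by rewrite horner_exp hornerD hornerC hornerZ hornerX !mxE [X in _ + X]mulrC.
suff p0 : p = 0.
  have := pE 1; rewrite p0 horner0 scale1r addrCA subrr addr0 => <-.
  by [].
(* The summand 1 keeps [M] positive when [x = z]. The parameters [e / M / (n + 2)] are distinct and
   displace [z] by less than [e]; there are [size p] of them, one too many for a nonzero [p]. *)
pose M := `|x - z| + 1; have M0 : 0 < M by rewrite ltr_wpDl.
pose s := [seq e / M / n.+2%:R | n <- iota 0 (size p)].
apply/eqP; apply: contraT => p0.
have : (size s < size p)%N.
  apply: max_poly_roots => //; last first.
    rewrite map_inj_uniq ?iota_uniq// => u v /(mulfI _) /=.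
    move=> /(_ (lt0r_neq0 (divr_gt0 e0 M0))) /invr_inj /eqP.
    by rewrite eqr_nat !eqSS => /eqP.
  apply/allP => _ /mapP[n _ ->]; rewrite /root pE fA//; apply: eA; split => // i j.
  rewrite (ord1 i) /ball/= !mxE opprD addNKr normrN normrM.
  have eM : 0 < e / M / n.+2%:R by rewrite !divr_gt0.
  rewrite gtr0_norm//; have xz := normr_coord_le (x - z) j; rewrite !mxE in xz.
  apply: (@le_lt_trans _ _ (e / M / n.+2%:R * M)).
    by rewrite ler_pM2l// (le_trans xz)// lerDl.
  rewrite mulrAC divfK ?gt_eqF// ltr_pdivrMr// ltr_pMr// ltr1n.
  by [].
by rewrite size_map size_iota ltnn.
Qed.

End polynomial.

(** * Definiteness of the inner product and representation of linear forms *)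

Section positivity.
Context {R : realType} {d : nat}.
Local Notation pt := 'rV[R]_d.
Local Notation leb := (lebesgue_rV R d).

Lemma leb_ball_gt0 (x : pt) (e : R) : 0 < e -> (0 < leb (ball x e))%E.
Proof.
move=> e0.
have -> : ball x e = [set y : pt | forall i, `](x 0 i - e), (x 0 i + e)[%classic (y 0 i)].
  apply/seteqP; split => y /=.
    by case=> _ xy i; have := xy 0 i; rewrite ball_itv.
  by move=> xy; split => // i j; rewrite (ord1 i) ball_itv; exact: xy.
rewrite (lebesgue_rV_prod (fun i => measurable_itv _)).
have -> : (\prod_i lebesgue_measure `](x 0 i - e)%R, (x 0 i + e)%R[ =
   \prod_(i < d) (e *+ 2)%:E)%E.
  apply: eq_bigr => i _; rewrite lebesgue_measure_itv/= lte_fin.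
  rewrite ifT; last by rewrite ltrD2l gtrN.
  by rewrite -EFinB; congr EFin; rewrite mulr2n; ring.
apply: (big_ind (fun y : \bar R => 0 < y)%E) => //.
  by move=> a b; exact: mule_gt0.
by move=> _ _; rewrite lte_fin pmulrn_lgt0.
Qed.

Lemma Rintegral_sqr_eq0 (D A : set pt) (g : pt -> R) : continuous g ->
  measurable D -> bdd D -> open A -> A `<=` D ->
  \int[leb]_(x in D) (g x * g x) = 0 -> forall x, A x -> g x = 0.
Proof.
move=> cg mD bD oA AD g0 x Ax; apply/eqP; apply: contraT => gx.
have gg0 : 0 < g x * g x by rewrite -expr2 exprn_even_gt0.
have Lg : LB (fun y => g y * g y) by apply: LB_mul; exact: LB_continuous.
have [e e0 eA] : exists2 e, 0 < e & forall y, ball x e y -> D y /\ g x * g x / 2 <= g y * g y.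
  have cgg : {for x, continuous (fun y => g y * g y)} by apply: continuousM; exact: cg.
  have h1 : \forall y \near x, g x * g x / 2 < g y * g y.
    by apply: (cvgr_gt _ cgg); rewrite ltr_pdivrMr// ltr_pMr// ltr1n.
  have h2 : \forall y \near x, A y by exact: open_nbhs_nbhs.
  have /nbhs_ballP[e /= e0 he] : nbhs x ([set y | g x * g x / 2 < g y * g y] `&` A).
    exact: filterI h1 h2.
  exists e => // y /he[/ltW ? /AD].
  by split.
have mB : measurable (ball x e : set pt) by apply: rV_open_measurable; exact: ball_open.
have BD : ball x e `<=` D by move=> y /eA[].
have : 0 < \int[leb]_(y in D) (g y * g y).
  apply: (@lt_le_trans _ _ (\int[leb]_(y in D) (g x * g x / 2 * \1_(ball x e) y))).
    rewrite LB_RintegralZ//; last exact: LB_indic.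
    rewrite mulr_gt0 ?divr_gt0//.
    have -> : \int[leb]_(y in D) \1_(ball x e) y = \int[leb]_(y in ball x e) 1.
      by rewrite (Rintegral_sub _ BD); apply: eq_Rintegral => y _; rewrite mulr1.
    rewrite Rintegral_cst// mul1r fine_gt0// leb_ball_gt0//=.
    by apply: bdd_lty => //; exact: bdd_sub bD.
  apply: LB_le_Rintegral => //; first by apply: LB_scale; exact: LB_indic.
  move=> y _; rewrite indicE; case: (boolP (_ \in _)) => [/[!inE] /eA[_]|_].
    by rewrite mulr1.
  by rewrite mulr0 -expr2 sqr_ge0.
by rewrite g0 ltxx.
Qed.

End positivity.

(* [cokermx G] collects the vectors killed by [G], so that [l] is in the row space
   of [G] as soon as it vanishes on the null vectors of the form. *)
Lemma riesz_matrix (F : fieldType) n (G : 'M[F]_n) (l : 'rV[F]_n) :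
  (forall y : 'cV_n, y^T *m G *m y = 0 -> l *m y = 0) ->
  exists x : 'rV_n, x *m G = l.
Proof.
move=> lG; suff /submxP[x ->] : (l <= G)%MS by exists x.
rewrite submxE; apply/eqP/matrixP => i j; rewrite [RHS]mxE.
have Gc : G *m col j (cokermx G) = 0 by rewrite colE mulmxA mulmx_coker mul0mx.
have /(congr1 (fun A : 'M[F]_1 => A 0 0)) : l *m col j (cokermx G) = 0.
  by apply: lG; rewrite -mulmxA Gc mulmx0.
by rewrite colE mulmxA -colE (ord1 i) !mxE.
Qed.

(** The form [b] may be degenerate: it will be the Gram matrix of a spanning family that contains
    zero functions, so only compatibility of [l] with its null vectors can be required. *)
Lemma riesz_span (F : fieldType) (J : finType) (b : J -> J -> F) (l : J -> F) :
  (forall c : J -> F, \sum_i \sum_j c i * c j * b i j = 0 ->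
    \sum_j c j * l j = 0) ->
  exists x : J -> F, forall j, \sum_i x i * b i j = l j.
Proof.
move=> bl.
pose G : 'M[F]_#|J| := \matrix_(i, j) b (enum_val i) (enum_val j).
pose lv : 'rV[F]_#|J| := \row_j l (enum_val j).
have sumE (h : J -> F) : \sum_(i < #|J|) h (enum_val i) = \sum_j h j.
  by rewrite -(big_enum_val (A := predT) h) /=; apply: eq_bigl => i; rewrite inE.
have [|x xG] := @riesz_matrix _ _ G lv.
  move=> y /(congr1 (fun A : 'M[F]_1 => A 0 0)) yGy.
  apply/matrixP => i j; rewrite (ord1 i) (ord1 j) !mxE.
  pose c k := y (enum_rank k) 0.
  have cE k : y k 0 = c (enum_val k) by rewrite /c enum_valK.
  under eq_bigr do rewrite mxE cE mulrC.
  rewrite (sumE (fun k => c k * l k)); apply: bl.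
  rewrite -[RHS](_ : (0 : 'M[F]_1) 0 0 = 0); last by rewrite mxE.
  rewrite -yGy !mxE -sumE exchange_big -sumE; apply: eq_bigr => k _.
  rewrite mxE mulr_suml; apply: eq_bigr => q _.
  by rewrite !mxE !cE mulrAC.
exists (fun k => x 0 (enum_rank k)) => j.
have /matrixP/(_ 0 (enum_rank j)) := xG; rewrite !mxE enum_rankK => <-.
rewrite -sumE; apply: eq_bigr => k _.
by rewrite mxE enum_rankK enum_valK.
Qed.

(** * Broken functions on a mesh *)

Section surface.
Context {R : realType} {d : nat}.
Local Notation pt := 'rV[R]_d.
Local Notation leb := (lebesgue_rV R d).
Variables (n : pt) (c : R).
Hypothesis n1 : dotv n n = 1.

Lemma eq_surface_int (A B : set pt) f :
  (forall x, dotv n x = c -> A x <-> B x) ->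
  surface_int n c A f = surface_int n c B f.
Proof.
move=> AB; congr Rintegral; apply/seteqP; split => x [h1 h2]; split => //;
  by apply/AB => //; exact: dotv_plane_proj.
Qed.

Lemma surface_int_indic (A S : set pt) f :
  surface_int n c (A `&` S) f = surface_int n c A (fun x => \1_S x * f x).
Proof.
rewrite /surface_int.
transitivity (\int[leb]_(x in prism n c A `&` [set x | S (plane_proj n c x)])
    f (plane_proj n c x)).
  congr Rintegral; apply/seteqP; split => x.
    by case=> h1 [h2 h3]; split.
  by case=> -[h1 h2] h3; split.
rewrite Rintegral_indic; apply: eq_Rintegral => x _; congr (_ * _).
Qed.

Lemma measurable_prism A : measurable A -> measurable (prism n c A).
Proof.
move=> mA; apply: (@measurable_tube _ _ n c [set t | 0 <= t <= 1] A) => //.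
rewrite (_ : mkset _ = `[0, 1]%classic); first exact: measurable_itv.
by apply/seteqP; split => t /=; rewrite in_itv.
Qed.

Lemma bdd_prism A : bdd A -> bdd (prism n c A).
Proof.
apply: (@bdd_tube _ _ n c [set t | 0 <= t <= 1] A 1) => // t /= /andP[t0 t1].
by rewrite ger0_norm.
Qed.

Variables (A : set pt) (mA : measurable A) (bA : bdd A).

Lemma surface_int_sum I (s : seq I) (P : pred I) (f : I -> pt -> R) :
  (forall i, P i -> LB (f i)) ->
  surface_int n c A (fun x => \sum_(i <- s | P i) f i x) =
  \sum_(i <- s | P i) surface_int n c A (f i).
Proof.
move=> Lf; rewrite /surface_int LB_Rintegral_sum//.
- exact: measurable_prism.
- exact: bdd_prism.
- by move=> i /Lf; exact: LB_comp_proj.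
Qed.

Lemma surface_intD f g : LB f -> LB g ->
  surface_int n c A (fun x => f x + g x) = surface_int n c A f + surface_int n c A g.
Proof.
move=> Lf Lg; rewrite /surface_int LB_RintegralD//; try exact: LB_comp_proj.
- exact: measurable_prism.
- exact: bdd_prism.
Qed.

Lemma surface_intB f g : LB f -> LB g ->
  surface_int n c A (fun x => f x - g x) = surface_int n c A f - surface_int n c A g.
Proof.
move=> Lf Lg; rewrite /surface_int LB_RintegralB//; try exact: LB_comp_proj.
- exact: measurable_prism.
- exact: bdd_prism.
Qed.

Lemma surface_intZ a f : LB f ->
  surface_int n c A (fun x => a * f x) = a * surface_int n c A f.
Proof.
move=> Lf; rewrite /surface_int LB_RintegralZ//; try exact: LB_comp_proj.
- exact: measurable_prism.
- exact: bdd_prism.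
Qed.

Lemma surface_int_ge0 f : (forall x, 0 <= f x) -> 0 <= surface_int n c A f.
Proof. by move=> f0; apply: Rintegral_ge0. Qed.

End surface.

Section mesh_theory.
Context {R : realType} {d : nat}.
Local Notation pt := 'rV[R]_d.
Local Notation leb := (lebesgue_rV R d).
Variables (M : mesh R d) (Omega : set pt).
Hypothesis meshP : mesh_of M Omega.
Implicit Types (E : elt M) (e : face M).

Lemma nrm_unit e : dotv (nrm e) (nrm e) = 1.
Proof. by case: meshP => -[]. Qed.

Lemma elt2_neq e : elt2 e <> Some (elt1 e).
Proof. by case: meshP => -[]. Qed.

Lemma bdd_cell E : bdd (cell E).
Proof. by case: meshP => _ /(_ E)[bE _] _ _ _; exact: bounded_bdd. Qed.

Lemma facet_adj E e : adj E e -> fset e = facet E e.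
Proof.
rewrite /adj => /orP[/eqP <-//|/eqP eE].
by case: meshP => _ _ _ _ /(_ e); rewrite eE.
Qed.

Lemma sgn_sqr E e : sgn E e * sgn E e = 1.
Proof. by rewrite /sgn; case: ifP; rewrite ?mulr1// mulrNN mulr1. Qed.

Lemma nrmE_unit E e : dotv (nrmE E e) (nrmE E e) = 1.
Proof. by rewrite dotvZl dotvZr nrm_unit mulr1 sgn_sqr. Qed.

Local Notation cface E := {e : face M | adj E e}.

Lemma cell_polytope E : cell E =
  [set x | forall i : cface E, dotv (nrmE E (val i)) x <= sgn E (val i) * off (val i)].
Proof.
apply/seteqP; split => x /= h; first by move=> [e ae]; exact: h.
by move=> e ae; exact: (h (exist _ e ae)).
Qed.

Lemma measurable_cell E : measurable (cell E).
Proof. by rewrite cell_polytope; exact: measurable_polytope. Qed.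

Lemma measurable_fset e : measurable (fset e).
Proof. by apply: measurableI; [exact: measurable_cell|exact: measurable_plane]. Qed.

Lemma bdd_fset e : bdd (fset e).
Proof. by apply: bdd_sub (bdd_cell (elt1 e)) => x []. Qed.

(* A point in the relative interior of facet [i] separates the hyperplanes of
   parallel facets. *)
Lemma cell_edge_null E (i j : cface E) : i != j ->
  leb [set x | dotv (nrmE E (val j)) (plane_proj (nrmE E (val i))
    (sgn E (val i) * off (val i)) x) = sgn E (val j) * off (val j)] = 0%E.
Proof.
move=> ij; set n := nrmE E (val i); set m := nrmE E (val j).
set ci := _ * off (val i); set cj := _ * off (val j).
have n1 : dotv n n = 1 by exact: nrmE_unit.
have m1 : dotv m m = 1 by exact: nrmE_unit.
have strict (k l : cface E) : k != l -> exists2 x : pt,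
    dotv (nrmE E (val k)) x = sgn E (val k) * off (val k) &
    dotv (nrmE E (val l)) x < sgn E (val l) * off (val l).
  move=> kl; case: meshP => _ _ /(_ E (val k) (valP k))[x [_ /= xk] xl] _ _.
  exists x; first by rewrite dotvZl xk.
  by apply: xl; [exact: valP|rewrite eq_sym; exact: kl].
(* The component of [m] orthogonal to [n]. If it is nonzero, the set is a hyperplane with normal
   [a], hence null; if it is zero, the two planes are parallel and the set is empty. *)
pose a := m - dotv m n *: n.
have aE x : dotv m (plane_proj n ci x) = dotv a x + ci * dotv m n.
  rewrite /plane_proj dotvBr dotvZr /a dotvBl dotvZl; ring.
have [a0|a0] := eqVneq a 0; last first.
  rewrite (_ : mkset _ = [set x | dotv a x = cj - ci * dotv m n]).
    exact: hyperplane_null.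
  apply/seteqP; split => x /=; rewrite aE; first by move=> <-; rewrite addrK.
  by move=> ->; rewrite subrK.
have mE : m = dotv m n *: n by apply/eqP; rewrite -subr_eq0 -/a a0.
rewrite (_ : mkset _ = set0) ?measure0//; apply/seteqP; split => x //=.
rewrite aE a0 dot0v add0r => cij.
have [y yi yj] := strict _ _ ij.
rewrite -/n -/m -/ci -/cj in yi yj.
have : dotv m y = dotv m n * ci by rewrite {1}mE dotvZl yi.
by move=> my; move: yj; rewrite my mulrC cij ltxx.
Qed.

(** [gauss_polytope] integrates over the whole cell, but a surface integral sees only the points on
    the plane, that is the facet; [surface_intN] replaces the outward normal of [E] by the normal of
    the face. *)
Lemma gauss_cell E (f : pt -> R) j : C1L f ->
  elt_int E (partial j f) = \sum_(e | adj E e) nrmE E e 0 j * face_int e f.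
Proof.
move=> Cf; have Lf := C1L_LB Cf; have := Cf => -[lf _ df _].
rewrite /elt_int; have bK := bdd_cell E; rewrite cell_polytope in bK *.
rewrite (gauss_polytope (fun i => nrmE_unit E (val i)) bK (@cell_edge_null E))//; last first.
  exact: C1L_partial_LB.
rewrite -cell_polytope [RHS](big_sub (fun e => adj E e) (fun e => nrmE E e 0 j * face_int e f)).
apply: eq_bigr => -[e ae] _ /=; congr (_ * _).
have mcell := measurable_cell E; have bcell := bdd_cell E.
transitivity (surface_int (nrm e) (off e) (cell E) f).
  rewrite /nrmE /sgn; case: ifP => _; first by rewrite scale1r mul1r.
  by rewrite scaleN1r mulN1r surface_intN//; exact: nrm_unit.
rewrite /face_int (facet_adj ae); apply: eq_surface_int; first exact: nrm_unit.
by move=> x xe; split => [h|[]//]; split.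
Qed.

Lemma sum_adj (X : elt M -> face M -> R) :
  \sum_E \sum_(e | adj E e) X E e =
  \sum_e (X (elt1 e) e + if elt2 e is Some E2 then X E2 e else 0).
Proof.
rewrite (exchange_big_dep xpredT)//=; apply: eq_bigr => e _.
rewrite (bigD1 (elt1 e))/= /adj ?eqxx//; congr (_ + _).
case e2 : (elt2 e) => [E2|].
  rewrite (bigD1 E2)/= ?eqxx ?orbT/=; last first.
    by apply/eqP => e21; apply: (@elt2_neq e); rewrite e2 e21.
  rewrite big1 ?addr0// => E /andP[/andP[/orP[/eqP ->|/eqP[->]] h1] h2].
    by rewrite eqxx in h1.
  by rewrite eqxx in h2.
rewrite big1// => E /andP[/orP[/eqP ->|//]]; by rewrite eqxx.
Qed.

Definition C1v (v : bvec M) := forall E i, C1L (fun x => v E x 0 i).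
Definition C1s (q : bscal M) := forall E, C1L (q E).

Lemma divgE (v : pt -> pt) x : divg v x = \sum_j partial j (fun y => v y 0 j) x.
Proof. by apply: eq_bigr => j _; rewrite mxE. Qed.

Lemma LB_jump v e i : C1v v -> LB (fun x => jump e v x 0 i).
Proof.
move=> Cv; rewrite /jump; case: (elt2 e) => [E2|]; last exact: C1L_LB.
by under eq_fun do rewrite !mxE; apply: LB_sub; exact: C1L_LB.
Qed.

Lemma LB_avg v e i : C1v v -> LB (fun x => avg e v x 0 i).
Proof.
move=> Cv; rewrite /avg; case: (elt2 e) => [E2|]; last exact: C1L_LB.
by under eq_fun do rewrite !mxE; apply/LB_scale/LB_add; exact: C1L_LB.
Qed.

Lemma LB_jumps q e : C1s q -> LB (jump e q).
Proof.
move=> Cq; rewrite /jump; case: (elt2 e) => [E2|]; last exact: C1L_LB.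
by apply: LB_sub; exact: C1L_LB.
Qed.

Lemma LB_avgs q e : C1s q -> LB (avg e q).
Proof.
move=> Cq; rewrite /avg; case: (elt2 e) => [E2|]; last exact: C1L_LB.
by apply/LB_scale/LB_add; exact: C1L_LB.
Qed.

Lemma face_int_sum e I (s : seq I) (P : pred I) (f : I -> pt -> R) :
  (forall i, P i -> LB (f i)) ->
  face_int e (fun x => \sum_(i <- s | P i) f i x) = \sum_(i <- s | P i) face_int e (f i).
Proof.
exact: (surface_int_sum (off e) (nrm_unit e) (measurable_fset e) (bdd_fset e)).
Qed.

Lemma face_intD e f g : LB f -> LB g ->
  face_int e (fun x => f x + g x) = face_int e f + face_int e g.
Proof.
exact: (surface_intD (off e) (nrm_unit e) (measurable_fset e) (bdd_fset e)).
Qed.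

Lemma face_intB e f g : LB f -> LB g ->
  face_int e (fun x => f x - g x) = face_int e f - face_int e g.
Proof.
exact: (surface_intB (off e) (nrm_unit e) (measurable_fset e) (bdd_fset e)).
Qed.

Lemma face_intZ e a f : LB f -> face_int e (fun x => a * f x) = a * face_int e f.
Proof.
exact: (surface_intZ (off e) (nrm_unit e) (measurable_fset e) (bdd_fset e)).
Qed.

Lemma face_int_ge0 e f : (forall x, 0 <= f x) -> 0 <= face_int e f.
Proof. exact: surface_int_ge0. Qed.

Lemma elt_intD E f g : LB f -> LB g ->
  elt_int E (fun x => f x + g x) = elt_int E f + elt_int E g.
Proof. exact: (LB_RintegralD (measurable_cell E) (bdd_cell E)). Qed.

Lemma elt_intZ E a f : LB f -> elt_int E (fun x => a * f x) = a * elt_int E f.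
Proof. exact: (LB_RintegralZ (measurable_cell E) (bdd_cell E)). Qed.

Lemma elt_int_sum E I (s : seq I) (P : pred I) (f : I -> pt -> R) :
  (forall i, P i -> LB (f i)) ->
  elt_int E (fun x => \sum_(i <- s | P i) f i x) = \sum_(i <- s | P i) elt_int E (f i).
Proof. exact: (LB_Rintegral_sum (measurable_cell E) (bdd_cell E)). Qed.

Lemma elt_int_ge0 E f : (forall x, 0 <= f x) -> 0 <= elt_int E f.
Proof. by move=> f0; apply: Rintegral_ge0. Qed.

Lemma le_elt_int E f g : LB f -> LB g -> (forall x, f x <= g x) ->
  elt_int E f <= elt_int E g.
Proof.
by move=> Lf Lg fg; apply: (LB_le_Rintegral (measurable_cell E) (bdd_cell E)).
Qed.

Lemma LB_v v E i : C1v v -> LB (fun x => v E x 0 i).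
Proof. by move=> Cv; exact: C1L_LB. Qed.

Lemma LB_dot v w E F : C1v v -> C1v w -> LB (fun x => dotv (v E x) (w F x)).
Proof. by move=> Cv Cw; apply: LB_dotv => i; exact: LB_v. Qed.

Lemma sgn1 e : sgn (elt1 e) e = 1.
Proof. by rewrite /sgn eqxx. Qed.

Lemma sgn2 e E : elt2 e = Some E -> sgn E e = -1.
Proof.
move=> e2; rewrite /sgn ifN//; apply/eqP => e1.
by apply: (@elt2_neq e); rewrite e2 e1.
Qed.

Lemma gauss_mesh (v : bvec M) : C1v v ->
  \sum_E elt_int E (bdiv v E) = \sum_e face_int e (fun x => dotv (jump e v x) (nrm e)).
Proof.
move=> Cv.
have Lvn E e : LB (fun x => dotv (v E x) (nrm e)).
  by apply: LB_dotv => i; [exact: LB_v|exact: LB_cst].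
have -> : \sum_E elt_int E (bdiv v E) = \sum_E \sum_(e | adj E e)
    sgn E e * face_int e (fun x => dotv (v E x) (nrm e)).
  apply: eq_bigr => E _; rewrite (_ : bdiv v E = fun x => \sum_j partial j (fun y => v E y 0 j) x).
    rewrite elt_int_sum; last by move=> j _; exact: C1L_partial_LB.
    have -> : \sum_j elt_int E (partial j (fun y => v E y 0 j)) =
        \sum_j \sum_(e | adj E e) nrmE E e 0 j * face_int e (fun y => v E y 0 j).
      by apply: eq_bigr => j _; exact: gauss_cell.
    rewrite exchange_big; apply: eq_bigr => e _ /=.
    rewrite face_int_sum; last by move=> j _; apply: LB_mul; [exact: LB_v|exact: LB_cst].
    rewrite mulr_sumr; apply: eq_bigr => j _.
    rewrite /nrmE mxE -mulrA; congr (_ * _); rewrite -face_intZ; last exact: LB_v.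
    by congr face_int; apply/funext => x; rewrite mulrC.
  by apply/funext => x; rewrite /bdiv divgE.
rewrite (sum_adj (fun E e => sgn E e * face_int e (fun x => dotv (v E x) (nrm e)))).
apply: eq_bigr => e _; rewrite sgn1 mul1r /jump.
case e2 : (elt2 e) => [E2|]; last by rewrite addr0.
rewrite (sgn2 e2) mulN1r -face_intB//.
by congr face_int; apply/funext => x; rewrite dotvBl.
Qed.

Lemma C1v_scale q v : C1s q -> C1v v -> C1v (fun E x => q E x *: v E x).
Proof. by move=> Cq Cv E i; under eq_fun do rewrite mxE; exact: C1LM. Qed.

Lemma C1s_dot v w : C1v v -> C1v w -> C1s (fun E x => dotv (v E x) (w E x)).
Proof. by move=> Cv Cw E; apply: C1L_sum => i _; exact: C1LM. Qed.

Lemma LB_bdiv v E : C1v v -> LB (bdiv v E).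
Proof.
move=> Cv; rewrite (_ : bdiv v E = fun x => \sum_j partial j (fun y => v E y 0 j) x).
  by apply: LB_sum => j _; exact: C1L_partial_LB.
by apply/funext => x; rewrite /bdiv divgE.
Qed.

Lemma LB_bgrad q E i : C1s q -> LB (fun x => bgrad q E x 0 i).
Proof. by move=> Cq; under eq_fun do rewrite mxE; exact: C1L_partial_LB. Qed.

Lemma LB_bjac v E i j : C1v v -> LB (fun x => bjac v E x i j).
Proof. by move=> Cv; under eq_fun do rewrite mxE; exact: C1L_partial_LB. Qed.

Lemma bdiv_scale q v E x : C1s q -> C1v v ->
  bdiv (fun E x => q E x *: v E x) E x =
  bdiv v E x * q E x + dotv (v E x) (bgrad q E x).
Proof.
move=> Cq Cv; rewrite /bdiv !divgE mulr_suml /dotv -big_split /=.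
apply: eq_bigr => j _; rewrite mxE.
have [_ _ dq _] := Cq E; have [_ _ dv _] := Cv E j.
rewrite (_ : (fun y => (q E y *: v E y) 0 j) = fun y => q E y * v E y 0 j); last first.
  by apply/funext => y; rewrite mxE.
by rewrite partialM// mulrC; congr (_ + _); rewrite mulrC.
Qed.

(** The divergence theorem for [q t], with [[q t].n = {q} [t].n + {t}.n [q]] on interior faces. On a
    boundary face [[q t] = {q} [t]], so the remaining sum runs over interior faces only. *)
Lemma b_form_ibp t q : C1v t -> C1s q ->
  b_form t q = - vdot t (bgrad q) +
    \sum_(e | interior_face e) face_int e (fun x => dotv (avg e t x) (nrm e) * jump e q x).
Proof.
move=> Ct Cq; have := gauss_mesh (C1v_scale Cq Ct).
have Ltg E : LB (fun x => dotv (t E x) (bgrad q E x)).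
  by apply: LB_dotv => i; [exact: LB_v|exact: LB_bgrad].
have Lan e : LB (fun x => dotv (avg e t x) (nrm e)).
  by apply: LB_dotv => i; [exact: LB_avg|exact: LB_cst].
have Ljn e : LB (fun x => dotv (jump e t x) (nrm e)).
  by apply: LB_dotv => i; [exact: LB_jump|exact: LB_cst].
have -> : \sum_E elt_int E (bdiv (fun E x => q E x *: t E x) E) =
    \sum_E elt_int E (fun x => bdiv t E x * q E x) + vdot t (bgrad q).
  rewrite /vdot -big_split /=; apply: eq_bigr => E _.
  rewrite -elt_intD//; last by apply: LB_mul; [exact: LB_bdiv|exact: C1L_LB].
  by congr elt_int; apply/funext => x; exact: bdiv_scale.
have -> : \sum_e face_int e (fun x => dotv (jump e (fun E x => q E x *: t E x) x) (nrm e)) =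
    \sum_e face_int e (fun x => avg e q x * dotv (jump e t x) (nrm e)) +
    \sum_(e | interior_face e) face_int e (fun x => dotv (avg e t x) (nrm e) * jump e q x).
  rewrite [X in _ + X]big_mkcond -big_split /=; apply: eq_bigr => e _.
  rewrite /interior_face; case e2 : (elt2 e) => [E2|] /=.
    rewrite -face_intD; [|by apply: LB_mul => //; exact: LB_avgs
      |by apply: LB_mul => //; exact: LB_jumps].
    congr face_int; apply/funext => x; rewrite /jump /avg e2.
    by rewrite /GRing.scale /= !(dotvDl, dotvNl, dotvZl); field.
  rewrite addr0; congr face_int; apply/funext => x; rewrite /jump /avg e2.
  by rewrite dotvZl.
by rewrite /b_form => h; lra.
Qed.

Lemma LB_ext v E e i : C1v v -> LB (fun x => ext E e v x 0 i).
Proof.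
move=> Cv; rewrite /ext; case: (elt1 e == E); last exact: LB_v.
case: (elt2 e) => [E2|]; first exact: LB_v.
by under eq_fun do rewrite mxE; exact: LB_cst.
Qed.

Lemma measurable_lt0 f : LB f -> measurable [set x : pt | f x < 0].
Proof.
move=> [mf _]; have := mf measurableT _ (measurable_itv `]-oo, 0[).
by rewrite setTI set_itvE.
Qed.

(* The volume terms integrate to [1/2 {w}.n [|v|^2]] on interior faces, which the
   upwind terms complete to [1/2 |{w}.n| |[v]|^2]. *)
Lemma a_C_ge0 w v : C1v w -> C1v v -> 0 <= a_C w w v v.
Proof.
move=> Cw Cv; pose q : bscal M := fun E x => dotv (v E x) (v E x).
have Cq : C1s q by exact: C1s_dot.
pose G E e x := `|dotv (avg e w x) (nrmE E e)| * dotv (v E x - ext E e v x) (v E x).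
pose S E e := [set x | dotv (avg e w x) (nrmE E e) < 0].
have Lavg E e : LB (fun x => dotv (avg e w x) (nrmE E e)).
  by apply: LB_dotv => i; [exact: LB_avg|exact: LB_cst].
have LG E e : LB (G E e).
  apply: LB_mul; first exact: LB_norm.
  apply: LB_dotv => i; last exact: LB_v.
  by under eq_fun do rewrite !mxE; apply: LB_sub; [exact: LB_v|exact: LB_ext].
have LSG E e : LB (fun x => \1_(S E e) x * G E e x).
  exact: LB_mul (LB_indic (measurable_lt0 (Lavg E e))) (LG E e).
have Ljw e : LB (fun x => dotv (jump e w x) (nrm e)).
  by apply: LB_dotv => i; [exact: LB_jump|exact: LB_cst].
have LjF e : LB (fun x => dotv (jump e (fun E x => q E x *: w E x) x) (nrm e)).
  by apply: LB_dotv => i; [apply/LB_jump/C1v_scale|exact: LB_cst].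
have LF E : LB (fun x => dotv (mulv (bjac v E x) (w E x)) (v E x)).
  apply: LB_dotv => i; last exact: LB_v.
  rewrite (_ : (fun x => _) = fun x => \sum_j w E x 0 j * bjac v E x i j).
    by apply: LB_sum => j _; apply: LB_mul; [exact: LB_v|exact: LB_bjac].
  by apply/funext => x; rewrite mxE; apply: eq_bigr => j _; rewrite mxE.
(* Pointwise, [(w . grad v) . v + 1/2 (div w) |v|^2] is half the divergence of [|v|^2 w]. *)
have volE : \sum_E (elt_int E (fun x => dotv (mulv (bjac v E x) (w E x)) (v E x))
      + 2^-1 * elt_int E (fun x => bdiv w E x * dotv (v E x) (v E x))) =
    2^-1 * \sum_e face_int e (fun x => dotv (jump e (fun E x => q E x *: w E x) x) (nrm e)).
  rewrite -gauss_mesh; last exact: C1v_scale.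
  rewrite mulr_sumr; apply: eq_bigr => E _.
  have Lb : LB (fun x => bdiv w E x * q E x).
    by apply: LB_mul; [exact: LB_bdiv|exact: C1L_LB].
  rewrite -[X in _ + X]elt_intZ// -elt_intD//; last exact: LB_scale.
  rewrite -elt_intZ; last exact/LB_bdiv/C1v_scale.
  congr elt_int; apply/funext => x; rewrite bdiv_scale// mulrDr addrC; congr (_ + _).
  rewrite /dotv mulr_sumr.
  under eq_bigr => i _ do rewrite mxE mulr_suml.
  rewrite exchange_big; apply: eq_bigr => j _ /=.
  rewrite mxE /q partial_sum; last by move=> i _; apply: C1LM; exact: Cv.
  rewrite mulrCA mulr_sumr mulr_sumr; apply: eq_bigr => i _.
  have [_ _ dv _] := Cv E i.
  by rewrite !mxE partialM//; field.
rewrite /a_C volE.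
have -> : \sum_E \sum_(e | adj E e) surface_int (nrm e) (off e) (inflow E e w) (G E e) =
    \sum_E \sum_(e | adj E e) face_int e (fun x => \1_(S E e) x * G E e x).
  by apply: eq_bigr => E _; apply: eq_bigr => e _; rewrite surface_int_indic.
rewrite sum_adj -mulrBr -sumrB mulr_sumr -big_split /=; apply: sumr_ge0 => e _.
rewrite -face_intB//; last by apply: LB_mul => //; exact: LB_avgs.
have Ldiff := LB_sub (LjF e) (LB_mul (Ljw e) (LB_avgs e Cq)).
rewrite -face_intZ//; have LZ := LB_scale 2^-1 Ldiff.
(* On a boundary face [[q w] = {q} [w]], so the volume contribution cancels; the outer trace being
   0, the upwind term is [|{w}.n| |v|^2] on the inflow part. *)
case e2 : (elt2 e) => [E2|]; last first.
  rewrite addr0 -face_intD//; apply: face_int_ge0 => x.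
  rewrite [X in 2^-1 * X](_ : _ = 0) ?mulr0 ?add0r; last first.
    by rewrite /jump /avg e2 dotvZl /q; ring.
  rewrite /G /ext eqxx e2 subr0.
  by rewrite mulr_ge0 ?indicE// mulr_ge0// dotv_ge0.
rewrite addrA -face_intD// -face_intD//; last exact: LB_add.
apply: face_int_ge0 => x.
have s2E : dotv (avg e w x) (nrmE E2 e) = - dotv (avg e w x) (nrm e).
  by rewrite /nrmE (sgn2 e2) scaleN1r dotvNr.
have s1E : dotv (avg e w x) (nrmE (elt1 e) e) = dotv (avg e w x) (nrm e).
  by rewrite /nrmE sgn1 scale1r.
have ind E (a : R) : dotv (avg e w x) (nrmE E e) = a -> \1_(S E e) x = (a < 0)%R%:R :> R.
  move=> <-; rewrite indicE; congr (nat_of_bool _)%:R.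
  by apply/idP/idP; rewrite inE.
have e12 : (elt1 e == E2) = false.
  by apply/eqP => e1; apply: (@elt2_neq e); rewrite e2 e1.
rewrite (ind _ _ s1E) (ind _ _ s2E) /G s1E s2E /ext eqxx e12 e2.
have := dotv_ge0 (v (elt1 e) x - v E2 x).
rewrite /jump /avg e2 /q /GRing.scale /= !(dotvDl, dotvNl, dotvZl, dotvDr, dotvNr, dotvZr).
rewrite (dotvC (v E2 x) (v (elt1 e) x)).
move: (dotv (v (elt1 e) x) _) (dotv (v E2 x) (v E2 x)) (dotv (v (elt1 e) x) (v (elt1 e) x)).
move: (dotv (w (elt1 e) x) _) (dotv (w E2 x) _) => w1 w2 m b a h.
have [s0|s0|s0] := ltgtP (2^-1 * (w1 + w2)) 0.
- rewrite ltr0_norm// oppr_lt0 ltNge (ltW s0) /=; nra.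
- rewrite normrN gtr0_norm// oppr_lt0 s0 /=; nra.
- rewrite s0 oppr0 ltxx /=; nra.
Qed.

End mesh_theory.

(** * Classical derivatives as weak derivatives *)

Section weak_derivative.
Context {R : realType} {d : nat}.
Local Notation pt := 'rV[R]_d.
Local Notation leb := (lebesgue_rV R d).

Lemma partial_near0 (f : pt -> R) j x : (\forall y \near x, f y = 0) -> partial j f x = 0.
Proof.
move=> f0; apply: cvg_lim => //; apply: cvg_near_cst.
have fx : f x = 0 by exact: nbhs_singleton f0.
have /nbhs_ballP[e /= e0 fe] := f0.
near=> h; rewrite /= fx subr0 (fe _ _) ?scaler0//; split => // i k.
rewrite (ord1 i) /ball/= !mxE eqxx /= [_ + x 0 k]addrC opprD addNKr normrN normrM normr_nat.
apply: (@le_lt_trans _ _ `|h|); first by rewrite ler_piMr// lern1 leq_b1.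
by near: h; exact: dnbhs0_lt.
Unshelve. all: by end_near. Qed.

(** The larger cube contains the supports of [f] and of its translates by at most 1, so by
    translation invariance all the difference quotients have integral zero. *)
Lemma int_partial_eq0 (f : pt -> R) (j : 'I_d) r : LB f ->
  (forall x, derivable f x (delta_mx 0 j)) -> LB (partial j f) ->
  (forall x, ~ bx r x -> f x = 0) ->
  \int[leb]_(x in bx (r + 1)) partial j f x = 0.
Proof.
move=> Lf df Ldf f0.
have mr s : measurable (bx s : set pt) by exact: measurable_bx.
have br s : bdd (bx s : set pt) by exact: bdd_bx.
have := cvg_difference_quotient Lf df Ldf (mr (r + 1)) (br (r + 1)).
rewrite (_ : (fun k : nat => _) = fun=> 0); last first.
  apply/funext => k; set h : R := k.+1%:R^-1.
  rewrite LB_RintegralB//; last by under eq_fun do rewrite addrC; exact: LB_shift.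
  have rr : bx r `<=` (bx (r + 1) : set pt) by apply: bx_sub; rewrite lerDl.
  have -> : \int[leb]_(x in bx (r + 1)) f x = \int[leb]_(x in bx r) f x.
    rewrite (Rintegral_sub _ rr); apply: eq_Rintegral => x _; rewrite indicE.
    by case: (boolP (_ \in _)) => [_|/negP]; rewrite ?mul1r// inE => /f0 ->; rewrite mulr0.
  rewrite (LB_Rintegral_shift (h *: delta_mx 0 j) Lf (mr r) (br r)).
  have sub : [set x | bx r (x + h *: delta_mx 0 j)] `<=` (bx (r + 1) : set pt).
    move=> x /= xr; rewrite -[x](addrK (h *: delta_mx 0 j)); apply: bx_add => //.
    rewrite -scaleNr; apply: bx_sub (bx_delta (- h) j).
    by rewrite normrN ger0_norm ?invr_ge0// invf_le1// ler1n.
  rewrite (Rintegral_sub _ sub) [X in _ * (_ - X)](_ : _ =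
      \int[leb]_(x in bx (r + 1)) f (h *: delta_mx 0 j + x)); last first.
    apply: eq_Rintegral => x _; rewrite indicE (addrC (h *: _)).
    case: (boolP (_ \in _)) => [_|/negP]; rewrite ?mul1r// inE => /= /f0 ->.
    by rewrite mulr0.
  by rewrite subrr mulr0.
by move=> h; apply: (cvg_unique _ h (cvg_cst _)).
Qed.

(** The product rule for [g phi] is integrated over a cube containing [U]; since the support of
    [phi] lies in [U], both the boundary contribution and the part outside [U] vanish. *)
Lemma C1L_weak_partial (U : set pt) (g : pt -> R) j : open U -> bdd U ->
  C1L g -> weak_partial U j g (partial j g).
Proof.
move=> oU [r0 Ur0] Cg phi [Cphi cphi phiU].
have [cg _ _ _] := Cg; have := C1L_LB Cg => Lg; have Ldg := C1L_partial_LB j Cg.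
have [_ cg' dg _] := Cg.
have [cp /(_ j)[dp [cdp _]]] := Cphi 1%N.
have Lp := LB_continuous cp; have Ldp := LB_continuous cdp.
set S := closure _ in cphi phiU.
have phi0 x : ~ S x -> phi x = 0.
  move=> Sx; apply: contrapT => /eqP phix; apply: Sx; exact: subset_closure.
have dphi0 x : ~ S x -> partial j phi x = 0.
  move=> Sx; apply: partial_near0.
  have oS : open (~` S) by apply: closed_openC; exact: closed_closure.
  have : \forall y \near x, (~` S) y by exact: open_nbhs_nbhs.
  by apply: filterS => y /phi0.
have mU : measurable U by exact: rV_open_measurable.
have U1 : U `<=` bx (r0 + 1) by apply: (subset_trans Ur0); apply: bx_sub; rewrite lerDl.
have bU : bdd U by exists r0.
have dF x : derivable (fun x => g x * phi x) x (delta_mx 0 j) by exact: derivableM.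
have pF := partialM (dg j) dp.
have LdF : LB (partial j (fun x => g x * phi x)).
  by rewrite pF; apply: LB_add; exact: LB_mul.
have F0 x : ~ bx r0 x -> g x * phi x = 0.
  by move=> nx; rewrite phi0 ?mulr0// => /phiU /Ur0.
have := int_partial_eq0 (LB_mul Lg Lp) dF LdF F0.
have -> : \int[leb]_(x in bx (r0 + 1)) partial j (fun x => g x * phi x) x =
   \int[leb]_(x in U) (g x * partial j phi x + partial j g x * phi x).
  rewrite (Rintegral_sub _ U1); apply: eq_Rintegral => x _; rewrite pF indicE.
  case: (boolP (_ \in _)) => [_|/negP]; rewrite ?mul1r// inE => Ux.
  by rewrite mul0r dphi0 ?phi0 ?mulr0 ?addr0// => /phiU.
rewrite LB_RintegralD//; try exact: LB_mul.
by move/eqP; rewrite addr_eq0 => /eqP.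
Qed.

Lemma LB_Lp (U : set pt) p f : LB f -> measurable U -> bdd U -> 0 <= p -> Lp U p f.
Proof.
move=> Lf mU bU p0; have [mf bf] := Lf; split; first exact: measurable_funTS.
have Lpow : LB (fun x => `|f x| `^ p).
  split.
    by apply: (measurableT_comp (measurable_powR p)); exact: measurableT_comp.
  move=> r; have [C hC] := bf r; exists (C `^ p) => x xr.
  rewrite ger0_norm ?powR_ge0// ge0_ler_powR// ?nnegrE//; last exact: hC.
  by apply: le_trans (hC x xr).
exact: (integrable_lty mU (LB_integrable Lpow mU bU)).
Qed.

End weak_derivative.

(** * Discrete fields in the broken Sobolev space *)

Section mesh_fields.
Context {R : realType} {d : nat}.
Local Notation pt := 'rV[R]_d.
Local Notation leb := (lebesgue_rV R d).
Variables (M : mesh R d) (Omega : set pt).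
Hypothesis meshP : mesh_of M Omega.
Implicit Types (E : elt M) (e : face M).

(** A null set that contains the boundary points of the cell and whose measure is immediate. *)
Definition cell_planes E : set pt :=
  \big[setU/set0]_(e | adj E e) [set x | dotv (nrm e) x = off e].

Lemma measurable_cell_planes E : measurable (cell_planes E).
Proof. by apply: bigsetU_measurable => e _; exact: measurable_plane. Qed.

Lemma cell_planes_null E : leb (cell_planes E) = 0%E.
Proof.
apply/(negligibleP leb); first exact: measurable_cell_planes.
apply: (big_ind (fun A => leb.-negligible A)); first exact: negligible_set0.
  by move=> A B; exact: negligibleU.
move=> e _; apply/negligibleP; first exact: measurable_plane.
apply: hyperplane_null; apply: contra_eq_neq (nrm_unit meshP e) => ->.
by rewrite dot0v eq_sym oner_eq0.
Qed.

Lemma dotv_continuous (a : pt) : continuous (dotv a).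
Proof.
have : C1L (dotv a).
  by apply: C1L_sum => i _; apply: C1LM; [exact: C1L_cst|exact: C1L_coord].
by case.
Qed.

Lemma cell_interior E x : cell E x -> ~ cell_planes E x -> interior (cell E) x.
Proof.
move=> cx nx; rewrite /interior /=.
have near_e e : \forall y \near x, adj E e -> dotv (nrmE E e) y <= sgn E e * off e.
  have [ae|nae] := boolP (adj E e); last first.
    by apply: (@nearW _ (nbhs x)).
  have xe : dotv (nrmE E e) x < sgn E e * off e.
    rewrite lt_neqAle cx// andbT; apply/eqP; rewrite dotvZl => xe; apply: nx.
    rewrite /cell_planes (bigD1 e)//=; left.
    have := congr1 (fun t => sgn E e * t) xe.
    by rewrite /= !mulrA sgn_sqr !mul1r.
  have : \forall y \near x, dotv (nrmE E e) y < sgn E e * off e.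
    by apply: (cvgr_lt _ (@dotv_continuous (nrmE E e) x)).
  by apply: filterS => y /ltW yh _.
apply: (@filterS _ (nbhs x) _ _ _ _ (@filter_forall _ _
  (fun e y => adj E e -> dotv (nrmE E e) y <= sgn E e * off e) (nbhs x) _ near_e)).
by move=> y h e; exact: h.
Qed.

(** The absence of cracks enters here: a cell is known to lie in [closure Omega] only, and the
    interior of that closure is [Omega]. *)
Lemma interior_cell_Omega E : polyhedral_domain Omega -> interior (cell E) `<=` Omega.
Proof.
case=> _ _ _ _ [iO _] x xE; rewrite -iO; apply: interiorS xE.
by case: meshP => _ _ _ [_ <-] _ y yE; exists E.
Qed.

Lemma bdd_interior E : bdd (interior (cell E)).
Proof. by apply: bdd_sub (bdd_cell meshP E); exact: interior_subset. Qed.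

Lemma measurable_interior_cell E : measurable (interior (cell E)).
Proof. by apply: rV_open_measurable; exact: open_interior. Qed.

Lemma elt_int_interior E (f : pt -> R) :
  elt_int E f = \int[leb]_(x in interior (cell E)) f x.
Proof.
rewrite /elt_int Rintegral_mkcond [RHS]Rintegral_mkcond.
apply: (Rintegral_null (measurable_cell_planes E) (cell_planes_null E)).
move=> x _ nx; rewrite /patch; case: (boolP (x \in cell E)).
  by rewrite inE => cx; rewrite mem_set//; exact: cell_interior.
rewrite notin_setE => ncx; rewrite memNset// => /interior_subset.
by [].
Qed.

Lemma in_Xh_C1v k v : in_Xh k v -> C1v (M := M) v.
Proof. by move=> Xv E i; exact: C1L_poly (Xv E i). Qed.

Lemma in_Mh_C1s k q : in_Mh k q -> C1s (M := M) q.
Proof. by move=> Mq E; exact: C1L_poly (Mq E). Qed.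

Lemma in_Mh_bdiv k l v : (k.-1 <= l)%N -> in_Xh (M := M) k v -> in_Mh l (bdiv v).
Proof.
move=> kl Xv E; rewrite (_ : bdiv v E = fun x => \sum_j partial j (fun y => v E y 0 j) x).
  by apply: poly_fun_sum => j _; apply: poly_funW kl _; exact/partial_poly/Xv.
by apply/funext => x; rewrite /bdiv divgE.
Qed.

Lemma in_Xh_bgrad k l q : (k.-1 <= l)%N -> in_Mh (M := M) k q -> in_Xh l (bgrad q).
Proof.
move=> kl Mq E j; rewrite (_ : (fun x => _) = partial j (q E)).
  by apply: poly_funW kl _; exact/partial_poly/Mq.
by apply/funext => x; rewrite mxE.
Qed.

Lemma C1L_Ck1 f : C1L f -> Ck 1 (f : pt -> R).
Proof. by case=> _ cf df dcf; split => //; move=> j; split => //; split => //; exact: dcf. Qed.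

(** Gives access to the Poincaré inequality, which is assumed on the broken Sobolev space, for
    discrete velocities. *)
Lemma in_Xh_in_X k v : in_Xh (M := M) k v -> in_X v (bjac v).
Proof.
move=> Xv E i f Df.
have Pf : poly_fun k f by exact: Xv.
have Cf : C1L f by exact: C1L_poly Pf.
have DfE : Df = fun j => partial j f.
  by apply/funext => j; apply/funext => x; rewrite /Df /bjac mxE.
have mU := measurable_interior_cell E; have bU := bdd_interior E.
have oU : open (interior (cell E)) by exact: open_interior.
have CDf j : C1L (Df j) by rewrite DfE; exact: C1L_poly (partial_poly j Pf).
have p0 : 0 <= (2 * d)%:R / d.+1%:R :> R by rewrite divr_ge0.
split.
- by case: (C1L_LB Cf).
- by apply: LB_Lp => //; exact: C1L_LB.
- split.
  + by apply: LB_Lp => //; exact: C1L_LB.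
  + move=> j; split; first by apply: LB_Lp => //; exact: C1L_LB.
    by rewrite DfE; exact: C1L_weak_partial.
  + move=> j l; exists (partial l (Df j)); split.
      by apply: LB_Lp => //; exact: C1L_partial_LB.
    exact: C1L_weak_partial.
(* A polynomial is its own smooth approximation: the constant sequence realizes the trace. *)
- exists (fun=> f); split.
  + by move=> _; exact: C1L_Ck1.
  + rewrite (_ : (fun k : nat => _) = fun=> 0%E); first exact: cvg_cst.
    by apply/funext => _; rewrite integral0_eq// => x _; rewrite subrr normr0.
  + move=> j; rewrite (_ : (fun k : nat => _) = fun=> 0%E); first exact: cvg_cst.
    by apply/funext => _; rewrite integral0_eq// => x _; rewrite DfE subrr normr0.
  + move=> e _; rewrite (_ : (fun k : nat => _) = fun=> 0%E); first exact: cvg_cst.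
    by apply/funext => _; rewrite integral0_eq// => x _; rewrite subrr normr0.
Qed.

Lemma poly_elt_eq0 k E (q : pt -> R) : poly_fun k q ->
  elt_int E (fun x => q x * q x) = 0 -> q = fun=> 0.
Proof.
move=> Pq q0; have [_ cq _ _] := C1L_poly Pq.
have [_ [x xE]] : bounded_set (cell E) /\ interior (cell E) !=set0.
  by case: meshP => _ /(_ E).
apply: (poly_fun_eq0 Pq (@open_interior _ (cell E))); first by exists x.
exact: (Rintegral_sqr_eq0 cq (measurable_cell E) (bdd_cell meshP E)
  (@open_interior _ (cell E)) (@interior_subset _ (cell E)) q0).
Qed.

Lemma sdot_eq0 k q : in_Mh (M := M) k q -> sdot q q = 0 -> q = fun _ _ => 0.
Proof.
move=> Mq /eqP; rewrite psumr_eq0 => [/allP h|E _]; last first.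
  by apply: elt_int_ge0 => x; rewrite -expr2 sqr_ge0.
apply/funext => E; apply: (poly_elt_eq0 (Mq E) (E := E)).
by apply/eqP; have := h E (mem_index_enum _).
Qed.


(** * Square-integrable data tested on the cells *)

Section square_integrable.
Hypothesis OmegaP : polyhedral_domain Omega.
Variables (g : pt -> pt) (g_L2 : L2vec Omega g).

Let mOmega : measurable Omega.
Proof. by case: OmegaP => oO _ _ _ _; exact: rV_open_measurable. Qed.

Let sqr_integrable i : leb.-integrable Omega (EFin \o (fun x => g x 0 i ^+ 2)).
Proof.
have [mg g2] := g_L2 i; apply/integrableP; split.
  by apply/measurable_EFinP; exact: measurable_funX.
apply: le_lt_trans g2; rewrite le_eqVlt; apply/orP; left; apply/eqP.
apply: eq_integral => x _; rewrite /= ger0_norm ?sqr_ge0//.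
by rewrite (powR_mulrn 2)// real_normK// num_real.
Qed.

Lemma integrable_Rsum (D : set pt) I (s : seq I) (P : pred I) (F : I -> pt -> R) :
  measurable D -> (forall i, P i -> leb.-integrable D (EFin \o F i)) ->
  leb.-integrable D (EFin \o (fun x => \sum_(i <- s | P i) F i x)).
Proof.
move=> mD iF; have := integrable_sum mD s iF.
apply: eq_integrable => // x _.
by rewrite /= sumEFin.
Qed.

Lemma Rintegral_Rsum (D : set pt) I (s : seq I) (P : pred I) (F : I -> pt -> R) :
  measurable D -> (forall i, P i -> leb.-integrable D (EFin \o F i)) ->
  \int[leb]_(x in D) (\sum_(i <- s | P i) F i x) =
  \sum_(i <- s | P i) \int[leb]_(x in D) F i x.
Proof.
move=> mD iF; elim: s => [|i s IH].
  under eq_Rintegral do rewrite big_nil.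
  by rewrite big_nil Rintegral_cst// mul0r.
under eq_Rintegral do rewrite big_cons; rewrite big_cons.
have [Pi|_] := boolP (P i) => //; rewrite RintegralD ?IH//; first exact: iF.
exact: integrable_Rsum.
Qed.

Let dot_integrable : leb.-integrable Omega (EFin \o (fun x => dotv (g x) (g x))).
Proof.
by apply: integrable_Rsum => // i _; under eq_fun do rewrite -expr2; exact: sqr_integrable.
Qed.

Let sub_integrable E f : leb.-integrable Omega (EFin \o f) ->
  leb.-integrable (interior (cell E)) (EFin \o f).
Proof.
apply: integrableS => //; first exact: measurable_interior_cell.
exact: interior_cell_Omega.
Qed.

Lemma L2norm_sqr : L2norm Omega g ^+ 2 = \int[leb]_(x in Omega) dotv (g x) (g x).
Proof. by rewrite sqr_sqrtr// Rintegral_ge0// => x _; exact: dotv_ge0. Qed.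

(** The interiors of the cells are disjoint parts of [Omega], so their indicators add up to at most
    1. This direction suffices for upper bounds by the data. *)
Lemma sum_cells_le_L2norm : vdot (fun _ : elt M => g) (fun=> g) <= L2norm Omega g ^+ 2.
Proof.
rewrite L2norm_sqr /vdot; under eq_bigr do rewrite elt_int_interior.
under eq_bigr => E _ do
  rewrite (Rintegral_sub _ (interior_cell_Omega (E := E) OmegaP)).
rewrite -Rintegral_Rsum//; last first.
  move=> E _; apply: (le_integrable mOmega _ _ dot_integrable).
    apply/measurable_EFinP/measurable_funM; last first.
      by apply/measurable_EFinP; case/integrableP : dot_integrable.
    by apply: measurable_indic; exact: measurable_interior_cell.
  move=> x _; rewrite /= lee_fin normrM ler_piMl// indicE ger0_norm//.
  by rewrite lern1 leq_b1.
apply: le_Rintegral => //.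
  apply: integrable_Rsum => // E _; apply: (le_integrable mOmega _ _ dot_integrable).
    apply/measurable_EFinP/measurable_funM; last first.
      by apply/measurable_EFinP; case/integrableP : dot_integrable.
    by apply: measurable_indic; exact: measurable_interior_cell.
  move=> x _; rewrite /= lee_fin normrM ler_piMl// indicE ger0_norm//.
  by rewrite lern1 leq_b1.
move=> x _; rewrite -mulr_suml ler_piMl ?dotv_ge0//.
have [[E xE]|nE] := pselect (exists E, interior (cell E) x); last first.
  rewrite big1// => E _; rewrite indicE memNset// => xE; apply: nE.
  by exists E.
rewrite (bigD1 E)//= big1 ?addr0 => [|F FE].
  by rewrite indicE lern1 leq_b1.
rewrite indicE memNset// => xF; case: meshP => _ _ _ [/(_ F E FE) + _] _.
by move=> /seteqP[/(_ x) h _]; exact: h.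
Qed.

(* Outside [Omega] nothing is known about [g], hence the detour through the
   interiors of the elements. *)
Lemma vdot_young (v : bvec M) a : C1v v -> 0 < a ->
  2 * vdot (fun=> g) v <= a^-1 * L2norm Omega g ^+ 2 + a * vdot v v.
Proof.
move=> Cv a0.
apply: (@le_trans _ _ (a^-1 * vdot (fun _ : elt M => g) (fun=> g) + a * vdot v v)); last first.
  by rewrite lerD2r ler_wpM2l ?invr_ge0 ?(ltW a0)// sum_cells_le_L2norm.
rewrite /vdot !mulr_sumr -big_split /=; apply: ler_sum => E _.
rewrite !elt_int_interior; have mU := measurable_interior_cell E.
have bU := bdd_interior E.
have ig := sub_integrable E dot_integrable.
have iv : leb.-integrable (interior (cell E)) (EFin \o (fun x => dotv (v E x) (v E x))).
  by apply: LB_integrable => //; apply: LB_dotv => i; exact: LB_v.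
have igv : leb.-integrable (interior (cell E)) (EFin \o (fun x => dotv (g x) (v E x))).
  apply: integrable_Rsum => // i _.
  have Lv : LB (fun x => v E x 0 i ^+ 2) by apply/C1L_LB/C1LX/Cv.
  have i2 := sub_integrable E (sqr_integrable i).
  have iv2 := LB_integrable Lv mU bU.
  apply: (le_integrable mU _ _ (integrableD mU i2 iv2)).
    apply/measurable_EFinP/measurable_funM.
      have [mg _] := g_L2 i; apply: measurable_funS mg => //.
      exact: interior_cell_Omega.
    by apply: measurable_funTS; case: (LB_v E i Cv).
  move=> x _; rewrite /= lee_fin [leRHS]ger0_norm ?addr_ge0 ?sqr_ge0//.
  by rewrite ler_norml; apply/andP; split; nra.
rewrite -!RintegralZl// -RintegralD//; last 2 first.
- exact: (integrableZl mU a^-1 ig).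
- exact: (integrableZl mU a iv).
apply: le_Rintegral => //.
- exact: (integrableZl mU 2 igv).
- exact: (integrableD mU (integrableZl mU a^-1 ig) (integrableZl mU a iv)).
move=> x _.
have := dotv_ge0 (g x - a *: v E x).
rewrite !(dotvDl, dotvDr, dotvNl, dotvNr, dotvZl, dotvZr) (dotvC (v E x)) => h.
rewrite -(ler_pM2l a0) [leRHS]mulrDr [a * (a^-1 * _)]mulrA divff ?gt_eqF// mul1r.
by move: h; set A := dotv (g x) (g x); set B := dotv (g x) _; set C := dotv (v E x) _ => h; lra.
Qed.

End square_integrable.

End mesh_fields.

(** * Discrete forms and lift operators *)

(** By Lagrange's identity, the double sum of [(x i - x j)^2] is twice the difference of the two
    sides. *)
Lemma sqr_sum_le (R : realDomainType) (I : finType) (x : I -> R) :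
  (\sum_i x i) ^+ 2 <= #|I|%:R * \sum_i x i ^+ 2.
Proof.
have : 0 <= \sum_i \sum_j (x i - x j) ^+ 2.
  by do 2!(apply: sumr_ge0 => ? _); exact: sqr_ge0.
have inner i : \sum_j (x i - x j) ^+ 2 =
    #|I|%:R * x i ^+ 2 - 2 * (\sum_j x j) * x i + \sum_j x j ^+ 2.
  transitivity (\sum_j (x i ^+ 2 + - (2 * x i) * x j + x j ^+ 2)).
    by apply: eq_bigr => j _; ring.
  by rewrite !big_split /= sumr_const -mulr_natl -mulr_sumr; ring.
rewrite (eq_bigr _ (fun i _ => inner i)) !big_split /= sumrN -!mulr_sumr sumr_const.
rewrite -[X in _ + X]mulr_natl.
have -> : #|I|%:R * (\sum_i x i ^+ 2) - 2 * (\sum_i x i) * (\sum_i x i) +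
    #|I|%:R * \sum_i x i ^+ 2 = 2 * (#|I|%:R * \sum_i x i ^+ 2 - (\sum_i x i) ^+ 2).
  by ring.
by rewrite pmulr_rge0// subr_ge0.
Qed.

Section broken_riesz.
Context {R : realType} {d : nat}.
Local Notation pt := 'rV[R]_d.
Local Notation leb := (lebesgue_rV R d).
Variables (Y : finType) (C : Y -> set pt) (k : nat).
Hypotheses (mC : forall y, measurable (C y)) (bC : forall y, bdd (C y)).
Hypothesis pos : forall y q, poly_fun k q ->
  \int[leb]_(x in C y) (q x * q x) = 0 -> q = fun=> 0.
Variable l : (Y -> pt -> R) -> R.
Hypothesis l_lin : forall (J : finType) (c : J -> R) (e : J -> Y -> pt -> R),
  (forall j y, poly_fun k (e j y)) ->
  l (fun y x => \sum_j c j * e j y x) = \sum_j c j * l (e j).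

Local Notation B q r := (\sum_y \int[leb]_(x in C y) (q y x * r y x)).
Local Notation J := (Y * {ffun 'I_d -> 'I_k.+1})%type.

(** Exponents of too large total degree are kept, with the value 0, so that the index set is a plain
    product type; the family spans but is not a basis. *)
Let base (j : J) (y : Y) (x : pt) : R :=
  if (y == j.1) && (\sum_i j.2 i <= k)%N then monomial (fun i => j.2 i : nat) x else 0.

Let poly_base j y : poly_fun k (base j y).
Proof.
rewrite /base.
case: (boolP ((y == j.1) && (\sum_i j.2 i <= k)%N)) => [/andP[_ h]|_].
  exact: poly_fun_monomial.
exact: poly_fun0.
Qed.

Let LB_base j y : LB (base j y).
Proof. exact/C1L_LB/C1L_poly/poly_base. Qed.

Let comb (c : J -> R) : Y -> pt -> R := fun y x => \sum_j c j * base j y x.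

Let poly_comb c y : poly_fun k (comb c y).
Proof. by apply: poly_fun_sum => j _; exact/poly_funZ/poly_base. Qed.

Let combP q : (forall y, poly_fun k (q y)) -> exists c, q = comb c.
Proof.
move=> Pq; have /choice[c cq] : forall y, exists c : {ffun 'I_d -> 'I_k.+1} -> R,
    q y = fun x => \sum_(a : {ffun 'I_d -> 'I_k.+1} | (\sum_i a i <= k)%N)
      c a * monomial (fun i => a i : nat) x.
  by move=> y; exact/poly_funE/Pq.
exists (fun j => c j.1 j.2); apply/funext => y; apply/funext => x.
rewrite /comb -(pair_bigA _ (fun y' a => c y' a * base (y', a) y x)) /=.
rewrite (bigD1 y)//= [X in _ + X]big1 ?addr0 => [|y' yy'].
  rewrite cq big_mkcond; apply: eq_bigr => a _; rewrite /base /= eqxx /=.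
  by case: ifP; rewrite ?mulr0.
by rewrite big1// => a _; rewrite /base /= eq_sym (negbTE yy') mulr0.
Qed.

Let B_comb c c' : B (comb c) (comb c') =
  \sum_i \sum_j c i * c' j * B (base i) (base j).
Proof.
under [RHS]eq_bigr => i _ do under eq_bigr => j _ do rewrite mulr_sumr.
under [RHS]eq_bigr => i _ do rewrite exchange_big.
rewrite [RHS]exchange_big; apply: eq_bigr => y _ /=.
have Lij i j : LB (fun x => c i * c' j * (base i y x * base j y x)).
  by apply/LB_scale/LB_mul.
transitivity (\int[leb]_(x in C y)
    \sum_i \sum_j c i * c' j * (base i y x * base j y x)).
  apply: eq_Rintegral => x _; rewrite /comb mulr_suml; apply: eq_bigr => i _.
  by rewrite mulr_sumr; apply: eq_bigr => j _; rewrite mulrACA.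
rewrite LB_Rintegral_sum//; last by move=> i _; exact: LB_sum.
apply: eq_bigr => i _; rewrite LB_Rintegral_sum//; apply: eq_bigr => j _.
by rewrite LB_RintegralZ//; exact: LB_mul.
Qed.

(** A null vector of the Gram matrix is a combination with zero norm on every [C y], hence zero by
    [pos], and [l] kills it. [Y] stands for the elements in the scalar lift and for the pairs of an
    element and a coordinate in the vector lift. *)
Lemma broken_riesz : exists r, (forall y, poly_fun k (r y)) /\
  forall q, (forall y, poly_fun k (q y)) -> B r q = l q.
Proof.
have l0 : l (fun _ _ => 0) = 0.
  have := l_lin (fun=> 0) poly_base; rewrite big1 => [|j _]; last by rewrite mul0r.
  move=> h; rewrite -[RHS]h; congr l; apply/funext => y; apply/funext => x.
  by rewrite big1// => j _; rewrite mul0r.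
have [|x xl] := @riesz_span R J (fun i j => B (base i) (base j)) (fun j => l (base j)).
  move=> c; rewrite -B_comb -l_lin// => cc; rewrite -[RHS]l0; congr l.
  apply/funext => y; apply: (pos (y := y)) => //; first exact: poly_comb.
  move/eqP : cc; rewrite psumr_eq0 => [/allP h|z _].
    by apply/eqP; have := h y (mem_index_enum _).
  by apply: Rintegral_ge0 => u _; rewrite -expr2 sqr_ge0.
exists (comb x); split=> [|q Pq]; first exact: poly_comb.
have [c ->] := combP Pq; rewrite B_comb exchange_big /= l_lin//.
apply: eq_bigr => j _; rewrite -xl mulr_sumr; apply: eq_bigr => i _.
by rewrite mulrCA mulrA.
Qed.

End broken_riesz.

Section forms.
Context {R : realType} {d : nat}.
Local Notation pt := 'rV[R]_d.
Local Notation leb := (lebesgue_rV R d).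
Variables (M : mesh R d) (Omega : set pt).
Hypothesis meshP : mesh_of M Omega.
Implicit Types (E : elt M) (e : face M) (q r s : bscal M) (t u v w : bvec M).

Lemma C1sD q r : C1s q -> C1s r -> C1s (fun E x => q E x + r E x).
Proof. by move=> Cq Cr E; exact: C1LD. Qed.

Lemma C1sZ a q : C1s q -> C1s (fun E x => a * q E x).
Proof. by move=> Cq E; exact: C1LZ. Qed.

Lemma C1vD v w : C1v v -> C1v w -> C1v (fun E x => v E x + w E x).
Proof. by move=> Cv Cw E i; under eq_fun do rewrite mxE; exact: C1LD. Qed.

Lemma C1vZ a v : C1v v -> C1v (fun E x => a *: v E x).
Proof. by move=> Cv E i; under eq_fun do rewrite mxE; exact: C1LZ. Qed.

Lemma sdotC q r : sdot q r = sdot r q.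
Proof. by apply: eq_bigr => E _; congr elt_int; apply/funext => x; rewrite mulrC. Qed.

Lemma vdotC v w : vdot v w = vdot w v.
Proof. by apply: eq_bigr => E _; congr elt_int; apply/funext => x; rewrite dotvC. Qed.

Lemma sdotDl q r s : C1s q -> C1s r -> C1s s ->
  sdot (fun E x => q E x + r E x) s = sdot q s + sdot r s.
Proof.
move=> Cq Cr Cs; rewrite /sdot -big_split; apply: eq_bigr => E _ /=.
rewrite -(elt_intD meshP); last 2 first.
  by apply: LB_mul; exact: C1L_LB.
  by apply: LB_mul; exact: C1L_LB.
by congr elt_int; apply/funext => x; rewrite mulrDl.
Qed.

Lemma sdotZl a q r : C1s q -> C1s r ->
  sdot (fun E x => a * q E x) r = a * sdot q r.
Proof.
move=> Cq Cr; rewrite /sdot mulr_sumr; apply: eq_bigr => E _ /=.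
rewrite -(elt_intZ meshP); last by apply: LB_mul; exact: C1L_LB.
by congr elt_int; apply/funext => x; rewrite mulrA.
Qed.

Lemma vdotDl v w t : C1v v -> C1v w -> C1v t ->
  vdot (fun E x => v E x + w E x) t = vdot v t + vdot w t.
Proof.
move=> Cv Cw Ct; rewrite /vdot -big_split; apply: eq_bigr => E _ /=.
rewrite -(elt_intD meshP); [|exact: LB_dot|exact: LB_dot].
by congr elt_int; apply/funext => x; rewrite dotvDl.
Qed.

Lemma vdotZl a v w : C1v v -> C1v w ->
  vdot (fun E x => a *: v E x) w = a * vdot v w.
Proof.
move=> Cv Cw; rewrite /vdot mulr_sumr; apply: eq_bigr => E _ /=.
rewrite -(elt_intZ meshP); last exact: LB_dot.
by congr elt_int; apply/funext => x; rewrite dotvZl.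
Qed.

Lemma sdot_ge0 q : 0 <= sdot q q.
Proof. by apply: sumr_ge0 => E _; apply: elt_int_ge0 => x; rewrite -expr2 sqr_ge0. Qed.

Lemma vdot_ge0 v : 0 <= vdot v v.
Proof. by apply: sumr_ge0 => E _; apply: elt_int_ge0 => x; exact: dotv_ge0. Qed.

Lemma snorm_sqr q : snorm q ^+ 2 = sdot q q.
Proof. by rewrite sqr_sqrtr// sdot_ge0. Qed.

Lemma vnorm_sqr v : vnorm v ^+ 2 = vdot v v.
Proof. by rewrite sqr_sqrtr// vdot_ge0. Qed.

Lemma sdot_sqrD a q r : C1s q -> C1s r ->
  sdot (fun E x => q E x + a * r E x) (fun E x => q E x + a * r E x) =
  sdot q q + 2 * a * sdot r q + a ^+ 2 * sdot r r.
Proof.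
move=> Cq Cr; have Car := C1sZ a Cr; have Cqr := C1sD Cq Car.
rewrite sdotDl// sdotZl// !(sdotC _ (fun E x => _ + _)) !sdotDl// !sdotZl//.
by rewrite (sdotC q r); ring.
Qed.

Lemma vdot_sqrD a v w : C1v v -> C1v w ->
  vdot (fun E x => v E x + a *: w E x) (fun E x => v E x + a *: w E x) =
  vdot v v + 2 * a * vdot w v + a ^+ 2 * vdot w w.
Proof.
move=> Cv Cw; have Caw := C1vZ a Cw; have Cvw := C1vD Cv Caw.
rewrite vdotDl// vdotZl// !(vdotC _ (fun E x => _ + _)) !vdotDl// !vdotZl//.
by rewrite (vdotC v w); ring.
Qed.

Lemma bgradD q r E x : C1s q -> C1s r ->
  bgrad (fun E x => q E x + r E x) E x = bgrad q E x + bgrad r E x.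
Proof.
move=> Cq Cr; apply/rowP => j; rewrite !mxE.
by have [_ _ dq _] := Cq E; have [_ _ dr _] := Cr E; rewrite partialD.
Qed.

Lemma jumpD (V : lmodType R) (q r : elt M -> pt -> V) e x :
  jump e (fun E x => q E x + r E x) x = jump e q x + jump e r x.
Proof. by rewrite /jump; case: (elt2 e) => // E2; rewrite opprD addrACA. Qed.

Lemma avgD (V : lmodType R) (q r : elt M -> pt -> V) e x :
  avg e (fun E x => q E x + r E x) x = avg e q x + avg e r x.
Proof. by rewrite /avg; case: (elt2 e) => // E2; rewrite -scalerDr addrACA. Qed.

Lemma eq_avg (V : lmodType R) (q r : elt M -> pt -> V) e x :
  (forall E, q E x = r E x) -> avg e q x = avg e r x.
Proof. by move=> qr; rewrite /avg; case: (elt2 e) => [E2|]; rewrite !qr. Qed.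

Lemma LB_avg_gen v e i : (forall E, LB (fun x => v E x 0 i)) -> LB (fun x => avg e v x 0 i).
Proof.
move=> Lv; rewrite /avg; case: (elt2 e) => [E2|]; last exact: Lv.
by under eq_fun do rewrite !mxE; apply/LB_scale/LB_add; exact: Lv.
Qed.

Let LB_avg_grad q e : C1s q -> LB (fun x => dotv (avg e (bgrad q) x) (nrm e)).
Proof.
move=> Cq; apply: LB_dotv => i; last exact: LB_cst.
by apply: LB_avg_gen => E; exact: LB_bgrad.
Qed.

Let LB_grad_dot q r E : C1s q -> C1s r ->
  LB (fun x => dotv (bgrad q E x) (bgrad r E x)).
Proof. by move=> Cq Cr; apply: LB_dotv => i; exact: LB_bgrad. Qed.

Definition ellip_grad q r : R :=
  \sum_E elt_int E (fun x => dotv (bgrad q E x) (bgrad r E x)).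

Definition ellip_flux q r : R :=
  \sum_(e | interior_face e) face_int e (fun x =>
    dotv (avg e (bgrad q) x) (nrm e) * jump e r x).

Definition ellip_pen (st : R) q r : R :=
  \sum_(e | interior_face e) st / h_face e * face_int e (fun x =>
    jump e q x * jump e r x).

Lemma a_ellipE st q r : a_ellip st q r =
  ellip_grad q r - ellip_flux q r - ellip_flux r q + ellip_pen st q r.
Proof. by []. Qed.

Lemma ellip_gradC q r : ellip_grad q r = ellip_grad r q.
Proof. by apply: eq_bigr => E _; congr elt_int; apply/funext => x; rewrite dotvC. Qed.

Lemma ellip_penC st q r : ellip_pen st q r = ellip_pen st r q.
Proof.
by apply: eq_bigr => e _; congr (_ * _); congr face_int; apply/funext => x; rewrite mulrC.
Qed.

Lemma a_ellipC st q r : a_ellip st q r = a_ellip st r q.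
Proof. by rewrite !a_ellipE ellip_gradC ellip_penC [X in X + _ = _]addrAC. Qed.

Lemma ellip_gradDl q r s : C1s q -> C1s r -> C1s s ->
  ellip_grad (fun E x => q E x + r E x) s = ellip_grad q s + ellip_grad r s.
Proof.
move=> Cq Cr Cs; rewrite -big_split; apply: eq_bigr => E _ /=.
rewrite -(elt_intD meshP); [|exact: LB_grad_dot..].
by congr elt_int; apply/funext => x; rewrite bgradD// dotvDl.
Qed.

Lemma ellip_fluxDl q r s : C1s q -> C1s r -> C1s s ->
  ellip_flux (fun E x => q E x + r E x) s = ellip_flux q s + ellip_flux r s.
Proof.
move=> Cq Cr Cs; rewrite -big_split; apply: eq_bigr => e _ /=.
rewrite -(face_intD meshP);
  [|by apply: LB_mul; [exact: LB_avg_grad|exact: LB_jumps]..].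
congr face_int; apply/funext => x; rewrite -mulrDl -dotvDl -avgD.
by congr (dotv _ _ * _); apply: eq_avg => E; exact: bgradD.
Qed.

Lemma ellip_fluxDr q r s : C1s q -> C1s r -> C1s s ->
  ellip_flux s (fun E x => q E x + r E x) = ellip_flux s q + ellip_flux s r.
Proof.
move=> Cq Cr Cs; rewrite -big_split; apply: eq_bigr => e _ /=.
rewrite -(face_intD meshP);
  [|by apply: LB_mul; [exact: LB_avg_grad|exact: LB_jumps]..].
by congr face_int; apply/funext => x; rewrite jumpD mulrDr.
Qed.

Lemma ellip_penDl st q r s : C1s q -> C1s r -> C1s s ->
  ellip_pen st (fun E x => q E x + r E x) s = ellip_pen st q s + ellip_pen st r s.
Proof.
move=> Cq Cr Cs; rewrite -big_split; apply: eq_bigr => e _ /=.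
rewrite -mulrDr -(face_intD meshP); [|by apply: LB_mul; exact: LB_jumps..].
by congr (_ * _); congr face_int; apply/funext => x; rewrite jumpD mulrDl.
Qed.

Lemma a_ellipDl st q r s : C1s q -> C1s r -> C1s s ->
  a_ellip st (fun E x => q E x + r E x) s = a_ellip st q s + a_ellip st r s.
Proof.
move=> Cq Cr Cs; rewrite !a_ellipE.
rewrite ellip_gradDl// ellip_fluxDl// ellip_fluxDr// ellip_penDl//.
move: (ellip_grad q s) (ellip_grad r s) (ellip_flux q s) (ellip_flux r s)
  (ellip_flux s q) (ellip_flux s r) (ellip_pen st q s) (ellip_pen st r s).
by move=> *; ring.
Qed.

Lemma a_ellip_sqrD st q r : C1s q -> C1s r ->
  a_ellip st (fun E x => q E x + r E x) (fun E x => q E x + r E x) =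
  a_ellip st q q + 2 * a_ellip st r q + a_ellip st r r.
Proof.
move=> Cq Cr; have Cqr := C1sD Cq Cr.
rewrite a_ellipDl// !(a_ellipC _ _ (fun E x => _ + _)) !a_ellipDl//.
rewrite (a_ellipC st q r).
by move: (a_ellip st q q) (a_ellip st r q) (a_ellip st r r) => *; ring.
Qed.

Lemma is_lift_RP k t : C1v t -> is_lift_R k t (lift_R k t).
Proof.
move=> Ct; apply: getPex.
have Ljn e : LB (fun x => dotv (jump e t x) (nrm e)).
  by apply: LB_dotv => i; [exact: LB_jump|exact: LB_cst].
have [||r [Pr rq]] := @broken_riesz R d (elt M) (@cell R d M) k
    (@measurable_cell R d M) (bdd_cell meshP) _
    (fun q => \sum_e face_int e (fun x => avg e q x * dotv (jump e t x) (nrm e))) _.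
- by move=> E q Pq h; exact: (poly_elt_eq0 meshP Pq h).
- move=> J c b Pb; under [RHS]eq_bigr do rewrite mulr_sumr.
  rewrite exchange_big; apply: eq_bigr => e _ /=.
  have Lb j : LB (fun x => avg e (b j) x * dotv (jump e t x) (nrm e)).
    by apply: LB_mul => //; apply: LB_avgs => E; exact: C1L_poly (Pb j E).
  have -> : \sum_j c j * face_int e (fun x => avg e (b j) x * dotv (jump e t x) (nrm e)) =
      face_int e (fun x => \sum_j c j * (avg e (b j) x * dotv (jump e t x) (nrm e))).
    rewrite (face_int_sum meshP); last by move=> j _; exact: LB_scale.
    by apply: eq_bigr => j _; rewrite (face_intZ meshP).
  congr face_int; apply/funext => x; under [RHS]eq_bigr do rewrite mulrA.
  rewrite -mulr_suml; congr (_ * _); rewrite /avg; case: (elt2 e) => // E2.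
  rewrite /GRing.scale /= -big_split /= mulr_sumr; apply: eq_bigr => j _.
  by rewrite -mulrDr mulrCA.
by exists r; split.
Qed.

Lemma is_lift_GP k q : C1s q -> is_lift_G k q (lift_G k q).
Proof.
move=> Cq; apply: getPex.
(* Reassembles a vector field from its scalar components, the form in which [broken_riesz] treats
   it. *)
pose vec (g : elt M * 'I_d -> pt -> R) : bvec M := fun E x => \row_i g (E, i) x.
have vecE g E x i : vec g E x 0 i = g (E, i) x by rewrite mxE.
have [||||g [Pg gt]] := @broken_riesz R d (elt M * 'I_d)%type (fun y => @cell R d M y.1) k
    _ _ _ (fun g => \sum_(e | interior_face e) face_int e (fun x =>
      dotv (avg e (vec g) x) (nrm e) * jump e q x)) _.
- by move=> y; exact: measurable_cell.
- by move=> y; exact: bdd_cell meshP _.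
- by move=> [E i] r Pr h; exact: (poly_elt_eq0 meshP Pr h).
- move=> J c b Pb; under [RHS]eq_bigr do rewrite mulr_sumr.
  rewrite exchange_big; apply: eq_bigr => e _ /=.
  have Lb j : LB (fun x => dotv (avg e (vec (b j)) x) (nrm e) * jump e q x).
    apply: LB_mul; last exact: LB_jumps.
    apply: LB_dotv => i; last exact: LB_cst.
    apply: LB_avg_gen => E; under eq_fun do rewrite vecE.
    exact: C1L_LB (C1L_poly (Pb j (E, i))).
  have -> : \sum_j c j * face_int e (fun x => dotv (avg e (vec (b j)) x) (nrm e) * jump e q x) =
      face_int e (fun x => \sum_j c j * (dotv (avg e (vec (b j)) x) (nrm e) * jump e q x)).
    rewrite (face_int_sum meshP); last by move=> j _; exact: LB_scale.
    by apply: eq_bigr => j _; rewrite (face_intZ meshP).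
  congr face_int; apply/funext => x; under [RHS]eq_bigr do rewrite mulrA -dotvZl.
  rewrite -mulr_suml; congr (_ * _).
  have -> : \sum_j dotv (c j *: avg e (vec (b j)) x) (nrm e) =
      dotv (\sum_j c j *: avg e (vec (b j)) x) (nrm e).
    rewrite /dotv exchange_big; apply: eq_bigr => i _ /=.
    by rewrite summxE mulr_suml.
  congr dotv; apply/rowP => i; rewrite summxE /avg; case: (elt2 e) => [E2|].
    rewrite !mxE -big_split /= mulr_sumr; apply: eq_bigr => j _.
    by rewrite !mxE -mulrDr mulrCA.
  by rewrite !mxE; apply: eq_bigr => j _; rewrite !mxE.
exists (vec g); split=> [E i|t Xt].
  by under eq_fun do rewrite vecE; exact: Pg.
have := gt (fun y x => t y.1 x 0 y.2) (fun y => Xt y.1 y.2).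
have -> : vec (fun y x => t y.1 x 0 y.2) = t.
  by apply/funext => E; apply/funext => x; apply/rowP => i; rewrite vecE.
move=> <-; transitivity (\sum_E \sum_i \int[leb]_(x in cell E) (g (E, i) x * t E x 0 i)).
  apply: eq_bigr => E _.
  have := elt_int_sum meshP E (index_enum 'I_d) (P := xpredT)
    (f := fun i x => g (E, i) x * t E x 0 i).
  move=> h; apply: etrans (h _).
    by congr elt_int; apply/funext => x; apply: eq_bigr => i _; rewrite vecE.
  move=> i _; apply: LB_mul; first exact: C1L_LB (C1L_poly (Pg (E, i))).
  exact: C1L_LB (C1L_poly (Xt E i)).
by rewrite pair_bigA; apply: eq_bigr => -[E i] _.
Qed.

End forms.

Section discrete_operators.
Context {R : realType} {d : nat}.
Local Notation pt := 'rV[R]_d.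
Variables (M : mesh R d) (Omega : set pt).
Hypothesis meshP : mesh_of M Omega.
Variables (k1 k2 : nat).
Hypothesis k2_range : (k1.-1 <= k2 <= k1.+1)%N.
Implicit Types (q r : bscal M) (t v w : bvec M).

Definition dg_div v : bscal M := fun E x => bdiv v E x - lift_R k2 v E x.

Definition dg_grad q : bvec M := fun E x => bgrad q E x - lift_G k1 q E x.

Lemma in_MhD q r : in_Mh k2 q -> in_Mh k2 r -> in_Mh k2 (fun E x => q E x + r E x).
Proof. by move=> Mq Mr E; exact: poly_funD. Qed.

Lemma in_MhZ a q : in_Mh k2 q -> in_Mh k2 (fun E x => a * q E x).
Proof. by move=> Mq E; exact: poly_funZ. Qed.

Lemma in_Mh_0 : in_Mh k2 (fun (_ : elt M) _ => 0).
Proof. by move=> E; exact: poly_fun0. Qed.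

Lemma in_Mh0D q r : in_Mh0 k2 q -> in_Mh0 k2 r -> in_Mh0 k2 (fun E x => q E x + r E x).
Proof.
move=> [Mq q0] [Mr r0]; split; first exact: in_MhD.
rewrite -[RHS]addr0 -[X in X + _]q0 -[X in _ + X]r0 -big_split; apply: eq_bigr => E _.
by rewrite /= (elt_intD meshP)//; apply: C1L_LB; [exact: in_Mh_C1s Mq E|exact: in_Mh_C1s Mr E].
Qed.

Lemma in_XhD v w : in_Xh k1 v -> in_Xh k1 w -> in_Xh k1 (fun E x => v E x + w E x).
Proof. by move=> Xv Xw E i; under eq_fun do rewrite mxE; exact: poly_funD (Xv E i) (Xw E i). Qed.

Lemma in_XhZ a v : in_Xh k1 v -> in_Xh k1 (fun E x => a *: v E x).
Proof. by move=> Xv E i; under eq_fun do rewrite mxE; exact: poly_funZ (Xv E i). Qed.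

(** The two bounds on [k2] have separate purposes: the lower one makes broken divergences admissible
    pressures, the upper one makes broken gradients admissible velocities in the next lemma. Hence
    [dg_div] and [dg_grad] are themselves test functions. *)
Let in_Mh_div v : in_Xh k1 v -> in_Mh k2 (bdiv v).
Proof. by case/andP: k2_range => h _; exact: in_Mh_bdiv. Qed.

Let in_Xh_grad q : in_Mh k2 q -> in_Xh k1 (bgrad q).
Proof. by case/andP: k2_range => _ h; apply: in_Xh_bgrad; case: (k2) h. Qed.

Lemma lift_RP v : in_Xh k1 v -> is_lift_R k2 v (lift_R k2 v).
Proof. by move=> Xv; apply: (is_lift_RP meshP); exact: in_Xh_C1v Xv. Qed.

Lemma lift_GP q : in_Mh k2 q -> is_lift_G k1 q (lift_G k1 q).
Proof. by move=> Mq; apply: (is_lift_GP meshP); exact: in_Mh_C1s Mq. Qed.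

Let dg_divE v : dg_div v = fun E x => bdiv v E x + -1 * lift_R k2 v E x.
Proof. by apply/funext => E; apply/funext => x; rewrite mulN1r. Qed.

Let dg_gradE q : dg_grad q = fun E x => bgrad q E x + -1 *: lift_G k1 q E x.
Proof. by apply/funext => E; apply/funext => x; rewrite scaleN1r. Qed.

Lemma in_Mh_dg_div v : in_Xh k1 v -> in_Mh k2 (dg_div v).
Proof.
move=> Xv; rewrite dg_divE; apply: in_MhD; first exact: in_Mh_div.
by apply: in_MhZ; case: (lift_RP Xv).
Qed.

Lemma in_Xh_dg_grad q : in_Mh k2 q -> in_Xh k1 (dg_grad q).
Proof.
move=> Mq; rewrite dg_gradE; apply: in_XhD; first exact: in_Xh_grad.
by apply: in_XhZ; case: (lift_GP Mq).
Qed.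

Lemma b_form_div t q : in_Xh k1 t -> in_Mh k2 q -> b_form t q = sdot (dg_div t) q.
Proof.
move=> Xt Mq; have [Mr rq] := lift_RP Xt; have Md := in_Mh_div Xt.
have Cd := in_Mh_C1s Md; have Cr := in_Mh_C1s Mr; have Cq := in_Mh_C1s Mq.
rewrite dg_divE (sdotDl meshP)//; last exact: C1sZ.
by rewrite (sdotZl meshP)// rq// mulN1r.
Qed.

Lemma b_form_grad t q : in_Xh k1 t -> in_Mh k2 q -> b_form t q = - vdot t (dg_grad q).
Proof.
move=> Xt Mq; have [Xg gt] := lift_GP Mq; have Xd := in_Xh_grad Mq.
have Cd := in_Xh_C1v Xd; have Cg := in_Xh_C1v Xg; have Ct := in_Xh_C1v Xt.
rewrite (b_form_ibp meshP Ct (in_Mh_C1s Mq)) -gt// vdotC [in RHS]vdotC dg_gradE.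
rewrite (vdotDl meshP)//; last exact: C1vZ.
by rewrite (vdotZl meshP)// mulN1r opprB addrC.
Qed.

Let jumpv v := \sum_e (h_face e)^-1 * face_int e (fun x => dotv (jump e v x) (jump e v x)).

Let jumps q := \sum_(e | interior_face e)
  (h_face e)^-1 * face_int e (fun x => jump e q x ^+ 2).

Let jumpv_ge0 v : 0 <= jumpv v.
Proof.
apply: sumr_ge0 => e _; rewrite mulr_ge0 ?invr_ge0 ?powR_ge0//.
by apply: face_int_ge0 => x; exact: dotv_ge0.
Qed.

Let jumps_ge0 q : 0 <= jumps q.
Proof.
apply: sumr_ge0 => e _; rewrite mulr_ge0 ?invr_ge0 ?powR_ge0//.
by apply: face_int_ge0 => x; exact: sqr_ge0.
Qed.

Let frob_ge0 (A : 'M[R]_d) : 0 <= frob A A.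
Proof. by do 2!(apply: sumr_ge0 => ? _); rewrite -expr2 sqr_ge0. Qed.

Let gradn v := \sum_E elt_int E (fun x => frob (bjac v E x) (bjac v E x)).

Let gradn_ge0 v : 0 <= gradn v.
Proof. by apply: sumr_ge0 => E _; apply: elt_int_ge0. Qed.

Lemma dg_norm_h_sqr sigma v : 0 <= sigma ->
  dg_norm_h sigma v ^+ 2 = gradn v + sigma * jumpv v.
Proof.
move=> s0; rewrite /dg_norm_h /dg_norm.
have -> : \sum_e sigma / h_face e * face_int e (fun x => dotv (jump e v x) (jump e v x)) =
    sigma * jumpv v.
  by rewrite /jumpv mulr_sumr; apply: eq_bigr => e _; rewrite mulrA.
by rewrite sqr_sqrtr// (addr_ge0 (gradn_ge0 v))// mulr_ge0.
Qed.

(** The divergence is the trace of the Jacobian; Cauchy-Schwarz on its [d] diagonal entries is the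
    origin of the factor [d]. *)
Lemma sdot_div_le v : C1v v -> sdot (bdiv v) (bdiv v) <= d%:R * gradn v.
Proof.
move=> Cv; rewrite /sdot /gradn mulr_sumr; apply: ler_sum => E _.
have LJ i j : LB (fun x => bjac v E x i j) by exact: LB_bjac.
have Lf : LB (fun x => frob (bjac v E x) (bjac v E x)).
  by apply: LB_sum => i _; apply: LB_sum => j _; exact: LB_mul.
rewrite -(elt_intZ meshP)//; apply: (le_elt_int meshP); last 1 first.
- move=> x; rewrite -expr2 /bdiv /divg.
  apply: le_trans (sqr_sum_le _) _; rewrite card_ord ler_wpM2l//.
  apply: ler_sum => i _; rewrite (bigD1 i)//= -expr2 lerDl.
  by apply: sumr_ge0 => j _; rewrite -expr2 sqr_ge0.
- by apply: LB_mul; exact: LB_bdiv.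
- exact: LB_scale.
Qed.

(** From [|x - y|^2 <= 2 |x|^2 + 2 |y|^2], that is [|x + y|^2 >= 0]. The lower bound on [sigma] is
    the one for which the lift costs the same factor [d] as the divergence, so the sum is [d] times
    the squared DG norm. *)
Lemma dg_div_le sigma Mk2 v : (0 < d)%N -> 0 <= sigma -> 0 <= Mk2 ->
  Mk2 ^+ 2 / d%:R <= sigma -> in_Xh k1 v ->
  snorm (lift_R k2 v) <= Mk2 * Num.sqrt (jumpv v) ->
  sdot (dg_div v) (dg_div v) <= 2 * d%:R * dg_norm_h sigma v ^+ 2.
Proof.
move=> d0 s0 M0 sM Xv Rv; have Cv := in_Xh_C1v Xv.
have [Mr _] := lift_RP Xv; have Cr := in_Mh_C1s Mr.
have Cd := in_Mh_C1s (in_Mh_div Xv).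
have d0' : 0 < d%:R :> R by rewrite ltr0n.
have rr : sdot (lift_R k2 v) (lift_R k2 v) <= d%:R * (sigma * jumpv v).
  apply: (@le_trans _ _ (Mk2 ^+ 2 * jumpv v)).
    rewrite -snorm_sqr -[X in _ * X](@sqr_sqrtr _ (jumpv v))// -exprMn.
    by rewrite ler_sqr ?nnegrE ?sqrtr_ge0// mulr_ge0// sqrtr_ge0.
  by rewrite mulrA ler_wpM2r// mulrC -ler_pdivrMr.
have dd := sdot_div_le Cv.
have := sdot_ge0 (fun E x => bdiv v E x + 1 * lift_R k2 v E x).
rewrite dg_divE !(sdot_sqrD meshP)// dg_norm_h_sqr//.
move: rr dd; move: (sdot _ _) (sdot (bdiv v) _) (sdot (lift_R k2 v) (bdiv v)) => *; lra.
Qed.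

(** Testing the lift with [bgrad q] shows that the cross term of the square is exactly the
    consistency and symmetry terms of the elliptic form. The two sides then differ only in having
    the square of the lift against the penalty. *)
Lemma dg_grad_le sigmat Mtk1 q : 0 <= sigmat -> 0 <= Mtk1 ->
  Mtk1 ^+ 2 <= sigmat -> in_Mh k2 q ->
  vnorm (lift_G k1 q) <= Mtk1 * Num.sqrt (jumps q) ->
  vdot (dg_grad q) (dg_grad q) <= a_ellip sigmat q q.
Proof.
move=> s0 M0 sM Mq Gq; have [Xg gt] := lift_GP Mq; have Xd := in_Xh_grad Mq.
have Cd := in_Xh_C1v Xd; have Cg := in_Xh_C1v Xg.
have gg : vdot (lift_G k1 q) (lift_G k1 q) <= sigmat * jumps q.
  apply: (@le_trans _ _ (Mtk1 ^+ 2 * jumps q)); last by rewrite ler_wpM2r.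
  rewrite -vnorm_sqr -[X in _ * X](@sqr_sqrtr _ (jumps q))// -exprMn.
  by rewrite ler_sqr ?nnegrE ?sqrtr_ge0// mulr_ge0// sqrtr_ge0.
have pen : ellip_pen sigmat q q = sigmat * jumps q.
  rewrite /ellip_pen /jumps mulr_sumr; apply: eq_bigr => e _.
  by rewrite mulrA; congr (_ * _); congr face_int; apply/funext => x; rewrite expr2.
have gd := gt _ Xd.
rewrite dg_gradE (vdot_sqrD meshP)// gd a_ellipE pen.
have -> : vdot (bgrad q) (bgrad q) = ellip_grad q q by [].
move: gg; rewrite -/(ellip_flux q q).
move: (vdot _ _) (ellip_grad _ _) (ellip_flux _ _) => *; lra.
Qed.

End discrete_operators.

(** * The energy estimate *)

Section energy.
Context {R : realType} {d : nat}.
Local Notation pt := 'rV[R]_d.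
Variables (M : mesh R d) (Omega : set pt).
Hypotheses (meshP : mesh_of M Omega) (OmegaP : polyhedral_domain Omega).
Hypothesis d_gt0 : (0 < d)%N.
Variables (k1 k2 : nat).
Hypothesis k2_range : (k1.-1 <= k2 <= k1.+1)%N.
Variables (mu sigma sigmat eps kappa Mk2 Mtk1 CP delta tau : R).
Hypotheses (mu_gt0 : 0 < mu) (sigma_gt0 : 0 < sigma) (sigmat_gt0 : 0 < sigmat).
Hypotheses (kappa_gt0 : 0 < kappa) (Mk2_gt0 : 0 < Mk2) (Mtk1_gt0 : 0 < Mtk1).
Hypotheses (delta_gt0 : 0 < delta) (tau_gt0 : 0 < tau).
Hypothesis a_eps_coercive : forall t : bvec M, in_Xh k1 t ->
  kappa * dg_norm_h sigma t ^+ 2 <= a_eps sigma eps t t.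
Hypothesis lift_R_bound : forall t : bvec M, in_Xh k1 t ->
  snorm (lift_R k2 t) <=
  Mk2 * Num.sqrt (\sum_e (h_face e)^-1 *
                    face_int e (fun x => dotv (jump e t x) (jump e t x))).
Hypothesis lift_G_bound : forall q : bscal M, in_Mh k2 q ->
  vnorm (lift_G k1 q) <=
  Mtk1 * Num.sqrt (\sum_(e | interior_face e) (h_face e)^-1 *
                     face_int e (fun x => jump e q x ^+ 2)).
Hypothesis poincare : forall (t : bvec M) Dt, in_X t Dt ->
  vnorm t <= CP * dg_norm sigma t Dt.
Hypotheses (sigma_ge : Mk2 ^+ 2 / d%:R <= sigma) (sigmat_ge : Mtk1 ^+ 2 <= sigmat).
Hypothesis delta_le : delta <= kappa / (2 * d%:R).
Variables (NT : nat) (u0 : pt -> pt) (f : nat -> pt -> pt).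
Hypotheses (u0_L2 : L2vec Omega u0)
  (f_L2 : forall n, (1 <= n <= NT)%N -> L2vec Omega (f n)).
Variables (v u : nat -> bvec M) (phi p : nat -> bscal M).
Hypothesis scheme :
  pressure_correction k1 k2 mu sigma sigmat eps delta tau NT u0 f v u phi p.

Local Notation S := (S_aux k2 delta mu v).
Local Notation xi := (xi_aux k2 delta mu v p).
Local Notation Z n := (dg_div k2 (v n)).
Local Notation D n := (dg_norm_h sigma (v n) ^+ 2).
Local Notation N n := (L2norm Omega (f n) ^+ 2).

Lemma S_aux0 : S 0 = fun _ _ => 0.
Proof. by apply/funext => E; apply/funext => x; rewrite /S_aux big_geq// mulr0. Qed.

Lemma S_auxS n : S n.+1 = fun E x => S n E x + delta * mu * Z n.+1 E x.
Proof.
by apply/funext => E; apply/funext => x; rewrite /S_aux big_nat_recr//= mulrDr.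
Qed.

Lemma in_Xh_v n : (n < NT)%N -> in_Xh k1 (v n.+1).
Proof. by move=> nN; apply: (pc_v_Xh scheme). Qed.

Lemma in_Xh_u n : (n <= NT)%N -> in_Xh k1 (u n).
Proof. by case: n => [|n] nN; [exact: pc_u0_Xh scheme|exact: (pc_u_Xh scheme)]. Qed.

Lemma in_Mh_p n : (n <= NT)%N -> in_Mh k2 (p n).
Proof.
case: n => [|n] nN; last exact: (pc_p_Mh scheme).
by rewrite (pc_p0 scheme); exact: in_Mh_0.
Qed.

Lemma in_Mh0_phi n : (n < NT)%N -> in_Mh0 k2 (phi n.+1).
Proof. by move=> nN; apply: (pc_phi_Mh0 scheme). Qed.

Lemma in_Mh_Z n : (n < NT)%N -> in_Mh k2 (Z n.+1).
Proof. by move=> nN; apply: (in_Mh_dg_div meshP k2_range); exact: in_Xh_v. Qed.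

Lemma in_Mh_S n : (n <= NT)%N -> in_Mh k2 (S n).
Proof.
elim: n => [|n IH] nN; first by rewrite S_aux0; exact: in_Mh_0.
by rewrite S_auxS; apply: in_MhD; [exact/IH/ltnW|exact/in_MhZ/in_Mh_Z].
Qed.

Lemma xi_auxE n : xi n = fun E x => p n E x + S n E x.
Proof.
case: n => [|n] //; apply/funext => E; apply/funext => x.
by rewrite /xi_aux (pc_p0 scheme) S_aux0 addr0.
Qed.

(* The pressure update is designed so that the rotational correction, collected
   in [S], disappears from the increment of [xi]. *)
Lemma xi_auxS n : (n < NT)%N -> xi n.+1 = fun E x => xi n E x + phi n.+1 E x.
Proof.
move=> nN; have MS := in_Mh_S (ltnW nN); have Mp := in_Mh_p (ltnW nN).
have MZ := in_Mh_Z nN; have [Mphi _] := in_Mh0_phi nN; have Mp1 := in_Mh_p nN.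
(* The residual of the pressure update. It belongs to the discrete pressure space and is orthogonal
   to it, so testing it with itself makes the update hold pointwise. *)
pose w : bscal M := fun E x =>
  p n.+1 E x + -1 * (p n E x + (phi n.+1 E x + - (delta * mu) * Z n.+1 E x)).
have Mr : in_Mh k2 (fun E x => phi n.+1 E x + - (delta * mu) * Z n.+1 E x).
  by apply: in_MhD => //; exact: in_MhZ.
have Mr' := in_MhD Mp Mr.
have Mw : in_Mh k2 w by apply: in_MhD => //; exact: in_MhZ.
have w_orth q : in_Mh k2 q -> sdot w q = 0.
  move=> Mq; have Cq := in_Mh_C1s Mq.
  have CZ := in_Mh_C1s MZ; have Cp := in_Mh_C1s Mp; have Cp1 := in_Mh_C1s Mp1.
  have Cphi := in_Mh_C1s Mphi; have Cr := in_Mh_C1s Mr; have Cr' := in_Mh_C1s Mr'.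
  rewrite (sdotDl meshP)//; last exact: C1sZ.
  rewrite (sdotZl meshP)// (sdotDl meshP)// (sdotDl meshP)//; last exact: C1sZ.
  rewrite (sdotZl meshP)// (pc_p scheme (n := n.+1))//=.
  by rewrite (b_form_div meshP k2_range (in_Xh_v nN) Mq); ring.
have w0 := sdot_eq0 meshP Mw (w_orth _ Mw).
rewrite !xi_auxE S_auxS; apply/funext => E; apply/funext => x.
have := congr1 (fun q : bscal M => q E x) w0; rewrite /w /= => h.
by apply/eqP; rewrite -subr_eq0; apply/eqP; rewrite -[RHS]h; ring.
Qed.

(** Each increment of [xi] is a potential of zero mean; this admits [xi] as a test function in the
    potential equation. *)
Lemma in_Mh0_xi n : (n <= NT)%N -> in_Mh0 k2 (xi n).
Proof.
elim: n => [|n IH] nN; last first.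
  by rewrite xi_auxS//; apply: (in_Mh0D meshP); [exact/IH/ltnW|exact: in_Mh0_phi].
split; first exact: in_Mh_0.
rewrite big1// => E _; rewrite /elt_int (_ : (fun x => _) = fun=> 0)//.
by rewrite Rintegral_cst ?mul0r//; exact: measurable_cell.
Qed.

Lemma vdot_poincare n : (n < NT)%N -> vdot (v n.+1) (v n.+1) <= CP ^+ 2 * D n.+1.
Proof.
move=> nN; have Pn := poincare (in_Xh_in_X meshP (in_Xh_v nN)).
rewrite -vnorm_sqr -exprMn ler_sqr// nnegrE ?sqrtr_ge0//.
by apply: le_trans Pn; exact: sqrtr_ge0.
Qed.

(** The weight [kappa mu / (2 CP^2)] in Young's inequality is the one for which the Poincaré
    inequality charges [kappa mu / 2] to the viscous term. No sign of [CP] is given, and [CP = 0] is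
    treated apart. *)
Lemma forcing_le n : (n < NT)%N ->
  2 * vdot (fun=> f n.+1) (v n.+1) <=
  2 * CP ^+ 2 / (kappa * mu) * N n.+1 + kappa * mu / 2 * D n.+1.
Proof.
move=> nN; have Cv := in_Xh_C1v (in_Xh_v nN).
have Y a := vdot_young meshP OmegaP (f_L2 (n := n.+1) nN) (a := a) Cv.
have VP := vdot_poincare nN; have V0 := vdot_ge0 (v n.+1).
have km : 0 < kappa * mu by rewrite mulr_gt0.
have N0 : 0 <= N n.+1 by exact: sqr_ge0.
have D0 : 0 <= D n.+1 by exact: sqr_ge0.
have [CP0|CP0] := eqVneq CP 0; last first.
  have C2 : 0 < CP ^+ 2 by rewrite exprn_even_gt0.
  have a0 : 0 < kappa * mu / (2 * CP ^+ 2) by rewrite divr_gt0// mulr_gt0.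
  apply: le_trans (Y _ a0) _; rewrite invf_div lerD2l.
  apply: (@le_trans _ _ (kappa * mu / (2 * CP ^+ 2) * (CP ^+ 2 * D n.+1))).
    by rewrite ler_wpM2l// ltW.
  by rewrite le_eqVlt; apply/orP; left; apply/eqP; field; rewrite CP0.
have V00 : vdot (v n.+1) (v n.+1) = 0.
  by apply/eqP; rewrite eq_le V0 andbT; move: VP; rewrite CP0 expr0n mul0r.
rewrite CP0 expr0n mulr0 !mul0r add0r.
apply: (@le_trans _ _ 0); last by rewrite mulr_ge0// divr_ge0// ltW.
rewrite leNgt; apply/negP => F0.
set F := vdot _ _ in F0 Y.
have F0' : 0 < F by rewrite -(pmulr_rgt0 F (ltr0n R 2)).
(* As the velocity has zero norm, Young's inequality reads [2 F <= N / a] for all [a > 0]. This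
   weight gives [2 F <= F N / (N + 1)], impossible for [F > 0]; the summand 1 covers [N = 0]. *)
have a0 : 0 < (N n.+1 + 1) / F by rewrite divr_gt0// ltr_wpDl.
have := Y _ a0; rewrite V00 mulr0 addr0 invf_div mulrAC ler_pdivlMr ?ltr_wpDl//.
by have := mulr_ge0 (ltW F0') N0; lra.
Qed.

Local Notation a q r := (a_ellip sigmat q r).

(** Against discrete tests, [u = v - tau (grad phi - G[phi])]. In the expansion of the square the
    cross term is [- 2 tau^2 a(phi, phi)], by the potential equation, and the last square is at most
    [tau^2 a(phi, phi)], by [dg_grad_le]. *)
Lemma velocity_update n : (n < NT)%N ->
  vdot (u n.+1) (u n.+1) <=
  vdot (v n.+1) (v n.+1) - tau ^+ 2 * a (phi n.+1) (phi n.+1).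
Proof.
move=> nN; have Xv := in_Xh_v nN; have Xu := in_Xh_u nN; have [Mphi _] := in_Mh0_phi nN.
have XD := in_Xh_dg_grad meshP k2_range Mphi.
have U t : in_Xh k1 t ->
    vdot (u n.+1) t = vdot (v n.+1) t - tau * vdot t (dg_grad k1 (phi n.+1)).
  move=> Xt; rewrite (pc_u scheme (n := n.+1))//.
  by rewrite (b_form_grad meshP k2_range Xt Mphi) mulrN.
have uu := U _ Xu; have uv := U _ Xv; have uD := U _ XD.
have va : b_form (v n.+1) (phi n.+1) = - (tau * a (phi n.+1) (phi n.+1)).
  rewrite (pc_phi scheme (n := n.+1) nN (in_Mh0_phi nN)) mulrN opprK mulrA.
  by rewrite divff ?mul1r// gt_eqF.
rewrite (b_form_grad meshP k2_range Xv Mphi) in va.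
have DD := dg_grad_le meshP k2_range (ltW sigmat_gt0) (ltW Mtk1_gt0) sigmat_ge Mphi
  (lift_G_bound Mphi).
have tDD : tau ^+ 2 * vdot (dg_grad k1 (phi n.+1)) (dg_grad k1 (phi n.+1)) <=
    tau ^+ 2 * a (phi n.+1) (phi n.+1) by rewrite ler_wpM2l// sqr_ge0.
rewrite (vdotC (v _) (u _)) in uu.
rewrite uu uv uD.
have -> : vdot (v n.+1) (dg_grad k1 (phi n.+1)) = tau * a (phi n.+1) (phi n.+1).
  by apply: oppr_inj; rewrite va.
move: tDD; move: (vdot (dg_grad _ _) _) (a _ _) => *; lra.
Qed.

(** Twice the momentum equation provides [2 kappa mu tau D]. One unit of [kappa mu tau D] pays for
    the quadratic remainder of [S], half a unit for the forcing, and the other half stays on the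
    left. *)
Lemma energy_step n : (n < NT)%N ->
  vdot (u n.+1) (u n.+1) + tau ^+ 2 * a (xi n.+1) (xi n.+1)
  + (delta * mu)^-1 * tau * sdot (S n.+1) (S n.+1) + kappa * mu / 2 * tau * D n.+1 <=
  vdot (u n) (u n) + tau ^+ 2 * a (xi n) (xi n)
  + (delta * mu)^-1 * tau * sdot (S n) (S n)
  + 2 * CP ^+ 2 / (kappa * mu) * tau * N n.+1.
Proof.
move=> nN; have Xv := in_Xh_v nN; have Cv := in_Xh_C1v Xv.
have Cu := in_Xh_C1v (in_Xh_u (ltnW nN)).
have M0phi := in_Mh0_phi nN; have [Mphi _] := M0phi.
have M0xi := in_Mh0_xi (ltnW nN); have [Mxi _] := M0xi.
have MS := in_Mh_S (ltnW nN); have MZ := in_Mh_Z nN; have Mp := in_Mh_p (ltnW nN).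
have mom := pc_v scheme (n := n.+1) nN Xv; rewrite /= in mom.
have ac := a_C_ge0 meshP Cu Cv.
have ae := a_eps_coercive Xv.
(* Bounds the mixed term of the time difference: [2 (u, v) <= |u|^2 + |v|^2]. *)
have sq := vdot_ge0 (fun E x => u n E x + -1 *: v n.+1 E x).
rewrite (vdot_sqrD meshP)// (vdotC (v _) (u _)) in sq.
have bp : b_form (v n.+1) (p n) = - (tau * a (phi n.+1) (xi n)) - sdot (Z n.+1) (S n).
  have -> : - (tau * a (phi n.+1) (xi n)) = b_form (v n.+1) (xi n).
    rewrite (pc_phi scheme (n := n.+1) nN M0xi) mulrN opprK mulrA.
    by rewrite divff ?mul1r// gt_eqF.
  rewrite !(b_form_div meshP k2_range Xv)// xi_auxE.
  rewrite [in RHS](sdotC _ (fun E x => _)) (sdotDl meshP); first last.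
  - exact: in_Mh_C1s MZ.
  - exact: in_Mh_C1s MS.
  - exact: in_Mh_C1s Mp.
  by rewrite (sdotC (S n)) addrK sdotC.
have ZZ := dg_div_le meshP k2_range d_gt0 (ltW sigma_gt0) (ltW Mk2_gt0) sigma_ge Xv
  (lift_R_bound Xv).
have FF := forcing_le nN.
have UU := velocity_update nN.
rewrite bp in mom.
rewrite S_auxS (sdot_sqrD meshP); [|exact: in_Mh_C1s MS|exact: in_Mh_C1s MZ].
rewrite xi_auxS// (a_ellip_sqrD meshP); [|exact: in_Mh_C1s Mxi|exact: in_Mh_C1s Mphi].
have dm : 0 < delta * mu by rewrite mulr_gt0.
have tac : 0 <= tau * a_C (u n) (u n) (v n.+1) (v n.+1) by rewrite mulr_ge0// ltW.
have tae : tau * mu * (kappa * D n.+1) <= tau * mu * a_eps sigma eps (v n.+1) (v n.+1).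
  by rewrite ler_wpM2l// mulr_ge0// ltW.
have tFF := ler_wpM2l (ltW tau_gt0) FF.
have D0 : 0 <= D n.+1 by exact: sqr_ge0.
have tZZ : tau * (delta * mu) * sdot (Z n.+1) (Z n.+1) <= tau * mu * (kappa * D n.+1).
  apply: (@le_trans _ _ (tau * (delta * mu) * (2 * d%:R * D n.+1))).
    by rewrite ler_wpM2l// mulr_ge0// ltW.
  have d2 : 0 < 2 * d%:R :> R by rewrite mulr_gt0// ltr0n.
  have : delta * (2 * d%:R) <= kappa by rewrite -ler_pdivlMr.
  move=> /(ler_wpM2r D0)/(ler_wpM2l (ltW mu_gt0))/(ler_wpM2l (ltW tau_gt0)).
  by move: (D n.+1) (d%:R) => Dn dR h; lra.
have -> : (delta * mu)^-1 * tau * (sdot (S n) (S n) + 2 * (delta * mu) * sdot (Z n.+1) (S n)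
    + (delta * mu) ^+ 2 * sdot (Z n.+1) (Z n.+1)) =
    (delta * mu)^-1 * tau * sdot (S n) (S n) + 2 * tau * sdot (Z n.+1) (S n)
    + tau * (delta * mu) * sdot (Z n.+1) (Z n.+1).
  move: (sdot _ _) (sdot _ _) (sdot _ _) => *; field.
  by rewrite !gt_eqF.
move: mom tac tae tFF tZZ UU sq.
set C := (delta * mu)^-1 * tau * _; set K := _ / (kappa * mu).
move: C K.
move: (a_C _ _ _ _) (a_eps _ _ _ _) (vdot (fun=> f _) _) (vdot (u n) (v _)).
move: (vdot (u n) _) (vdot (u n.+1) _) (vdot (v _) _) (a (phi _) (phi _)).
move: (a (phi _) (xi _)) (a (xi _) (xi _)) (sdot (Z _) (S _)) (sdot (Z _) (Z _)).
move: (D n.+1) (N n.+1) => *; lra.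
Qed.

(** The projection is tested with itself, and Young's inequality with weight 1 takes the place of
    Cauchy-Schwarz. *)
Lemma initial_energy : vdot (u 0) (u 0) <= L2norm Omega u0 ^+ 2.
Proof.
have Cu := in_Xh_C1v (pc_u0_Xh scheme).
have := vdot_young meshP OmegaP u0_L2 Cu ltr01.
have <- : vdot (u 0) (u 0) = vdot (fun=> u0) (u 0).
  by apply: eq_bigr => E _; apply: (pc_u0 scheme); exact: (pc_u0_Xh scheme).
by rewrite invr1 !mul1r => h; lra.
Qed.

Lemma energy_sum n : (n <= NT)%N ->
  vdot (u n) (u n) + tau ^+ 2 * a (xi n) (xi n)
  + (delta * mu)^-1 * tau * sdot (S n) (S n)
  + kappa * mu / 2 * tau * \sum_(1 <= i < n.+1) D i <=
  L2norm Omega u0 ^+ 2 + 2 * CP ^+ 2 / (kappa * mu) * tau * \sum_(1 <= i < n.+1) N i.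
Proof.
elim: n => [|n IH] nN; last first.
  have := IH (ltnW nN); have := energy_step nN.
  rewrite [in X in _ -> _ -> X](big_nat_recr n.+1)//=.
  rewrite [X in _ -> _ -> _ <= _ + _ * X](big_nat_recr n.+1)//=.
  move: (\sum_(1 <= i < n.+1) D i) (\sum_(1 <= i < n.+1) N i) (D n.+1) (N n.+1).
  by move=> *; lra.
pose z : bscal M := fun _ _ => 0.
have Mz : in_Mh k2 z by exact: in_Mh_0.
have Cz := in_Mh_C1s Mz.
have z1 : (fun E x => 0 * z E x) = z.
  by apply/funext => E; apply/funext => x; rewrite mul0r.
have z2 : (fun E x => z E x + z E x) = z.
  by apply/funext => E; apply/funext => x; rewrite addr0.
rewrite !big_geq// !mulr0 !addr0 S_aux0 -/z.
have -> : xi 0 = z by [].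
have -> : sdot z z = 0 by have := sdotZl meshP 0 Cz Cz; rewrite z1 mul0r.
(* Since [z + z = z], additivity gives [a(z, z) = 2 a(z, z)], so this term of the initial energy is
   zero. *)
have := a_ellipDl meshP sigmat Cz Cz Cz; rewrite z2.
move: (a z z) initial_energy => az h az2; have -> : az = 0 by lra.
by rewrite !mulr0 !addr0.
Qed.

End energy.

Unset Implicit Arguments.
Set Strict Implicit.
Set Printing Implicit Defensive.

Theorem theorem5p3 (R : realType) (d : nat) (d23 : d = 2%N \/ d = 3%N)
  (Omega : set 'rV[R]_d) (OmegaP : polyhedral_domain Omega)
  (H : Type) (Eh : H -> mesh R d) (EhP : forall h, mesh_of (Eh h) Omega)
  (rho : R)
  (Eh_regular : forall h (E : elt (Eh h)),
     ediam (cell E) / inball_diam (cell E) <= rho)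
  (k1 k2 : nat) (k1_ge1 : (1 <= k1)%N) (k2_range : (k1.-1 <= k2 <= k1.+1)%N)
  (mu sigma sigmat eps kappa : R)
  (mu_gt0 : 0 < mu) (sigma_gt0 : 0 < sigma) (sigmat_gt0 : 0 < sigmat)
  (epsP : [\/ eps = -1, eps = 0 | eps = 1])
  (kappaE : kappa = if eps == 1 then 1 else 2^-1)
  (a_eps_coercive : forall h (t : bvec (Eh h)), in_Xh k1 t ->
     kappa * dg_norm_h sigma t ^+ 2 <= a_eps sigma eps t t)
  (a_ellip_coercive : forall h (q : bscal (Eh h)), in_Mh k2 q ->
     2^-1 * dg_seminorm sigmat q ^+ 2 <= a_ellip sigmat q q)
  (Mk2 Mtk1 CP : R) (Mk2_gt0 : 0 < Mk2) (Mtk1_gt0 : 0 < Mtk1)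
  (lift_R_bound : forall h (t : bvec (Eh h)), in_Xh k1 t ->
     snorm (lift_R k2 t) <=
     Mk2 * Num.sqrt (\sum_e (h_face e)^-1 *
                       face_int e (fun x => dotv (jump e t x) (jump e t x))))
  (lift_G_bound : forall h (q : bscal (Eh h)), in_Mh k2 q ->
     vnorm (lift_G k1 q) <=
     Mtk1 * Num.sqrt (\sum_(e | interior_face e) (h_face e)^-1 *
                        face_int e (fun x => jump e q x ^+ 2)))
  (poincare : forall h (t : bvec (Eh h)) Dt, in_X t Dt ->
     vnorm t <= CP * dg_norm sigma t Dt)
  (sigma_ge : Mk2 ^+ 2 / d%:R <= sigma)
  (sigmat_ge : Mtk1 ^+ 2 <= sigmat)
  (delta : R) (delta_gt0 : 0 < delta) (delta_le : delta <= kappa / (2 * d%:R))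
  (T : R) (T_gt0 : 0 < T) (NT : nat) (NT_gt0 : (0 < NT)%N)
  (tau : R) (tauE : tau = T / NT%:R)
  (u0 : 'rV[R]_d -> 'rV[R]_d) (u0_L2 : L2vec Omega u0)
  (f : R -> 'rV[R]_d -> 'rV[R]_d)
  (f_L2 : forall n, (1 <= n <= NT)%N -> L2vec Omega (f (n%:R * tau)))
  (h : H) (v u : nat -> bvec (Eh h)) (phi p : nat -> bscal (Eh h))
  (scheme : pressure_correction k1 k2 mu sigma sigmat eps delta tau NT u0
     (fun n => f (n%:R * tau)) v u phi p)
  (m : nat) (m_range : (1 <= m <= NT)%N) :
  vnorm (u m) ^+ 2
  + kappa * mu / 2 * tau * \sum_(1 <= n < m.+1) dg_norm_h sigma (v n) ^+ 2
  + 2^-1 * tau ^+ 2 * dg_seminorm sigmat (xi_aux k2 delta mu v p m) ^+ 2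
  + (delta * mu)^-1 * tau * snorm (S_aux k2 delta mu v m) ^+ 2
  <= L2norm Omega u0 ^+ 2
     + 2 * CP ^+ 2 / (kappa * mu) * tau *
       \sum_(1 <= n < m.+1) L2norm Omega (f (n%:R * tau)) ^+ 2.
Proof.
have d_gt0 : (0 < d)%N by case: d23 => ->.
have kappa_gt0 : 0 < kappa by rewrite kappaE; case: ifP.
have tau_gt0 : 0 < tau by rewrite tauE divr_gt0// ltr0n.
case/andP: m_range => _ mNT.
have := energy_sum (EhP h) OmegaP d_gt0 k2_range mu_gt0 sigma_gt0 sigmat_gt0 kappa_gt0
  Mk2_gt0 Mtk1_gt0 delta_gt0 tau_gt0 (a_eps_coercive h) (lift_R_bound h) (lift_G_bound h)
  (poincare h) sigma_ge sigmat_ge delta_le u0_L2 f_L2 scheme mNT.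
rewrite vnorm_sqr snorm_sqr; apply: le_trans.
have [Mxi _] := in_Mh0_xi (EhP h) k2_range scheme mNT.
have := a_ellip_coercive h _ Mxi => /(ler_wpM2l (sqr_ge0 tau)).
set X := dg_seminorm _ _ ^+ 2; set Y := a_ellip _ _ _; set Z := _^-1 * tau * _.
set W := vdot _ _; set Q := kappa * mu / 2 * tau * _; set P := tau ^+ 2.
by rewrite mulrA [P * _]mulrC => h1; lra.
Qed.
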